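(* Let $m\ge 1$ be an integer, let $\alpha,\beta\in\mathbb{C}$, and let $\varphi(z)=\overline{z}^{m}+\alpha z^m+\beta$ for $z \in \mathbb{D}$. Then the spectrum of the Toeplitz operator $T_\varphi$ on the Bergman space $L^2_a(\mathbb{D})$ is $\sigma(T_\varphi)=\overline{\varphi(\mathbb{D})}$, the closure of the image $\varphi(\mathbb{D})$ in $\mathbb{C}$.
   Context: $\mathbb{D}$ is the open unit disk in $\mathbb{C}$ and $dA$ is the normalized Lebesgue area measure on $\mathbb{D}$. The Bergman space $L^2_a(\mathbb{D})$ is the closed subspace of analytic functions in $L^2(\mathbb{D},dA)$, and $P:L^2(\mathbb{D},dA)\to L^2_a(\mathbb{D})$ is the orthogonal projection. For $\varphi\in L^\infty(\mathbb{D},dA)$ the Toeplitz operator $T_\varphi$ on $L^2_a(\mathbb{D})$ is $T_\varphi f=P(\varphi f)$. *)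

(* Defs.v *)
From HB Require Import structures.
From mathcomp Require Import all_boot all_order all_algebra.
From mathcomp Require Import ring complex.
From mathcomp Require Import all_classical all_reals all_analysis.
From mathcomp Require Import measurable_realfun.

Set Implicit Arguments.
Unset Strict Implicit.
Unset Printing Implicit Defensive.

Import Order.TTheory GRing.Theory Num.Theory.
Import numFieldNormedType.Exports.
Import ComplexField.Normc.

Local Open Scope classical_set_scope.
Local Open Scope ring_scope.
Local Open Scope complex_scope.

(* The topology of R[i] is the one induced by the modulus. *)
HB.instance Definition _ (R : realType) :=
  PseudoPointedMetric.copy R[i] (R[i]^o).
HB.instance Definition _ (R : realType) := NormedModule.copy R[i] (R[i]^o).

Section BergmanSpace.
Context {R : realType}.
Local Notation C := R[i].

Definition unit_disk : set C := [set z | `|z| < 1].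

(* Integrals over the disk are taken in the real coordinates (x, y) of
   x + i y. *)
Local Notation plane := (measurableTypeR R * measurableTypeR R)%type.

Definition cplx (p : plane) : C := (p.1 : R) +i* (p.2 : R).

Definition disk2 : set plane := cplx @^-1` unit_disk.

(* Area measure, normalized so that the unit disk has mass 1. *)
Definition dA :=
  mscale (NngNum (ltW (etrans (invr_gt0 _) (pi_gt0 R))))
    (@lebesgue_measure R \x @lebesgue_measure R)%E.

(* Elements of L^2(D, dA) are represented by functions on R[i], whose values
   outside the disk are irrelevant. *)
Definition L2_disk (f : C -> C) : Prop :=
  [/\ measurable_fun disk2 (fun p => complex.Re (f (cplx p))),
      measurable_fun disk2 (fun p => complex.Im (f (cplx p))) &
      dA.-integrable disk2 (fun p => (normc (f (cplx p)) ^+ 2)%:E)].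

Definition L2_inner (f g : C -> C) : C :=
  \int[dA]_(p in disk2) complex.Re (f (cplx p) * conjc (g (cplx p))) +i*
  \int[dA]_(p in disk2) complex.Im (f (cplx p) * conjc (g (cplx p))).

Definition L2_norm (f : C -> C) : R := Num.sqrt (complex.Re (L2_inner f f)).

(* Locally the sum of a convergent power series. *)
Definition analytic_on (U : set C) (f : C -> C) : Prop :=
  forall z0, U z0 -> exists (r : R) (a : nat -> C), 0 < r /\
    forall z, `|z - z0| < r%:C ->
      [series a k * (z - z0) ^+ k]_k @ \oo --> f z.

(* Analytic functions on the disk are extended by 0 outside of it, so that
   equality of functions on R[i] is equality of functions on the disk. *)
Definition bergman_pred : {pred (C -> C)} :=
  mem [set f : C -> C | [/\ analytic_on unit_disk f, L2_disk f &
                            forall z, ~ unit_disk z -> f z = 0]].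

Lemma measurable_disk2 : measurable disk2.
Proof.
have -> : disk2 = (fun p : plane => (p.1 : R) ^+ 2 + (p.2 : R) ^+ 2) @^-1` `]-oo, 1[.
  apply/funext => -[x y]; rewrite /disk2 /unit_disk /= /cplx /=.
  rewrite normc_def ltcR /= in_itv /=.
  by rewrite -[X in (_ < X) = _ :> Prop]sqrtr1 ltr_sqrt.
rewrite -[X in measurable X]setTI.
have mf : measurable_fun setT (fun p : plane => (p.1 : R) ^+ 2 + (p.2 : R) ^+ 2).
  by apply: measurable_funD; apply: measurable_funX;
    [exact: (@measurable_fst _ _ (measurableTypeR R) (measurableTypeR R)) |
     exact: (@measurable_snd _ _ (measurableTypeR R) (measurableTypeR R))].
by apply: mf => //; exact: measurable_itv.
Qed.

Lemma normc2E (z : C) : normc z ^+ 2 = complex.Re z ^+ 2 + complex.Im z ^+ 2.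
Proof. by case: z => x y /=; rewrite sqr_sqrtr // addr_ge0 ?sqr_ge0. Qed.

Lemma L2_disk_comb (c : C) (f g : C -> C) :
  L2_disk f -> L2_disk g -> L2_disk (fun z => c * f z + g z).
Proof.
move=> [rf If nf] [rg Ig ng].
have mRe : measurable_fun disk2 (fun p => complex.Re (c * f (cplx p) + g (cplx p))).
  rewrite (_ : (fun p => _) = (fun p => complex.Re c * complex.Re (f (cplx p)) -
    complex.Im c * complex.Im (f (cplx p)) + complex.Re (g (cplx p)))); last first.
    by apply/funext => p; move: (f _) (g _) => [? ?] [? ?]; case: (c) => ? ?.
  by apply: measurable_funD => //; apply: measurable_funB;
    apply: measurable_funM => //.
have mIm : measurable_fun disk2 (fun p => complex.Im (c * f (cplx p) + g (cplx p))).
  rewrite (_ : (fun p => _) = (fun p => complex.Re c * complex.Im (f (cplx p)) +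
    complex.Im c * complex.Re (f (cplx p)) + complex.Im (g (cplx p)))); last first.
    by apply/funext => p; move: (f _) (g _) => [? ?] [? ?]; case: (c) => ? ?.
  by apply: measurable_funD => //; apply: measurable_funD;
    apply: measurable_funM => //.
split => //.
have mD := measurable_disk2.
have ncf : dA.-integrable disk2 (fun p =>
    ((2 * normc c ^+ 2)%:E * (normc (f (cplx p)) ^+ 2)%:E)%E).
  exact: integrableZl.
have ng2 : dA.-integrable disk2 (fun p =>
    ((2 : R)%:E * (normc (g (cplx p)) ^+ 2)%:E)%E).
  exact: integrableZl.
apply: (le_integrable mD _ _ (integrableD mD ncf ng2)).
  apply/measurable_EFinP; under eq_fun do rewrite normc2E.
  by apply: measurable_funD; apply: measurable_funX.
move=> p _; rewrite -!EFinM -EFinD !abse_EFin lee_fin.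
have n0 (z : C) : 0 <= normc z by case: z => ? ?; exact: sqrtr_ge0.
rewrite !ger0_norm ?addr_ge0 ?mulr_ge0 ?sqr_ge0 ?n0 //.
rewrite -mulrA -exprMn -normcM -mulrDr; move: (c * _) (g _) => u v.
rewrite !normc2E; case: u v => [a b] [a' b'] /=.
rewrite -subr_ge0 (_ : _ - _ = (a - a') ^+ 2 + (b - b') ^+ 2); last first.
  by rewrite !sqrrD !sqrrN; ring.
by rewrite addr_ge0 ?sqr_ge0.
Qed.

Lemma analytic_comb (U : set C) (c : C) (f g : C -> C) :
  analytic_on U f -> analytic_on U g ->
  analytic_on U (fun z => c * f z + g z).
Proof.
move=> af ag z0 Uz0; have [r [a [r0 fE]]] := af _ Uz0.
have [s [b [s0 gE]]] := ag _ Uz0.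
exists (Num.min r s), (fun k => c * a k + b k); split.
  by rewrite lt_min r0.
move=> z zlt.
have zr : `|z - z0| < r%:C.
  by apply: lt_le_trans zlt _; rewrite lecR ge_min lexx.
have zs : `|z - z0| < s%:C.
  by apply: lt_le_trans zlt _; rewrite lecR ge_min lexx orbT.
rewrite (_ : [series _]_k = (fun n => c * [series a k * (z - z0) ^+ k]_k n +
    [series b k * (z - z0) ^+ k]_k n)); last first.
  apply/funext => n; rewrite /series /= mulr_sumr -big_split /=.
  by apply: eq_bigr => k _; rewrite mulrDl mulrA.
apply: cvgD; last exact: gE.
by apply: cvgM; [exact: cvg_cst | exact: fE].
Qed.

Lemma bergman_submod_closed : submod_closed bergman_pred.
Proof.
split=> [|c f g /[!inE] -[af Lf zf] [ag Lg zg]].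
  rewrite inE; split => //.
    move=> z0 _; exists 1, (fun=> 0); split => // z _.
    rewrite (_ : [series _]_k = (fun=> 0)); first exact: cvg_cst.
    by apply/funext => n; rewrite /series /= big1 // => k _; rewrite mul0r.
  split; [exact: measurable_cst | exact: measurable_cst |].
  rewrite (_ : (fun p => _) = cst 0%E); last first.
    by apply/funext => p; rewrite normc0 expr0n.
  exact: integrable0.
split.
- exact: analytic_comb.
- exact: L2_disk_comb.
- by move=> z zD; rewrite -[LHS]/(c * f z + g z) zf // zg // mulr0 addr0.
Qed.

End BergmanSpace.

HB.instance Definition _ (R : realType) :=
  GRing.isSubmodClosed.Build R[i] (R[i] -> R[i]) (@bergman_pred R)
    (@bergman_submod_closed R).

Record bergman (R : realType) := Bergman {
  bergman_fun :> R[i] -> R[i];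
  _ : bergman_fun \in @bergman_pred R
}.

HB.instance Definition _ (R : realType) :=
  [isSub for @bergman_fun R].
HB.instance Definition _ (R : realType) := [Choice of bergman R by <:].
HB.instance Definition _ (R : realType) :=
  [SubChoice_isSubLmodule of bergman R by <:].

Section Operators.
Context {R : realType}.
Local Notation C := R[i].
Local Notation L2a := (bergman R).

(* The orthogonal projection of L^2(D, dA) onto L^2_a: the g in L^2_a such
   that f - g is orthogonal to L^2_a.  Only meaningful for f in L^2(D, dA). *)
Definition bergman_proj (f : C -> C) : L2a :=
  xget 0 [set g : L2a | forall h : L2a, L2_inner (f \- g) h = 0].

(* For phi bounded and measurable on the disk, so that phi * f is in
   L^2(D, dA). *)
Definition toeplitz (phi : C -> C) (f : L2a) : L2a :=
  bergman_proj (phi \* f).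

Definition bounded_operator (S : L2a -> L2a) : Prop :=
  linear S /\ exists M : R, forall f, L2_norm (S f) <= M * L2_norm f.

(* Complement of the set of lambda for which T - lambda is invertible in the
   algebra of bounded operators on L^2_a. *)
Definition spectrum (T : L2a -> L2a) : set C :=
  [set lambda | ~ exists S : L2a -> L2a,
    [/\ bounded_operator S,
        cancel (fun f => T f - lambda *: f) S &
        cancel S (fun f => T f - lambda *: f)]].

End Operators.

(* Main.v *)
(** Writing f = sum a_n z^n identifies the Bergman space with the sequences
    such that sum |a_n|^2 / (n+1) is finite, and turns T_phi into
    B + alpha U + beta, where U is the shift by m and B its adjoint.  Put
    E(w) = conj w + alpha w, so that phi(D) = E(D) + beta.

    If lambda is at positive distance from the convex set E(D) + beta, a
    separating direction d makes conj d (lambda - T_phi) coercive, hence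
    1 + t conj d (T_phi - lambda) is a strict contraction for small t > 0 and a
    Neumann series inverts T_phi - lambda.

    Conversely, if |alpha| < 1 and |w| < 1, then B + alpha U has an eigenvector
    for E(w), supported on the indices n with m | n+1: on these the equation is
    a second order recurrence whose limiting characteristic roots, those of
    t^2 - E(w) t + alpha, lie in the open disk.  Approximating alpha covers
    |alpha| <= 1, and the adjoint covers |alpha| > 1.

    Local power series are globalized without integration: averaging over the
    four points z + i^j t shows that Re h + eps |z|^2 has no interior maximum,
    and the resulting maximum principle, applied to averages over roots of unity
    divided by z^n, gives Cauchy's estimates.  The orthogonality of the monomials
    comes from integrating (d/dx - i d/dy) ((r^2 - |z|^2) z^a conj(z)^b) = 0 over
    the disk of radius r. *)
Require Import Defs.
From HB Require Import structures.
From mathcomp Require Import all_boot all_order all_algebra.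
From mathcomp Require Import cyclic separable cyclotomic.
From mathcomp Require Import ring lra zify complex.
From mathcomp Require Import all_classical all_reals all_analysis.
From mathcomp Require Import measurable_realfun.

Set Implicit Arguments.
Unset Strict Implicit.
Unset Printing Implicit Defensive.

Import Order.TTheory GRing.Theory Num.Theory.
Import numFieldNormedType.Exports.
Import ComplexField.Normc.

Local Open Scope classical_set_scope.
Local Open Scope ring_scope.
Local Open Scope complex_scope.

Section DiskIntegral.
Context {R : realType}.
Local Notation C := R[i].
Local Notation plane := (measurableTypeR R * measurableTypeR R)%type.
Local Notation mu := (@lebesgue_measure R).

Definition disk_of_radius (r : R) : set plane :=
  [set p | (p.1 : R) ^+ 2 + (p.2 : R) ^+ 2 < r ^+ 2].

Lemma measurable_plane_sqr_norm :
  measurable_fun setT (fun p : plane => (p.1 : R) ^+ 2 + (p.2 : R) ^+ 2).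
Proof.
by apply: measurable_funD; apply: measurable_funX;
  [exact: (@measurable_fst _ _ (measurableTypeR R) (measurableTypeR R)) |
   exact: (@measurable_snd _ _ (measurableTypeR R) (measurableTypeR R))].
Qed.

Lemma measurable_disk_of_radius (r : R) : measurable (disk_of_radius r).
Proof.
have -> : disk_of_radius r =
    (fun p : plane => (p.1 : R) ^+ 2 + (p.2 : R) ^+ 2) @^-1` `]-oo, (r ^+ 2)[.
  by apply/funext => -[x y]; rewrite /disk_of_radius /= in_itv.
rewrite -[X in measurable X]setTI.
by apply: measurable_plane_sqr_norm => //; exact: measurable_itv.
Qed.

Lemma integral_mscale_eq0 (D : set plane) (g : plane -> R) :
  measurable D -> measurable_fun D g ->
  ((mu \x mu).-integrable D (EFin \o g))%E ->
  \int[(mu \x mu)%E]_(p in D) g p = 0 -> \int[dA]_(p in D) g p = 0.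
Proof.
move=> mD mg ig; rewrite /Rintegral => g0.
have mgE : measurable_fun D (EFin \o g) by exact/measurable_EFinP.
have ip := integrable_pos_fin_num mD ig.
have iN := integrable_neg_fin_num mD ig.
rewrite integralE /= ge0_integral_mscale//; last exact: measurable_funepos.
rewrite ge0_integral_mscale//; last exact: measurable_funeneg.
move: g0; rewrite integralE fineB// => /eqP; rewrite subr_eq0 => /eqP g0.
by rewrite fineB ?fin_numM// !fineM// g0 subrr.
Qed.

Lemma lebesgue_disk_of_radius_lty (r : R) :
  ((mu \x mu)%E (disk_of_radius r) < +oo)%E.
Proof.
pose I : set (measurableTypeR R) := `[- `|r|, `|r|]%classic.
have mI : measurable I by exact: measurable_itv.
have sub : disk_of_radius r `<=` I `*` I.
  move=> -[x y]; rewrite /disk_of_radius /= => xy; rewrite /I /= !in_itv /=.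
  have xr : x ^+ 2 <= `|r| ^+ 2.
    by rewrite real_normK ?num_real//; nra.
  have yr : y ^+ 2 <= `|r| ^+ 2.
    by rewrite real_normK ?num_real//; nra.
  by rewrite -!ler_norml; split; rewrite -(@ler_pXn2r _ 2%N)// ?nnegrE//
    real_normK ?num_real.
apply: le_lt_trans (le_measure _ _ _ sub) _; rewrite ?inE//.
- exact: measurable_disk_of_radius.
- exact: measurableX.
rewrite [X in (X < _)%E](_ : _ = (mu I * mu I)%E); last exact: product_measure1E.
rewrite /I lebesgue_measure_itv /=.
by case: ifP => _; rewrite ?mule0// -EFinD -EFinM ltry.
Qed.

Lemma lebesgue_integrable_disk (r M : R) (g : plane -> R) :
  measurable_fun (disk_of_radius r) g ->
  (forall p, disk_of_radius r p -> `|g p| <= M) ->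
  ((mu \x mu).-integrable (disk_of_radius r) (EFin \o g))%E.
Proof.
move=> mg gM; apply: measurable_bounded_integrable => //.
- exact: measurable_disk_of_radius.
- exact: lebesgue_disk_of_radius_lty.
- exists M; split; first exact: num_real.
  by move=> K MK p Dp; apply: le_trans (gM _ Dp) (ltW MK).
Qed.

Lemma integral_slice (q Q : R -> R) (r y : R) : 0 < r ->
  (forall x, is_derive x (1 : R) Q (q x)) -> continuous q ->
  (forall x, x ^+ 2 + y ^+ 2 = r ^+ 2 -> Q x = 0) ->
  (\int[mu]_x ((fun t : R => (q t)%:E) \_ [set t : R | (t ^+ 2 + y ^+ 2 < r ^+ 2)%R]) x = 0)%E.
Proof.
move=> r0 dQ cq Q0; rewrite -integral_mkcond.
have [yr|yr] := leP (r ^+ 2) (y ^+ 2).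
  rewrite (_ : [set t | _] = set0) ?integral_set0//.
  by apply/seteqP; split => // t /=; nra.
set s := Num.sqrt (r ^+ 2 - y ^+ 2).
have s0 : 0 < s by rewrite sqrtr_gt0 subr_gt0.
have s2 : s ^+ 2 = r ^+ 2 - y ^+ 2 by rewrite sqr_sqrtr// subr_ge0 ltW.
have -> : [set t | t ^+ 2 + y ^+ 2 < r ^+ 2] = `](- s), s[%classic.
  apply/seteqP; split => t /=; rewrite in_itv /= -ltr_norml.
    move=> tr; rewrite -(@ltr_pXn2r _ 2%N)// ?nnegrE// ?(ltW s0)//.
    by rewrite real_normK ?num_real// s2; lra.
  rewrite -(@ltr_pXn2r _ 2%N)// ?nnegrE// ?(ltW s0)//.
  by rewrite real_normK ?num_real// s2; lra.
have cQ : continuous Q.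
  move=> x; apply: differentiable_continuous; apply/derivable1_diffP.
  by have [] := dQ x.
rewrite -(@integral_itv_bndoo _ (- s) s (fun t => (q t)%:E) true false); last first.
  by apply/measurable_EFinP; apply: measurable_funTS; exact: continuous_measurable_fun.
rewrite (@continuous_FTC2 _ q Q)//.
- by rewrite !Q0 ?sqrrN ?s2 ?subee// subrK.
- lra.
- exact: continuous_subspaceT.
- split.
  + by move=> x _; have [] := dQ x.
  + by apply: cvg_at_right_filter; exact: cQ.
  + by apply: cvg_at_left_filter; exact: cQ.
- by move=> x _; rewrite derive1E; have [_ ->] := dQ x.
Qed.

Lemma dA_integral_dx (q Q : R -> R -> R) (r M : R) : 0 < r ->
  measurable_fun (disk_of_radius r) (fun p : plane => q p.1 p.2) ->
  (forall p, disk_of_radius r p -> `|q p.1 p.2| <= M) ->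
  (forall x y, is_derive x (1 : R) (Q ^~ y) (q x y)) ->
  (forall y, continuous (q ^~ y)) ->
  (forall x y, x ^+ 2 + y ^+ 2 = r ^+ 2 -> Q x y = 0) ->
  \int[dA]_(p in disk_of_radius r) q p.1 p.2 = 0.
Proof.
move=> r0 mq qM dQ cq Q0.
have mD := measurable_disk_of_radius r.
have iq := lebesgue_integrable_disk mq qM.
apply: integral_mscale_eq0 => //.
rewrite /Rintegral integral_mkcond -integral21_prod_meas1; last first.
  exact: (integrable_mkcond _ mD).1 iq.
have -> : fubini_G mu ((EFin \o (fun p : plane => q p.1 p.2)) \_ (disk_of_radius r)) = cst 0%E.
  apply/funext => y; rewrite /fubini_G /=.
  have <- := integral_slice r0 (dQ ^~ y) (cq y) (Q0 ^~ y).
  by apply: eq_integral => x _; rewrite /patch /= !mem_setE.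
by rewrite integral0.
Qed.

Lemma dA_integral_dy (q Q : R -> R -> R) (r M : R) : 0 < r ->
  measurable_fun (disk_of_radius r) (fun p : plane => q p.1 p.2) ->
  (forall p, disk_of_radius r p -> `|q p.1 p.2| <= M) ->
  (forall x y, is_derive y (1 : R) (Q x) (q x y)) ->
  (forall x, continuous (q x)) ->
  (forall x y, x ^+ 2 + y ^+ 2 = r ^+ 2 -> Q x y = 0) ->
  \int[dA]_(p in disk_of_radius r) q p.1 p.2 = 0.
Proof.
move=> r0 mq qM dQ cq Q0.
have mD := measurable_disk_of_radius r.
have iq := lebesgue_integrable_disk mq qM.
apply: integral_mscale_eq0 => //.
rewrite /Rintegral integral_mkcond -integral12_prod_meas1; last first.
  exact: (integrable_mkcond _ mD).1 iq.
have -> : fubini_F mu ((EFin \o (fun p : plane => q p.1 p.2)) \_ (disk_of_radius r)) = cst 0%E.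
  apply/funext => x; rewrite /fubini_F /=.
  have Q0' y : y ^+ 2 + x ^+ 2 = r ^+ 2 -> Q x y = 0 by rewrite addrC; exact: Q0.
  have <- := integral_slice r0 (dQ x) (cq x) Q0'.
  apply: eq_integral => y _; rewrite /patch /=; congr (if _ then _ else _).
  by apply/idP/idP; rewrite !inE /disk_of_radius /= addrC.
by rewrite integral0.
Qed.

End DiskIntegral.

Section Modulus.
Context {R : realType}.
Local Notation C := R[i].
Implicit Types (x y z : C) (a b : R).

Lemma normc_ge0 z : 0 <= normc z.
Proof. by case: z => a b; exact: sqrtr_ge0. Qed.

Lemma normc_eq0 z : (normc z == 0) = (z == 0).
Proof.
by apply/eqP/eqP => [|->]; [exact: eq0_normc | exact: normc0].
Qed.

Lemma normc_gt0 z : (0 < normc z) = (z != 0).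
Proof. by rewrite lt0r normc_eq0 normc_ge0 andbT. Qed.

Lemma normc_normr z : `|z| = (normc z)%:C.
Proof. by rewrite normc_def; case: z. Qed.

Lemma normc_real a : normc a%:C = `|a|.
Proof. by rewrite /= expr0n addr0 sqrtr_sqr. Qed.

Lemma normcJ_eq z : normc (conjc z) = normc z.
Proof. by case: z => a b; rewrite /= sqrrN. Qed.

Lemma normc_i : normc 'i%C = 1 :> R.
Proof. by rewrite /= expr0n add0r expr1n sqrtr1. Qed.

Lemma normcX z n : normc (z ^+ n) = normc z ^+ n.
Proof. by elim: n => [|n IH]; rewrite ?expr0 ?normc1// !exprS normcM IH. Qed.

Lemma normc_nat n : normc (n%:R : C) = n%:R.
Proof. by rewrite -(rmorph_nat (real_complex R)) normc_real normr_nat. Qed.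

Lemma normcB x y : normc (x - y) = normc (y - x).
Proof. by rewrite -normcN opprB. Qed.

Lemma le_normc_dist x y z : normc (x - z) <= normc (x - y) + normc (y - z).
Proof. by rewrite (le_trans _ (le_normcD _ _))// addrA subrK. Qed.

Lemma le_normc_sub x y : normc x - normc y <= normc (x - y).
Proof. by rewrite lerBlDr (le_trans _ (le_normcD _ _))// subrK. Qed.

Lemma le_normc_sum (I : Type) (s : seq I) (P : pred I) (F : I -> C) :
  normc (\sum_(i <- s | P i) F i) <= \sum_(i <- s | P i) normc (F i).
Proof.
elim/big_ind2: _ => [|x u y v xu yv|i _]; rewrite ?normc0//.
exact: le_trans (le_normcD _ _) (lerD xu yv).
Qed.

Lemma abs_Re_le z : `|complex.Re z| <= normc z.
Proof.
case: z => a b /=; rewrite -sqrtr_sqr ler_wsqrtr// lerDl sqr_ge0//.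
Qed.

Lemma abs_Im_le z : `|complex.Im z| <= normc z.
Proof.
case: z => a b /=; rewrite -sqrtr_sqr ler_wsqrtr// lerDr sqr_ge0//.
Qed.

Lemma normc_le_ReIm z : normc z <= `|complex.Re z| + `|complex.Im z|.
Proof.
have n0 := addr_ge0 (normr_ge0 (complex.Re z)) (normr_ge0 (complex.Im z)).
rewrite -(@ler_pXn2r _ 2%N)// ?nnegrE ?normc_ge0//.
rewrite normc2E sqrrD !real_normK ?num_real//.
by rewrite lerD2r lerDl mulrn_wge0// mulr_ge0.
Qed.

Lemma ReD x y : complex.Re (x + y) = complex.Re x + complex.Re y.
Proof. by case: x y => [? ?] [? ?]. Qed.
Lemma ImD x y : complex.Im (x + y) = complex.Im x + complex.Im y.
Proof. by case: x y => [? ?] [? ?]. Qed.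
Lemma ReN x : complex.Re (- x) = - complex.Re x.
Proof. by case: x. Qed.
Lemma ImN x : complex.Im (- x) = - complex.Im x.
Proof. by case: x. Qed.
Lemma ReM x y : complex.Re (x * y) =
  complex.Re x * complex.Re y - complex.Im x * complex.Im y.
Proof. by case: x y => [? ?] [? ?]. Qed.
Lemma ImM x y : complex.Im (x * y) =
  complex.Re x * complex.Im y + complex.Im x * complex.Re y.
Proof. by case: x y => [? ?] [? ?]. Qed.
Lemma ReJ x : complex.Re (conjc x) = complex.Re x.
Proof. by case: x. Qed.
Lemma ImJ x : complex.Im (conjc x) = - complex.Im x.
Proof. by case: x. Qed.

Lemma complex_eqP x y :
  complex.Re x = complex.Re y -> complex.Im x = complex.Im y -> x = y.
Proof. by case: x y => [a b] [c d] /= -> ->. Qed.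

Lemma mulcJ z : z * conjc z = (normc z ^+ 2)%:C.
Proof.
by apply: complex_eqP; rewrite ?normc2E ?ReM ?ImM ?ReJ ?ImJ /=; ring.
Qed.

Lemma disk_of_radiusE (r : R) p : 0 <= r ->
  disk_of_radius r p <-> normc (cplx p) < r.
Proof.
move=> r0; rewrite -(@ltr_pXn2r _ 2%N)// ?nnegrE ?normc_ge0// normc2E.
by case: p.
Qed.

Lemma unit_diskE z : unit_disk z <-> normc z < 1.
Proof. by rewrite /unit_disk /= normc_normr ltcR. Qed.

Lemma disk2E : @disk2 R = disk_of_radius 1.
Proof.
apply/seteqP; split => p; first by move=> /unit_diskE/(disk_of_radiusE p ler01).
by move=> /(disk_of_radiusE p ler01)/unit_diskE.
Qed.

End Modulus.

Section ZExpr.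
Context {R : realType}.
Local Notation C := R[i].
Local Notation plane := (measurableTypeR R * measurableTypeR R)%type.

Definition measurable_cfun (D : set plane) (f : C -> C) :=
  measurable_fun D (fun p => complex.Re (f (cplx p))) /\
  measurable_fun D (fun p => complex.Im (f (cplx p))).

Lemma measurable_cfunD D f g : measurable_cfun D f -> measurable_cfun D g ->
  measurable_cfun D (fun z => f z + g z).
Proof.
move=> [rf jf] [rg jg]; split.
  by under eq_fun do rewrite ReD; exact: measurable_funD.
by under eq_fun do rewrite ImD; exact: measurable_funD.
Qed.

Lemma measurable_cfunM D f g : measurable_cfun D f -> measurable_cfun D g ->
  measurable_cfun D (fun z => f z * g z).
Proof.
move=> [rf jf] [rg jg]; split.
  by under eq_fun do rewrite ReM; apply: measurable_funB; apply: measurable_funM.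
by under eq_fun do rewrite ImM; apply: measurable_funD; apply: measurable_funM.
Qed.

Lemma measurable_cfunJ D f : measurable_cfun D f ->
  measurable_cfun D (fun z => conjc (f z)).
Proof.
move=> [rf jf]; split; first by under eq_fun do rewrite ReJ.
by under eq_fun do rewrite ImJ; exact: measurableT_comp.
Qed.

Lemma measurable_cfun_cst D (c : C) : measurable_cfun D (fun=> c).
Proof. by split; exact: measurable_cst. Qed.

Lemma measurable_cfun_id D : measurable_cfun D id.
Proof.
by split; apply: measurable_funTS;
  [exact: (@measurable_fst _ _ (measurableTypeR R) (measurableTypeR R)) |
   exact: (@measurable_snd _ _ (measurableTypeR R) (measurableTypeR R))].
Qed.

Lemma measurable_cfunX D f n : measurable_cfun D f ->
  measurable_cfun D (fun z => f z ^+ n).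
Proof.
move=> mf; elim: n => [|n IH]; first exact: measurable_cfun_cst.
by under eq_fun do rewrite exprS; exact: measurable_cfunM.
Qed.

Definition is_cderive (f : R -> C) (x : R) (l : C) :=
  is_derive x (1 : R) (fun t => complex.Re (f t)) (complex.Re l) /\
  is_derive x (1 : R) (fun t => complex.Im (f t)) (complex.Im l).

Lemma is_cderiveD f g x l k : is_cderive f x l -> is_cderive g x k ->
  is_cderive (fun t => f t + g t) x (l + k).
Proof.
move=> [rf jf] [rg jg]; split.
  by under eq_fun do rewrite ReD; rewrite ReD; exact: is_deriveD.
by under eq_fun do rewrite ImD; rewrite ImD; exact: is_deriveD.
Qed.

Lemma is_cderiveM f g x l k : is_cderive f x l -> is_cderive g x k ->
  is_cderive (fun t => f t * g t) x (l * g x + f x * k).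
Proof.
move=> [rf jf] [rg jg]; split.
  under eq_fun do rewrite ReM.
  by apply: is_derive_eq; rewrite ReD !ReM /GRing.scale /=; ring.
under eq_fun do rewrite ImM.
by apply: is_derive_eq; rewrite ImD !ImM /GRing.scale /=; ring.
Qed.

Lemma is_cderiveJ f x l : is_cderive f x l ->
  is_cderive (fun t => conjc (f t)) x (conjc l).
Proof.
move=> [rf jf]; split; first by under eq_fun do rewrite ReJ; rewrite ReJ.
by under eq_fun do rewrite ImJ; rewrite ImJ; exact: is_deriveN.
Qed.

Lemma is_cderive_cst (c : C) x : is_cderive (fun=> c) x 0.
Proof. by split; exact: is_derive_cst. Qed.

Lemma is_cderiveX f x l n : is_cderive f x l ->
  is_cderive (fun t => f t ^+ n) x (n%:R * f x ^+ n.-1 * l).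
Proof.
move=> df; elim: n => [|n IH]; first by rewrite !mul0r; exact: is_cderive_cst.
under eq_fun do rewrite exprS.
rewrite (_ : _ * l = l * f x ^+ n + f x * (n%:R * f x ^+ n.-1 * l)).
  exact: is_cderiveM.
by case: n {IH} => [|n] /=; rewrite ?expr0 ?exprS -?[n.+2]addn1 ?natrD; ring.
Qed.

Inductive zexpr :=
  | ZConst of C | ZVar | ZConj of zexpr | ZExp of zexpr & nat
  | ZAdd of zexpr & zexpr | ZMul of zexpr & zexpr.

Fixpoint zeval (e : zexpr) (z : C) : C :=
  match e with
  | ZConst c => c
  | ZVar => z
  | ZConj e => conjc (zeval e z)
  | ZExp e n => zeval e z ^+ n
  | ZAdd e f => zeval e z + zeval f z
  | ZMul e f => zeval e z * zeval f z
  end.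

(* Formal derivative in a real direction, [v] being the derivative of [z]:
   [v = 1] gives d/dx and [v = 'i] gives d/dy. *)
Fixpoint zderiv (v : C) (e : zexpr) : zexpr :=
  match e with
  | ZConst c => ZConst 0
  | ZVar => ZConst v
  | ZConj e => ZConj (zderiv v e)
  | ZExp e n => ZMul (ZMul (ZConst n%:R) (ZExp e n.-1)) (zderiv v e)
  | ZAdd e f => ZAdd (zderiv v e) (zderiv v f)
  | ZMul e f => ZAdd (ZMul (zderiv v e) f) (ZMul e (zderiv v f))
  end.

Lemma measurable_zeval D e : measurable_cfun D (zeval e).
Proof.
elim: e => [c||e IH|e IH n|e IHe f IHf|e IHe f IHf] /=.
- exact: measurable_cfun_cst.
- exact: measurable_cfun_id.
- exact: measurable_cfunJ.
- exact: measurable_cfunX.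
- exact: measurable_cfunD.
- exact: measurable_cfunM.
Qed.

Lemma zeval_bounded (r : R) e :
  exists M, forall z, normc z <= r -> normc (zeval e z) <= M.
Proof.
elim: e => [c||e [M IH]|e [M IH] n|e [M IHe] f [N IHf]|e [M IHe] f [N IHf]] /=.
- by exists (normc c).
- by exists r.
- by exists M => z /IH; rewrite normcJ_eq.
- exists (M ^+ n) => z /IH eM; rewrite normcX.
  by rewrite lerXn2r ?nnegrE ?normc_ge0// (le_trans _ eM)// normc_ge0.
- by exists (M + N) => z zr; apply: le_trans (le_normcD _ _) (lerD (IHe _ zr) (IHf _ zr)).
- by exists (M * N) => z zr; rewrite normcM ler_pM ?normc_ge0 ?IHe ?IHf.
Qed.

Lemma zeval_cderive (v : C) (g : R -> C) x e : is_cderive g x v ->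
  is_cderive (fun t => zeval e (g t)) x (zeval (zderiv v e) (g x)).
Proof.
move=> dg; elim: e => [c||e IH|e IH n|e IHe f IHf|e IHe f IHf] //=.
- exact: is_cderive_cst.
- exact: is_cderiveJ.
- exact: is_cderiveX.
- exact: is_cderiveD.
- exact: is_cderiveM.
Qed.

Lemma is_cderive_horizontal (y x : R) : is_cderive (fun t => t +i* y) x 1.
Proof. by split; [exact: is_derive_id | exact: is_derive_cst]. Qed.

Lemma is_cderive_vertical (y x : R) : is_cderive (fun t => x +i* t) y 'i%C.
Proof. by split; [exact: is_derive_cst | exact: is_derive_id]. Qed.

Lemma is_derive_continuous (f : R -> R) x l : is_derive x (1 : R) f l ->
  {for x, continuous f}.
Proof.
move=> [df _]; apply: differentiable_continuous.
exact/derivable1_diffP.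
Qed.

Definition cintegrable (D : set plane) (f : C -> C) :=
  dA.-integrable D (EFin \o (fun p => complex.Re (f (cplx p)))) /\
  dA.-integrable D (EFin \o (fun p => complex.Im (f (cplx p)))).

Definition cintegral (D : set plane) (f : C -> C) : C :=
  \int[dA]_(p in D) complex.Re (f (cplx p)) +i*
  \int[dA]_(p in D) complex.Im (f (cplx p)).

Lemma cintegral_zderiv (r : R) (e : zexpr) (v : C) : 0 < r ->
  v = 1 \/ v = 'i%C -> (forall z, normc z = r -> zeval e z = 0) ->
  cintegral (disk_of_radius r) (zeval (zderiv v e)) = 0.
Proof.
move=> r0 v1i e0.
have [M eM] := zeval_bounded r (zderiv v e).
have [mR mI] := measurable_zeval (disk_of_radius r) (zderiv v e).
have ER p : disk_of_radius r p ->
    `|complex.Re (zeval (zderiv v e) ((p.1 : R) +i* (p.2 : R)))| <= M.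
  by move=> /(disk_of_radiusE _ (ltW r0))/ltW/eM; apply: le_trans (abs_Re_le _).
have EI p : disk_of_radius r p ->
    `|complex.Im (zeval (zderiv v e) ((p.1 : R) +i* (p.2 : R)))| <= M.
  by move=> /(disk_of_radiusE _ (ltW r0))/ltW/eM; apply: le_trans (abs_Im_le _).
have circle0 (x y : R) : x ^+ 2 + y ^+ 2 = r ^+ 2 -> zeval e (x +i* y) = 0.
  by move=> xy; apply: e0; rewrite /= xy sqrtr_sqr gtr0_norm.
have dH x y := is_cderive_horizontal y x.
have dV x y := is_cderive_vertical y x.
apply: complex_eqP; case: v1i => v1; rewrite {v}v1 in mR mI ER EI eM *.
- apply: (@dA_integral_dx _ (fun x y => complex.Re (zeval (zderiv 1 e) (x +i* y)))
    (fun x y => complex.Re (zeval e (x +i* y))) r M) => //.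
  + by move=> x y; have [] := zeval_cderive e (dH x y).
  + by move=> y x; have [d _] := zeval_cderive (zderiv 1 e) (dH x y); apply: is_derive_continuous d.
  + by move=> x y /circle0 ->.
- apply: (@dA_integral_dy _ (fun x y => complex.Re (zeval (zderiv 'i%C e) (x +i* y)))
    (fun x y => complex.Re (zeval e (x +i* y))) r M) => //.
  + by move=> x y; have [] := zeval_cderive e (dV x y).
  + by move=> x y; have [d _] := zeval_cderive (zderiv 'i%C e) (dV x y); apply: is_derive_continuous d.
  + by move=> x y /circle0 ->.
- apply: (@dA_integral_dx _ (fun x y => complex.Im (zeval (zderiv 1 e) (x +i* y)))
    (fun x y => complex.Im (zeval e (x +i* y))) r M) => //.
  + by move=> x y; have [] := zeval_cderive e (dH x y).
  + by move=> y x; have [_ d] := zeval_cderive (zderiv 1 e) (dH x y); apply: is_derive_continuous d.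
  + by move=> x y /circle0 ->.
- apply: (@dA_integral_dy _ (fun x y => complex.Im (zeval (zderiv 'i%C e) (x +i* y)))
    (fun x y => complex.Im (zeval e (x +i* y))) r M) => //.
  + by move=> x y; have [] := zeval_cderive e (dV x y).
  + by move=> x y; have [_ d] := zeval_cderive (zderiv 'i%C e) (dV x y); apply: is_derive_continuous d.
  + by move=> x y /circle0 ->.
Qed.

End ZExpr.

Section Moments.
Context {R : realType}.
Local Notation C := R[i].
Local Notation plane := (measurableTypeR R * measurableTypeR R)%type.
Implicit Types (D : set plane) (f g : C -> C).

Lemma dA_disk_lty (r : R) : (dA (disk_of_radius r) < +oo)%E.
Proof.
rewrite /dA /mscale /=; have := lebesgue_disk_of_radius_lty r.
by apply: lte_mul_pinfty; rewrite ?lee_fin ?invr_ge0 ?pi_ge0.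
Qed.

Lemma integrable_disk (r M : R) (g : plane -> R) :
  measurable_fun (disk_of_radius r) g ->
  (forall p, disk_of_radius r p -> `|g p| <= M) ->
  dA.-integrable (disk_of_radius r) (EFin \o g).
Proof.
move=> mg gM; apply: measurable_bounded_integrable => //.
- exact: measurable_disk_of_radius.
- exact: dA_disk_lty.
- exists M; split; first exact: num_real.
  by move=> K MK p Dp; apply: le_trans (gM _ Dp) (ltW MK).
Qed.

Lemma cintegrable_disk (r M : R) f : 0 <= r ->
  measurable_cfun (disk_of_radius r) f ->
  (forall z, normc z < r -> normc (f z) <= M) ->
  cintegrable (disk_of_radius r) f.
Proof.
move=> r0 [mR mI] fM; split; apply: (@integrable_disk _ M) => // p.
- by move=> /(disk_of_radiusE p r0)/fM; apply: le_trans (abs_Re_le _).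
- by move=> /(disk_of_radiusE p r0)/fM; apply: le_trans (abs_Im_le _).
Qed.

Lemma cintegrable_zeval (r : R) e : 0 <= r ->
  cintegrable (disk_of_radius r) (zeval e).
Proof.
move=> r0; have [M eM] := zeval_bounded r e.
by apply: (@cintegrable_disk _ M) => // [|z /ltW/eM//]; exact: measurable_zeval.
Qed.

Lemma cintegrableD D f g : measurable D -> cintegrable D f -> cintegrable D g ->
  cintegrable D (fun z => f z + g z).
Proof.
move=> mD [rf jf] [rg jg]; split.
  have := integrableD mD rf rg; apply: eq_integrable => // p _ /=.
  by rewrite ReD EFinD.
have := integrableD mD jf jg; apply: eq_integrable => // p _ /=.
by rewrite ImD EFinD.
Qed.

Lemma cintegralD D f g : measurable D -> cintegrable D f -> cintegrable D g ->
  cintegral D (fun z => f z + g z) = cintegral D f + cintegral D g.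
Proof.
move=> mD [rf jf] [rg jg]; apply: complex_eqP; rewrite ?ReD ?ImD /=.
  by rewrite -RintegralD//; apply: eq_Rintegral => p _; rewrite ReD.
by rewrite -RintegralD//; apply: eq_Rintegral => p _; rewrite ImD.
Qed.

Lemma cintegrableZ D (c : C) f : measurable D -> cintegrable D f ->
  cintegrable D (fun z => c * f z).
Proof.
move=> mD [rf jf]; split.
  have := integrableB mD (integrableZl mD (complex.Re c) rf) (integrableZl mD (complex.Im c) jf).
  by apply: eq_integrable => // p _ /=; rewrite ReM EFinB !EFinM.
have := integrableD mD (integrableZl mD (complex.Re c) jf) (integrableZl mD (complex.Im c) rf).
by apply: eq_integrable => // p _ /=; rewrite ImM EFinD !EFinM.
Qed.

Lemma cintegralZ D (c : C) f : measurable D -> cintegrable D f ->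
  cintegral D (fun z => c * f z) = c * cintegral D f.
Proof.
move=> mD [rf jf].
have iZ (a : R) (g : plane -> R) : dA.-integrable D (EFin \o g) ->
    dA.-integrable D (EFin \o (fun p => a * g p)).
  move=> ig; have := integrableZl mD a ig.
  by apply: eq_integrable => // p _ /=; rewrite EFinM.
apply: complex_eqP; rewrite ?ReM ?ImM /=.
  rewrite -!RintegralZl// -RintegralB//; try exact: iZ.
  by apply: eq_Rintegral => p _; rewrite ReM.
rewrite -!RintegralZl// -RintegralD//; try exact: iZ.
by apply: eq_Rintegral => p _; rewrite ImM.
Qed.

Lemma cintegralJ D f : measurable D -> cintegrable D f ->
  cintegral D (fun z => conjc (f z)) = conjc (cintegral D f).
Proof.
move=> mD [rf jf]; apply: complex_eqP; rewrite ?ReJ ?ImJ /=.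
  by apply: eq_Rintegral => p _; rewrite ReJ.
rewrite -mulN1r -RintegralZl//.
by apply: eq_Rintegral => p _; rewrite ImJ mulN1r.
Qed.

Lemma eq_cintegral D f g : (forall p, D p -> f (cplx p) = g (cplx p)) ->
  cintegral D f = cintegral D g.
Proof.
by move=> fg; congr (_ +i* _); apply: eq_Rintegral => p /set_mem/fg ->.
Qed.

Lemma cintegrable0 D : measurable D -> cintegrable D (fun=> 0).
Proof. by move=> mD; split; exact: integrable0. Qed.

Lemma cintegral0 D : cintegral D (fun=> 0) = 0.
Proof. by rewrite /cintegral /Rintegral /= !integral0. Qed.

Lemma cintegrable_sum D (I : Type) (s : seq I) (F : I -> C -> C) :
  measurable D -> (forall i, cintegrable D (F i)) ->
  cintegrable D (fun z => \sum_(i <- s) F i z).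
Proof.
move=> mD iF; elim: s => [|i s IH].
  by under [X in cintegrable _ X]eq_fun do rewrite big_nil; exact: cintegrable0.
by under [X in cintegrable _ X]eq_fun do rewrite big_cons; exact: cintegrableD.
Qed.

Lemma cintegral_sum D (I : Type) (s : seq I) (F : I -> C -> C) :
  measurable D -> (forall i, cintegrable D (F i)) ->
  cintegral D (fun z => \sum_(i <- s) F i z) = \sum_(i <- s) cintegral D (F i).
Proof.
move=> mD iF; elim: s => [|i s IH].
  by rewrite big_nil; under [X in cintegral _ X]eq_fun do rewrite big_nil; exact: cintegral0.
under [X in cintegral _ X]eq_fun do rewrite big_cons.
by rewrite cintegralD ?IH ?big_cons//; exact: cintegrable_sum.
Qed.

Definition zmoment (r : R) (a b : nat) :=
  cintegral (disk_of_radius r) (fun z => z ^+ a * conjc z ^+ b).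

Lemma cintegrable_monomial (r : R) a b : 0 <= r ->
  cintegrable (disk_of_radius r) (fun z => z ^+ a * conjc z ^+ b).
Proof.
move=> r0.
exact: (cintegrable_zeval (ZMul (ZExp ZVar a) (ZExp (ZConj ZVar) b)) r0).
Qed.

(* (d/dx - i d/dy) / 2 kills powers of [conjc z]; apply it to
   (r^2 - |z|^2) z^a conjc z^b, which vanishes on the circle. *)
Lemma cintegral_dz (r : R) a b : 0 < r ->
  cintegral (disk_of_radius r) (fun z =>
    (r ^+ 2)%:C * a%:R * (z ^+ a.-1 * conjc z ^+ b) -
    a.+1%:R * (z ^+ a * conjc z ^+ b.+1)) = 0.
Proof.
move=> r0; have mD := measurable_disk_of_radius r.
pose w := ZAdd (ZConst (r ^+ 2)%:C) (ZMul (ZConst (-1)) (ZMul ZVar (ZConj ZVar))).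
pose e := ZMul w (ZMul (ZExp ZVar a) (ZExp (ZConj ZVar) b)).
have e0 z : normc z = r -> zeval e z = 0.
  by move=> zr /=; rewrite mulcJ zr; ring.
have := cintegral_zderiv r0 (or_introl erefl) e0.
have := cintegral_zderiv r0 (or_intror erefl) e0.
set ey := zderiv 'i%C e; set ex := zderiv 1 e => iy ix.
have iex := cintegrable_zeval ex (ltW r0).
have iey := cintegrable_zeval ey (ltW r0).
transitivity (2^-1 * (cintegral (disk_of_radius r) (zeval ex) -
   'i%C * cintegral (disk_of_radius r) (zeval ey))); last first.
  by rewrite ix iy mulr0 subr0 mulr0.
rewrite -mulNr -cintegralZ// -cintegralD//; last exact: cintegrableZ.
rewrite -cintegralZ//; last by apply: cintegrableD => //; exact: cintegrableZ.
apply: eq_cintegral => p _; rewrite /ex /ey /e /w.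
move: (cplx p) => z; cbn [zeval zderiv].
have ii : 'i%C * 'i%C = -1 :> C by rewrite -expr2 sqr_i.
have ci : conjc 'i%C = - 'i%C :> C by apply: complex_eqP; rewrite /= ?oppr0.
rewrite ci conjc1.
set zb := conjc z; set u := z ^+ a.-1; set v := zb ^+ b; set v' := zb ^+ b.-1.
have a1 : a%:R * z ^+ a = a%:R * (z * u).
  by rewrite /u; case: (a) => [|n]; rewrite ?mul0r// exprS.
rewrite -natr1.
apply: (mulfI (_ : 2 != 0 :> C)); first by rewrite pnatr_eq0.
rewrite [RHS]mulrA divff ?pnatr_eq0// mul1r.
set A := a%:R in a1 *; set B := b%:R; set W := (r ^+ 2)%:C; set I := 'i%C in ii *.
set za := z ^+ a in a1 *.
pose K := (zb - z) * za * v - (W - z * zb) * (A * u * v - za * B * v').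
apply: esym; transitivity ((I * I + 1) * K + 2 * (W - z * zb) * (A * u * v) - 2 * zb * za * v).
  rewrite /K; clearbody A B W I za v v' u zb; ring.
rewrite ii addNr mul0r add0r exprS -/v.
transitivity (2 * (W * A * (u * v) - (A * za + za) * (zb * v))); last by ring.
by rewrite a1; ring.
Qed.

End Moments.

Section MomentValues.
Context {R : realType}.
Local Notation C := R[i].
Local Notation plane := (measurableTypeR R * measurableTypeR R)%type.

Lemma zmoment_rec (r : R) a b : 0 < r ->
  (r ^+ 2)%:C * a%:R * zmoment r a.-1 b = a.+1%:R * zmoment r a b.+1.
Proof.
move=> r0; have := cintegral_dz a b r0.
have mD := measurable_disk_of_radius r.
have im x y := cintegrable_monomial x y (ltW r0).
rewrite cintegralD//; last 2 first.
- exact: cintegrableZ.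
- under [X in cintegrable _ X]eq_fun do rewrite -mulNr.
  exact: cintegrableZ.
rewrite cintegralZ// [X in _ + X](@eq_cintegral _ _ _ (fun z => - a.+1%:R * (z ^+ a * conjc z ^+ b.+1))).
  by rewrite cintegralZ// mulNr => /eqP; rewrite subr_eq0 => /eqP.
by move=> p _; rewrite mulNr.
Qed.

Lemma zmoment_swap (r : R) a b : 0 < r -> zmoment r b a = conjc (zmoment r a b).
Proof.
move=> r0; have mD := measurable_disk_of_radius r.
have im := cintegrable_monomial a b (ltW r0).
rewrite /zmoment -cintegralJ//.
by apply: eq_cintegral => p _; move: (cplx p) => z; rewrite rmorphM !rmorphXn /= conjcK mulrC.
Qed.

Lemma zmoment_shift (r : R) a b : 0 < r ->
  zmoment r a.+1 b.+1 = (r ^+ 2)%:C * (a.+1%:R / a.+2%:R) * zmoment r a b.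
Proof.
move=> r0; have := zmoment_rec a.+1 b r0; rewrite /= => E.
have a2 : a.+2%:R != 0 :> C by rewrite pnatr_eq0.
by apply: (mulfI a2); rewrite -E; field.
Qed.

Lemma zmoment0S (r : R) b : 0 < r -> zmoment r 0 b.+1 = 0.
Proof.
by move=> r0; have := zmoment_rec 0 b r0; rewrite mulr0 mul0r mul1r => <-.
Qed.

Lemma zmoment_neq (r : R) a b : 0 < r -> a != b -> zmoment r a b = 0.
Proof.
move=> r0; elim: a b => [|a IH] [|b]// ab; first exact: zmoment0S.
  by rewrite zmoment_swap// zmoment0S// conjc0.
by rewrite zmoment_shift// IH ?mulr0.
Qed.

Lemma zmoment_diag (r : R) n : 0 < r ->
  zmoment r n n = (r ^+ n.*2 / n.+1%:R)%:C * zmoment r 0 0.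
Proof.
move=> r0; elim: n => [|n IH]; first by rewrite expr0 divr1 mul1r.
rewrite zmoment_shift// IH mulrA; congr (_ * _).
have -> : (n.+1%:R / n.+2%:R : C) = (n.+1%:R / n.+2%:R)%:C.
  by rewrite rmorphM fmorphV /= !(rmorph_nat (real_complex R)).
rewrite -!rmorphM /=; congr (_%:C).
rewrite doubleS -[n.*2.+2]addn2 exprD.
have n1 : n.+1%:R != 0 :> R by rewrite pnatr_eq0.
have n2 : n.+2%:R != 0 :> R by rewrite pnatr_eq0.
move: n1 n2; set x := r ^+ n.*2; move: (n.+1%:R) (n.+2%:R) => u v u0 v0.
by rewrite /= expr2; field; rewrite u0 v0.
Qed.

Definition disk_area (r : R) := fine (dA (disk_of_radius r)).

Lemma zmoment00 (r : R) : 0 < r -> zmoment r 0 0 = (disk_area r)%:C.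
Proof.
move=> r0; have mD := measurable_disk_of_radius r.
rewrite /zmoment (@eq_cintegral _ _ _ (fun=> 1)); last first.
  by move=> p _; rewrite !expr0 mulr1.
apply: complex_eqP => /=; first by rewrite Rintegral_cst// mul1r.
by rewrite Rintegral_cst// mul0r.
Qed.

Lemma disk_area_ge0 (r : R) : 0 <= disk_area r.
Proof. exact: fine_ge0. Qed.

Definition power_sum (a : nat -> C) (N : nat) (z : C) : C :=
  \sum_(k < N) a k * z ^+ k.

Lemma cintegral_power_sum (r : R) (a : nat -> C) N : 0 < r ->
  cintegral (disk_of_radius r)
    (fun z => power_sum a N z * conjc (power_sum a N z)) =
  (disk_area r * \sum_(k < N) normc (a k) ^+ 2 * r ^+ k.*2 / k.+1%:R)%:C.
Proof.
move=> r0; have mD := measurable_disk_of_radius r.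
have im x y := cintegrable_monomial x y (ltW r0).
rewrite (@eq_cintegral _ _ _ (fun z => \sum_(j < N) \sum_(k < N)
    (a j * conjc (a k)) * (z ^+ j * conjc z ^+ k))); last first.
  move=> p _; move: (cplx p) => z; rewrite /power_sum rmorph_sum mulr_suml; apply: eq_bigr => j _.
  rewrite mulr_sumr; apply: eq_bigr => k _.
  by rewrite rmorphM rmorphXn /=; ring.
rewrite cintegral_sum//; last first.
  by move=> j; apply: cintegrable_sum => // k; exact: cintegrableZ.
rewrite mulr_sumr rmorph_sum /=; apply: eq_bigr => j _.
rewrite cintegral_sum//; last by move=> k; exact: cintegrableZ.
rewrite (bigD1 j)//= big1 ?addr0; last first.
  by move=> k kj; rewrite cintegralZ// -/(zmoment _ _ _) zmoment_neq ?mulr0// eq_sym.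
rewrite cintegralZ// -/(zmoment _ _ _) zmoment_diag// zmoment00//.
rewrite mulcJ -!rmorphM /=; by rewrite [in RHS]mulrC !mulrA.
Qed.

Lemma power_sum_bounded (r : R) a N :
  exists M, forall z : C, normc z <= r -> normc (power_sum a N z) <= M.
Proof.
exists (\sum_(k < N) normc (a k) * r ^+ k) => z zr.
apply: le_trans (le_normc_sum _ _ _) _; apply: ler_sum => k _.
rewrite normcM normcX ler_wpM2l ?normc_ge0// lerXn2r ?nnegrE ?normc_ge0//.
by rewrite (le_trans _ zr)// normc_ge0.
Qed.

Lemma measurable_power_sum D a N : measurable_cfun D (power_sum a N).
Proof.
rewrite /power_sum; elim: N => [|N IH].
  by under eq_fun do rewrite big_ord0; exact: measurable_cfun_cst.
under eq_fun do rewrite big_ord_recr /=.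
apply: measurable_cfunD => //; apply: measurable_cfunM.
  exact: measurable_cfun_cst.
exact: measurable_cfunX (measurable_cfun_id D).
Qed.

Lemma measurable_normc2 D (f : C -> C) : measurable_cfun D f ->
  measurable_fun D (fun p => normc (f (cplx p)) ^+ 2).
Proof.
move=> [mR mI]; under eq_fun do rewrite normc2E.
by apply: measurable_funD; exact: measurable_funX.
Qed.

Lemma integral_power_sum (r : R) (a : nat -> C) N : 0 < r ->
  (\int[dA]_(p in disk_of_radius r) (normc (power_sum a N (cplx p)) ^+ 2)%:E =
  (disk_area r * \sum_(k < N) normc (a k) ^+ 2 * r ^+ k.*2 / k.+1%:R)%:E)%E.
Proof.
move=> r0; have mD := measurable_disk_of_radius r.
have := congr1 (@complex.Re R) (cintegral_power_sum a N r0).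
rewrite /= => <-; rewrite /Rintegral fineK.
  by apply: eq_integral => p _; rewrite mulcJ.
have [M sM] := power_sum_bounded r a N.
have m2 := measurable_normc2 (measurable_power_sum (disk_of_radius r) a N).
have sM2 p : disk_of_radius r p -> `|normc (power_sum a N (cplx p)) ^+ 2| <= M ^+ 2.
  move=> /(disk_of_radiusE p (ltW r0))/ltW/sM sp.
  rewrite ger0_norm ?sqr_ge0// lerXn2r ?nnegrE ?normc_ge0//.
  by rewrite (le_trans _ sp)// normc_ge0.
have := integrable_fin_num mD (integrable_disk m2 sM2).
by congr (_ \is a fin_num); apply: eq_integral => p _; rewrite mulcJ.
Qed.

End MomentValues.

Section ComplexLimits.
Context {R : realType}.
Local Notation C := R[i].
Implicit Types (u v : nat -> C) (l : C).

Definition ccvg u l := forall e : R, 0 < e ->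
  exists N, forall n, (N <= n)%N -> normc (u n - l) < e.

Lemma ccvgP u l : (u n @[n --> \oo] --> l) <-> ccvg u l.
Proof.
have H := @cvgrPdist_lt R[i] R[i] nat \oo _ u l.
split.
  move/H => ul e e0; have e0' : 0 < e%:C by rewrite ltcR.
  have [N _ NP] := ul _ e0'; exists N => n /NP /=.
  by rewrite normc_normr ltcR normcB.
move=> ul; apply/H => e; rewrite ltcE /= => /andP[/eqP ie re].
have [N NP] := ul _ re; exists N => // n /= /NP.
by rewrite normc_normr ltcE /= ie eqxx normcB.
Qed.

Lemma ccvg_unique u l (k : C) :
  ccvg u l -> ccvg u k -> l = k.
Proof.
move=> ul uk; apply/eqP; rewrite -subr_eq0 -normc_eq0.
rewrite eq_le normc_ge0 andbT; apply/ler_addgt0Pl => e e0; rewrite addr0.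
have e2 : 0 < e / 2 by rewrite divr_gt0.
have [N NP] := ul _ e2; have [M MP] := uk _ e2.
have := NP _ (leq_maxl N M); have := MP _ (leq_maxr N M).
set n := maxn N M => uk' ul'.
rewrite (le_trans (le_normc_dist _ (u n) _))// (splitr e) normcB.
exact: ltW (ltrD _ _).
Qed.

Lemma ccvg_le u l (M : R) : ccvg u l ->
  (exists N, forall n, (N <= n)%N -> normc (u n) <= M) -> normc l <= M.
Proof.
move=> ul [N NM]; apply/ler_addgt0Pl => e /ul[K KP].
have := NM _ (leq_maxl N K); have := KP _ (leq_maxr N K).
set n := maxn N K => unl un.
rewrite -(subrK (u n) l) (le_trans (le_normcD _ _))// normcB.
exact: lerD (ltW unl) un.
Qed.

Lemma ccvgD u v l (k : C) : ccvg u l -> ccvg v k ->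
  ccvg (fun n => u n + v n) (l + k).
Proof.
move=> ul vk e e0; have e2 : 0 < e / 2 by rewrite divr_gt0.
have [N NP] := ul _ e2; have [M MP] := vk _ e2.
exists (maxn N M) => n; rewrite geq_max => /andP[/NP un /MP vn].
rewrite opprD addrACA (le_lt_trans (le_normcD _ _))// (splitr e).
exact: ltrD.
Qed.

Lemma ccvg_cst l : ccvg (fun=> l) l.
Proof. by move=> e e0; exists 0%N => n _; rewrite subrr normc0. Qed.

Lemma ccvgMl (c : C) u l : ccvg u l -> ccvg (fun n => c * u n) (c * l).
Proof.
move=> ul e e0; have c0 : 0 < normc c + 1 by rewrite ltr_wpDl ?normc_ge0.
have [N NP] := ul _ (divr_gt0 e0 c0); exists N => n /NP.
rewrite -mulrBr normcM ltr_pdivlMr// => /(le_lt_trans _); apply.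
by rewrite mulrC ler_wpM2l ?normc_ge0// lerDl.
Qed.

Lemma ccvg_sum (N : nat) (u : 'I_N -> nat -> C) (l : 'I_N -> C) :
  (forall i, ccvg (u i) (l i)) ->
  ccvg (fun n => \sum_(i < N) u i n) (\sum_(i < N) l i).
Proof.
elim: N u l => [|N IH] u l ul.
  by move=> e e0; exists 0%N => n _; rewrite !big_ord0 subrr normc0.
have := ccvgD (IH _ _ (fun i => ul (widen_ord (leqnSn N) i))) (ul ord_max).
move=> S e /S[K KP]; exists K => n /KP; rewrite !big_ord_recr /=; exact.
Qed.

Lemma ccvg_shift u l (k : nat) : ccvg u l -> ccvg (fun n => u (n + k)%N) l.
Proof.
by move=> ul e /ul[N NP]; exists N => n Nn; apply: NP; rewrite (leq_trans Nn)// leq_addr.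
Qed.

Lemma eq_ccvg u v l : u =1 v -> ccvg u l -> ccvg v l.
Proof. by move=> uv ul e /ul[N NP]; exists N => n /NP; rewrite uv. Qed.

Lemma ccvg_geometric u l (K q : R) : 0 <= q < 1 ->
  (forall n, normc (u n - l) <= K * q ^+ n) -> ccvg u l.
Proof.
move=> /andP[q0 q1] uK; move=> e e0.
have /cvgrPdist_lt/(_ e e0)[N _ NP] : (geometric K q n @[n --> \oo] --> (0 : R)).
  by apply: cvg_geometric; rewrite ger0_norm.
exists N => n /NP /=; rewrite sub0r normrN; apply: le_lt_trans.
by rewrite (le_trans (uK n))// ler_norm.
Qed.

Definition clim u : C :=
  limn (fun n => complex.Re (u n)) +i* limn (fun n => complex.Im (u n)).

Lemma geometric_increments_le u (K q : R) : 0 <= q < 1 ->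
  (forall n, normc (u n.+1 - u n) <= K * q ^+ n) ->
  forall n k, normc (u (n + k)%N - u n) <= K / (1 - q) * (q ^+ n - q ^+ (n + k)).
Proof.
move=> /andP[q0 q1] uK n; have q1' : 1 - q != 0 by rewrite subr_eq0 gt_eqF.
elim=> [|k IH]; first by rewrite addn0 !subrr normc0 mulr0.
rewrite addnS (le_trans (le_normc_dist _ (u (n + k)%N) _))//.
apply: le_trans (lerD (uK _) IH) _; rewrite exprS le_eqVlt; apply/orP; left.
by apply/eqP; field.
Qed.

Lemma clim_geometric u (K q : R) : 0 <= q < 1 ->
  (forall n, normc (u n.+1 - u n) <= K * q ^+ n) ->
  ccvg u (clim u) /\
  forall n, normc (u n - clim u) <= K / (1 - q) * q ^+ n.
Proof.
move=> q01 uK; have inc := geometric_increments_le q01 uK.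
have /andP[q0 q1] := q01.
have K0 : 0 <= K by have := le_trans (normc_ge0 _) (uK 0%N); rewrite expr0 mulr1.
have c0 : 0 <= K / (1 - q) by rewrite divr_ge0// subr_ge0 ltW.
have inc' n k : normc (u (n + k)%N - u n) <= K / (1 - q) * q ^+ n.
  by rewrite (le_trans (inc n k))// ler_wpM2l// gerBl exprn_ge0.
have part (f : C -> R) : (forall x y, `|f x - f y| <= normc (x - y)) ->
    cvgn (fun n => f (u n)).
  move=> fle; apply: cauchy_cvg; apply: cauchy_exP => e e0.
  have /cvgrPdist_lt/(_ (e / 2))[|N _ NP] :
      (geometric (K / (1 - q)) q n @[n --> \oo] --> (0 : R)).
  - by apply: cvg_geometric; rewrite ger0_norm.
  - by rewrite divr_gt0.
  have uN n : (N <= n)%N -> `|f (u N) - f (u n)| < e / 2.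
    move=> Nn; apply: le_lt_trans (fle _ _) _; rewrite normcB.
    rewrite -(subnKC Nn); apply: le_lt_trans (inc' _ _) _.
    have := NP N (leqnn N); rewrite /= sub0r normrN; apply: le_lt_trans.
    exact: ler_norm.
  exists (f (u N)), N => // n /= Nn; rewrite /ball /=.
  by apply: lt_trans (uN _ Nn) _; rewrite ltr_pdivrMr// ltr_pMr// ltr1n.
have cRe : cvgn (fun n => complex.Re (u n)).
  apply: (part (@complex.Re R)) => x y; rewrite -ReN -ReD; exact: abs_Re_le.
have cIm : cvgn (fun n => complex.Im (u n)).
  apply: (part (@complex.Im R)) => x y; rewrite -ImN -ImD; exact: abs_Im_le.
have ul : ccvg u (clim u).
  move=> e e0; have e2 : 0 < e / 2 by rewrite divr_gt0.
  have /cvgrPdist_lt/(_ _ e2)[N _ NP] := cRe.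
  have /cvgrPdist_lt/(_ _ e2)[M _ MP] := cIm.
  exists (maxn N M) => n; rewrite geq_max => /andP[Nn Mn].
  apply: le_lt_trans (normc_le_ReIm _) _; rewrite (splitr e).
  rewrite ReD ImD ReN ImN /=; apply: ltrD.
    by rewrite distrC; exact: NP.
  by rewrite distrC; exact: MP.
split=> // n; rewrite normcB.
apply: (@ccvg_le (fun m => u m - u n)).
  by apply: ccvgD => //; exact: ccvg_cst.
by exists n => m nm; rewrite -(subnKC nm).
Qed.

Lemma cseriesE (a : nat -> C) (t : C) n :
  [series a k * t ^+ k]_k n = power_sum a n t.
Proof. by rewrite /series /= big_mkord. Qed.

Lemma power_sumS (a : nat -> C) (t : C) n :
  power_sum a n.+1 t = power_sum a n t + a n * t ^+ n.
Proof. by rewrite /power_sum big_ord_recr. Qed.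

Lemma power_sum_cvg_bounded (a : nat -> C) (t l : C) :
  ccvg (power_sum a ^~ t) l ->
  exists M, forall n, normc (a n) * normc t ^+ n <= M.
Proof.
move=> /(_ 1 ltr01)[N NP].
exists (\sum_(k < N) normc (a k) * normc t ^+ k + 2) => n.
have s0 : 0 <= \sum_(k < N) normc (a k) * normc t ^+ k.
  by apply: sumr_ge0 => k _; rewrite mulr_ge0 ?exprn_ge0 ?normc_ge0.
have [nN|Nn] := ltnP n N.
  rewrite (bigD1 (Ordinal nN))//= -addrA lerDl addr_ge0//.
  by apply: sumr_ge0 => k _; rewrite mulr_ge0 ?exprn_ge0 ?normc_ge0.
rewrite (@le_trans _ _ 2)// ?lerDr//.
rewrite -normcX -normcM.
have -> : a n * t ^+ n = power_sum a n.+1 t - power_sum a n t.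
  by rewrite power_sumS addrC addKr.
rewrite (le_trans (le_normc_dist _ l _))// [normc (l - _)]normcB.
have -> : 2 = 1 + 1 :> R by rewrite -natr1.
apply: lerD; apply/ltW/NP; lia.
Qed.

End ComplexLimits.

Section DiskMaximum.
Context {R : realType}.
Local Notation C := R[i].

Lemma closed_disk_max (rho : R) (v : C -> R) : 0 <= rho ->
  (forall z, normc z <= rho -> forall e, 0 < e -> exists2 d, 0 < d &
     forall t, normc t < d -> `|v (z + t) - v z| < e) ->
  exists2 c, normc c <= rho & forall z, normc z <= rho -> v z <= v c.
Proof.
move=> rho0 cv; pose emb (p : R * R) : C := p.1 +i* p.2.
pose A : set (R * R) := [set p | p.1 ^+ 2 + p.2 ^+ 2 <= rho ^+ 2].
have AE p : A p <-> normc (emb p) <= rho.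
  rewrite -(@ler_pXn2r _ 2%N)// ?nnegrE ?normc_ge0// normc2E.
  by case: p.
have cA : compact A.
  apply: (@subclosed_compact _ _ (`[- rho, rho] `*` `[- rho, rho])).
  - have -> : A = (fun p : R * R => p.1 ^+ 2 + p.2 ^+ 2) @^-1` [set x | x <= rho ^+ 2] by [].
    apply: preimage_closed; last exact: closed_le.
    move=> p _; apply: cvgD.
      by apply: cvgM; exact: cvg_fst.
    by apply: cvgM; exact: cvg_snd.
  - by apply: compact_setX; exact: segment_compact.
  - move=> p /AE pr; split; rewrite /= in_itv /= -ler_norml.
      exact: le_trans (abs_Re_le (emb p)) pr.
    exact: le_trans (abs_Im_le (emb p)) pr.
have A0 : A !=set0 by exists (0, 0); rewrite /A /= expr0n addr0 sqr_ge0.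
have cf : {within A, continuous (fun p => v (emb p))}.
  apply: continuous_in_subspaceT => p /set_mem/AE pr.
  apply/cvgrPdist_lt => e e0; have [d d0 dP] := cv _ pr _ e0.
  have d2 : 0 < d / 2 by rewrite divr_gt0.
  exists (ball p.1 (d / 2), ball p.2 (d / 2)).
    by split; exact: nbhsx_ballx.
  move=> q [q1 q2]; rewrite distrC.
  have -> : emb q = emb p + (emb q - emb p) by rewrite addrC subrK.
  apply: dP; apply: le_lt_trans (normc_le_ReIm _) _; rewrite (splitr d).
  by apply: ltrD; rewrite ?ReD ?ReN ?ImD ?ImN distrC.
have [c cA' cmax] := compact_EVT_max A0 cA cf.
exists (emb c); first by apply/AE/set_mem.
move=> z zr; have := cmax (complex.Re z, complex.Im z).
have zE : emb (complex.Re z, complex.Im z) = z by case: (z).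
by rewrite zE; apply; apply/mem_set/AE; rewrite zE.
Qed.

End DiskMaximum.

Section PowerSeries.
Context {R : realType}.
Local Notation C := R[i].
Implicit Types (a : nat -> C) (z t : C).

Definition coef_bounded a := forall s : R, 0 < s < 1 ->
  exists M, forall n, normc (a n) * s ^+ n <= M.

Definition powser a z : C := clim (power_sum a ^~ z).

Lemma coef_geometric a (s : R) : coef_bounded a -> 0 <= s < 1 ->
  exists M q : R, [/\ 0 <= M, 0 <= q < 1 & forall n, normc (a n) * s ^+ n <= M * q ^+ n].
Proof.
move=> ba /andP[s0 s1]; pose g := (1 + s) / 2.
have g0 : 0 < g by rewrite /g; lra.
have sg : s < g by rewrite /g; lra.
have g1 : g < 1 by rewrite /g; lra.
have g01 : 0 < g < 1 by rewrite g0.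
have [M MP] := ba g g01.
have M0 : 0 <= M.
  by apply: le_trans (MP 0%N); rewrite expr0 mulr1 normc_ge0.
exists M, (s / g); split=> //.
  by rewrite divr_ge0 ?(ltW g0)//= ltr_pdivrMr// mul1r.
move=> n; rewrite expr_div_n mulrA ler_pdivlMr ?exprn_gt0//.
by rewrite mulrAC ler_wpM2r ?exprn_ge0.
Qed.

Lemma powser_unif a (s : R) : coef_bounded a -> 0 <= s < 1 ->
  exists K q : R, [/\ 0 <= K, 0 <= q < 1 &
    forall z, normc z <= s -> forall n, normc (power_sum a n z - powser a z) <= K * q ^+ n].
Proof.
move=> ba s01; have [M [q [M0 q01 MP]]] := coef_geometric ba s01.
have /andP[q0 q1] := q01; have /andP[s0 s1] := s01.
exists (M / (1 - q)), q; split=> //; first by rewrite divr_ge0// subr_ge0 ltW.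
move=> z zs n.
have inc k : normc (power_sum a k.+1 z - power_sum a k z) <= M * q ^+ k.
  rewrite power_sumS addrC addKr normcM normcX (le_trans _ (MP k))//.
  by rewrite ler_wpM2l ?normc_ge0// lerXn2r ?nnegrE ?normc_ge0.
by have [_] := clim_geometric q01 inc; exact.
Qed.

Lemma powser_cvg a z : coef_bounded a -> normc z < 1 ->
  ccvg (power_sum a ^~ z) (powser a z).
Proof.
move=> ba z1; have s01 : 0 <= normc z < 1 by rewrite normc_ge0.
have [K [q [K0 q01 KP]]] := powser_unif ba s01.
by apply: (ccvg_geometric q01) => n; exact: KP.
Qed.

Definition binomial_partial_sum z t j K : C :=
  \sum_(k < K) ('C(j, k))%:R * z ^+ (j - k) * t ^+ k.

Lemma binomial_partial_sum_full z t j K : (j < K)%N ->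
  binomial_partial_sum z t j K = (z + t) ^+ j.
Proof.
move=> jK; rewrite exprDn /binomial_partial_sum.
rewrite -(big_mkord xpredT (fun k => ('C(j, k))%:R * z ^+ (j - k) * t ^+ k)).
rewrite (@big_cat_nat _ _ _ j.+1)//= [X in _ + X]big_nat_cond [X in _ + X]big1 ?addr0; last first.
  by move=> k /andP[/andP[jk _] _]; rewrite bin_small// !mul0r.
by rewrite big_mkord; apply: eq_bigr => k _; rewrite -[RHS]mulr_natl mulrA.
Qed.

Lemma binomial_partial_sum_le z t j K :
  normc ((z + t) ^+ j - binomial_partial_sum z t j K) <= (normc z + normc t) ^+ j.
Proof.
have [jK|Kj] := ltnP j K.
  by rewrite binomial_partial_sum_full// subrr normc0 exprn_ge0// addr_ge0 ?normc_ge0.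
rewrite -(binomial_partial_sum_full _ _ (ltnSn j)) /binomial_partial_sum.
pose c k := ('C(j, k))%:R * z ^+ (j - k) * t ^+ k.
rewrite -!(big_mkord xpredT c).
have -> : \sum_(0 <= k < j.+1) c k - \sum_(0 <= k < K) c k = \sum_(K <= k < j.+1) c k.
  rewrite (@big_cat_nat _ _ _ K 0 j.+1)//= ?leqW//.
  by rewrite addrAC subrr add0r.
rewrite exprDn (le_trans (le_normc_sum _ _ _))//.
apply: (@le_trans _ _ (\sum_(0 <= k < j.+1) normc (c k))).
  rewrite [leRHS](@big_cat_nat _ _ _ K 0 j.+1)//= ?leqW// lerDr sumr_ge0// => k _.
  exact: normc_ge0.
rewrite big_mkord ler_sum// => k _.
by rewrite /c !normcM !normcX normc_nat -[leRHS]mulr_natl mulrA.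
Qed.

Lemma powser_recenter a z : coef_bounded a -> normc z < 1 ->
  exists b, forall t, normc t < 1 - normc z ->
    ccvg (power_sum b ^~ t) (powser a (z + t)).
Proof.
move=> ba z1.
pose u k n := \sum_(j < n) a j * (('C(j, k))%:R * z ^+ (j - k)).
pose b k := clim (u k).
have ub k : ccvg (u k) (b k).
  pose x := (1 - normc z) / 2; have x0 : 0 < x by rewrite /x; lra.
  have z0 := normc_ge0 z.
  have s01 : 0 <= normc z + x < 1 by rewrite addr_ge0 ?(ltW x0)//= /x; lra.
  have [M [q [M0 q01 MP]]] := coef_geometric ba s01.
  apply: (proj1 (@clim_geometric _ (u k) (M / x ^+ k) q q01 _)) => n.
  rewrite /u big_ord_recr /= addrAC subrr add0r normcM.
  rewrite mulrAC ler_pdivlMr ?exprn_gt0//; apply: le_trans (MP n).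
  rewrite -mulrA ler_wpM2l ?normc_ge0// normcM normcX normc_nat.
  have [kn|nk] := leqP k n; last first.
    by rewrite bin_small// !mul0r exprn_ge0// addr_ge0// ltW.
  rewrite exprDn (bigD1 (Ordinal (kn : (k < n.+1)%N)))//= -[X in _ <= X + _]mulr_natl mulrA lerDl.
  by apply: sumr_ge0 => i _; rewrite mulrn_wge0// mulr_ge0// exprn_ge0// ltW.
exists b => t tz.
have s01 : 0 <= normc z + normc t < 1.
  by rewrite addr_ge0 ?normc_ge0//=; lra.
have [M [q [M0 q01 MP]]] := coef_geometric ba s01.
have zt1 : normc (z + t) < 1 by apply: le_lt_trans (le_normcD _ _) _; lra.
apply: (@ccvg_geometric _ _ _ (M / (1 - q)) q q01) => K; rewrite normcB.
pose d n := \sum_(j < n) a j * ((z + t) ^+ j - binomial_partial_sum z t j K).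
have dE n : d n = power_sum a n (z + t) - \sum_(k < K) t ^+ k * u k n.
  rewrite /d /power_sum; under eq_bigr do rewrite mulrBr.
  rewrite sumrB; congr (_ - _); rewrite /u.
  under [RHS]eq_bigr do rewrite mulr_sumr.
  rewrite exchange_big /=; apply: eq_bigr => j _.
  rewrite mulr_sumr; apply: eq_bigr => k _; ring.
have dinc n : normc (d n.+1 - d n) <= M * q ^+ n.
  rewrite /d big_ord_recr /= addrAC subrr add0r normcM; apply: le_trans (MP n).
  by rewrite ler_wpM2l ?normc_ge0// binomial_partial_sum_le.
have dK : d K = 0.
  rewrite /d big1// => -[j jK] _ /=.
  by rewrite binomial_partial_sum_full// subrr mulr0.
have /andP[q0 q1] := q01.
apply: (@ccvg_le _ d).
  apply: (@eq_ccvg _ (fun n => power_sum a n (z + t) + - 1 * \sum_(k < K) t ^+ k * u k n)).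
    by move=> n; rewrite dE mulN1r.
  rewrite -[X in ccvg _ (_ - X)]mul1r -mulNr.
  apply: ccvgD; first exact: powser_cvg.
  apply: ccvgMl; rewrite /power_sum.
  under [X in ccvg _ X]eq_bigr do rewrite mulrC.
  by apply: ccvg_sum => k; apply: ccvgMl; exact: ub.
exists K => n Kn; rewrite -(subnKC Kn) -[d _]subr0 -dK.
apply: le_trans (geometric_increments_le q01 dinc _ _) _.
by rewrite ler_wpM2l ?divr_ge0 ?subr_ge0 ?(ltW q1)// gerBl exprn_ge0.
Qed.

End PowerSeries.

Section SecondOrderTaylor.
Context {R : realType}.
Local Notation C := R[i].
Implicit Types (h g : C -> C) (z t : C).

Definition taylor2 h z := exists (b1 b2 : C) (K d : R), [/\ 0 < d, 0 <= K &
  forall t, normc t < d ->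
    normc (h (z + t) - (h z + b1 * t + b2 * t ^+ 2)) <= K * normc t ^+ 3].

Lemma taylor2_cst (c : C) z : taylor2 (fun=> c) z.
Proof.
exists 0, 0, 0, 1; split=> // t _.
by rewrite !mul0r !addr0 subrr normc0.
Qed.

Lemma taylor2D h g z : taylor2 h z -> taylor2 g z ->
  taylor2 (fun x => h x + g x) z.
Proof.
move=> [b1 [b2 [K [d [d0 K0 hP]]]]] [c1 [c2 [L [e [e0 L0 gP]]]]].
exists (b1 + c1), (b2 + c2), (K + L), (Num.min d e).
split=> [||t]; rewrite ?lt_min ?d0 ?addr_ge0// => /andP[td te].
rewrite [leRHS]mulrDl; apply: le_trans (lerD (hP _ td) (gP _ te)).
apply: le_trans (le_normcD _ _); rewrite le_eqVlt; apply/orP; left.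
by apply/eqP; congr normc; ring.
Qed.

Lemma taylor2M h g z : taylor2 h z -> taylor2 g z ->
  taylor2 (fun x => h x * g x) z.
Proof.
move=> [b1 [b2 [K [d [d0 K0 hP]]]]] [c1 [c2 [L [e [e0 L0 gP]]]]].
pose B := normc (h z) + normc b1 + normc b2.
pose G := normc (g z) + normc c1 + normc c2 + L.
have n0 := @normc_ge0 R.
have B0 : 0 <= B by rewrite !addr_ge0.
have G0 : 0 <= G by rewrite !addr_ge0.
pose N := normc (b1 * c2 + b2 * c1) + normc (b2 * c2).
have N0 : 0 <= N by rewrite !addr_ge0.
exists (h z * c1 + b1 * g z), (h z * c2 + b1 * c1 + b2 * g z),
  (K * G + B * L + N), (Num.min 1 (Num.min d e)).
split=> [||t]; rewrite ?lt_min ?ltr01 ?d0 ?addr_ge0 ?mulr_ge0//.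
move=> /and3P[t1 td te].
set x := normc t; have x0 : 0 <= x by exact: n0.
have x1 n : x ^+ n <= 1 by rewrite exprn_ile1// ltW.
set E := h (z + t) - (h z + b1 * t + b2 * t ^+ 2) in hP *.
have EP : normc E <= K * x ^+ 3 by exact: hP.
have FP := gP _ te; set F := g (z + t) - _ in FP.
have -> : h (z + t) * g (z + t) - (h z * g z + (h z * c1 + b1 * g z) * t +
    (h z * c2 + b1 * c1 + b2 * g z) * t ^+ 2) =
  E * g (z + t) + (h z + b1 * t + b2 * t ^+ 2) * F +
    ((b1 * c2 + b2 * c1) * t ^+ 3 + b2 * c2 * t * t ^+ 3).
  by rewrite /E /F; ring.
have gG : normc (g (z + t)) <= G.
  have -> : g (z + t) = (g z + c1 * t + c2 * t ^+ 2) + F by rewrite /F; ring.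
  apply: le_trans (le_normcD _ _) _; apply: lerD; last first.
    by apply: le_trans FP _; rewrite ler_piMr.
  apply: le_trans (le_normcD _ _) _; apply: lerD.
    apply: le_trans (le_normcD _ _) _; apply: lerD => //.
    by rewrite normcM ler_piMr// (x1 1%N).
  by rewrite normcM normcX ler_piMr.
have hB : normc (h z + b1 * t + b2 * t ^+ 2) <= B.
  apply: le_trans (le_normcD _ _) _; apply: lerD.
    apply: le_trans (le_normcD _ _) _; apply: lerD => //.
    by rewrite normcM ler_piMr// (x1 1%N).
  by rewrite normcM normcX ler_piMr.
rewrite [leRHS]mulrDl; apply: le_trans (le_normcD _ _) _; apply: lerD.
  rewrite [leRHS]mulrDl; apply: le_trans (le_normcD _ _) _; apply: lerD.
    by rewrite normcM mulrAC; apply: ler_pM.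
  by rewrite normcM -mulrA; apply: ler_pM.
rewrite /N [leRHS]mulrDl; apply: le_trans (le_normcD _ _) _; apply: lerD.
  by rewrite normcM normcX.
rewrite normcM normcX ler_wpM2r ?exprn_ge0//.
by rewrite normcM ler_piMr// (x1 1%N).
Qed.

Lemma taylor2X h z n : taylor2 h z -> taylor2 (fun x => h x ^+ n) z.
Proof.
move=> th; elim: n => [|n IH]; first exact: taylor2_cst.
by under eq_fun do rewrite exprS; exact: taylor2M.
Qed.

Lemma taylor2_sum (I : Type) (s : seq I) (F : I -> C -> C) z :
  (forall i, taylor2 (F i) z) -> taylor2 (fun x => \sum_(i <- s) F i x) z.
Proof.
move=> tF; elim: s => [|i s IH].
  by under eq_fun do rewrite big_nil; exact: taylor2_cst.
by under eq_fun do rewrite big_cons; exact: taylor2D.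
Qed.

Lemma taylor2_inv z : z != 0 -> taylor2 GRing.inv z.
Proof.
move=> z0; have nz : 0 < normc z by rewrite normc_gt0.
exists (- z^-1 ^+ 2), (z^-1 ^+ 3), (2 / normc z ^+ 4), (normc z / 2).
split=> [||t tz]; rewrite ?divr_gt0 ?divr_ge0 ?exprn_ge0 ?normc_ge0//.
have zt : normc z / 2 <= normc (z + t).
  have := le_normc_sub z (- t); rewrite opprK normcN; apply: le_trans; lra.
have zt0 : z + t != 0 by rewrite -normc_gt0; apply: lt_le_trans zt; rewrite divr_gt0.
have -> : (z + t)^-1 - (z^-1 + - z^-1 ^+ 2 * t + z^-1 ^+ 3 * t ^+ 2) =
    - (z ^+ 3)^-1 * (z + t)^-1 * t ^+ 3.
  by field; rewrite z0 zt0.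
rewrite normcM normcX ler_wpM2r ?exprn_ge0 ?normc_ge0//.
rewrite normcM normcN !normcV normcX.
have -> : 2 / normc z ^+ 4 = (normc z ^+ 3)^-1 * (normc z / 2)^-1.
  by field; rewrite gt_eqF.
rewrite ler_wpM2l ?invr_ge0 ?exprn_ge0 ?normc_ge0// lef_pV2// posrE ?divr_gt0//.
by rewrite normc_gt0.
Qed.

Lemma taylor2_scale h (w z : C) : normc w = 1 -> taylor2 h (w * z) ->
  taylor2 (fun x => h (w * x)) z.
Proof.
move=> w1 [b1 [b2 [K [d [d0 K0 hP]]]]].
exists (b1 * w), (b2 * w ^+ 2), K, d; split=> // t td.
have := hP (w * t); rewrite normcM w1 mul1r => /(_ td).
by apply: le_trans; rewrite mulrDr exprMn !mulrA.
Qed.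

Lemma taylor2_local h g z : (exists2 d : R, 0 < d & forall t, normc t < d ->
    h (z + t) = g (z + t)) -> taylor2 g z -> taylor2 h z.
Proof.
move=> [d d0 hg] [b1 [b2 [K [e [e0 K0 gP]]]]].
have hz : h z = g z by have := hg 0; rewrite normc0 addr0; apply.
exists b1, b2, K, (Num.min d e); split=> [||t]; rewrite ?lt_min ?d0//.
by move=> /andP[td te]; rewrite hg// hz; exact: gP.
Qed.

Lemma taylor2_continuous h z : taylor2 h z -> forall e : R, 0 < e ->
  exists2 d : R, 0 < d & forall t, normc t < d -> normc (h (z + t) - h z) < e.
Proof.
move=> [b1 [b2 [K [d [d0 K0 hP]]]]] e e0.
pose L := normc b1 + normc b2 + K + 1.
have n0 := @normc_ge0 R.
have L0 : 0 < L by rewrite ltr_wpDl// !addr_ge0.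
exists (Num.min d (Num.min 1 (e / L))) => [|t].
  by rewrite !lt_min d0 ltr01 divr_gt0.
rewrite !lt_min => /and3P[td t1 te].
have x1 n : normc t ^+ n <= 1 by rewrite exprn_ile1// ltW.
apply: (@le_lt_trans _ _ ((normc b1 + normc b2 + K) * normc t)).
  have -> : h (z + t) - h z =
    b1 * t + b2 * t ^+ 2 + (h (z + t) - (h z + b1 * t + b2 * t ^+ 2)) by ring.
  rewrite [leRHS]mulrDl [X in _ <= X + _]mulrDl; apply: le_trans (le_normcD _ _) _; apply: lerD.
    apply: le_trans (le_normcD _ _) _; apply: lerD; rewrite normcM// normcX.
    by rewrite ler_wpM2l// exprS ler_piMr// (x1 1%N).
  by apply: le_trans (hP _ td) _; rewrite ler_wpM2l// exprS ler_piMr.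
have [->|tn0] := eqVneq (normc t) 0; first by rewrite mulr0.
have t0 : 0 < normc t by rewrite lt0r tn0 n0.
apply: (@lt_trans _ _ (L * normc t)); first by rewrite ltr_pM2r// /L ltrDl.
by rewrite mulrC -ltr_pdivlMr.
Qed.

Lemma taylor2_series h z (b : nat -> C) (r : R) : 0 < r ->
  (forall t, normc t < r -> ccvg (power_sum b ^~ t) (h (z + t))) ->
  taylor2 h z.
Proof.
move=> r0 hP; pose p := r / 2.
have p0 : 0 < p by rewrite /p; lra.
have npC : normc p%:C = p by rewrite normc_real ger0_norm// ltW.
have pr : normc p%:C < r by rewrite npC /p; lra.
have [M MP] := power_sum_cvg_bounded (hP _ pr); rewrite npC in MP.
have M0 : 0 <= M by apply: le_trans (MP 0%N); rewrite expr0 mulr1 normc_ge0.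
have b0 : b 0%N = h z.
  have := hP 0; rewrite normc0 addr0 => /(_ r0)/(ccvg_unique _); apply.
  move=> e e0; exists 1%N => n n1; rewrite /power_sum -(prednK n1).
  rewrite big_ord_recl expr0 mulr1 big1 ?addr0 ?subrr ?normc0// => i _.
  by rewrite expr0n mulr0.
exists (b 1%N), (b 2%N), (M * 2 / p ^+ 3), (p / 2).
split=> [||t tp]; first by rewrite divr_gt0.
  by rewrite divr_ge0 ?mulr_ge0 ?exprn_ge0// ltW.
set x := normc t; have x0 : 0 <= x := normc_ge0 t.
pose u n := power_sum b (n + 3)%N t.
have s3 : u 0%N = h z + b 1%N * t + b 2%N * t ^+ 2.
  by rewrite /u /power_sum !big_ord_recr big_ord0 /= b0; ring.
have half : 0 <= (2^-1 : R) < 1 by rewrite invr_ge0 ler0n /=; lra.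
have inc n : normc (u n.+1 - u n) <= M * (x / p) ^+ 3 * 2^-1 ^+ n.
  rewrite /u addSn power_sumS addrAC subrr add0r normcM normcX.
  have := MP (n + 3)%N; rewrite -ler_pdivlMr ?exprn_gt0// => bM.
  apply: (@le_trans _ _ (M / p ^+ (n + 3) * x ^+ (n + 3))).
    by rewrite ler_wpM2r ?exprn_ge0.
  have xp0 : 0 <= x / p by rewrite divr_ge0 ?(ltW p0).
  rewrite -mulrA [_^-1 * _]mulrC -expr_div_n [(n + 3)%N]addnC exprD mulrA.
  apply: ler_wpM2l; first by apply: mulr_ge0 => //; exact: exprn_ge0.
  rewrite lerXn2r ?nnegrE ?invr_ge0//.
  by rewrite ler_pdivrMr// mulrC ltW.
have [uc uP] := clim_geometric half inc.
have -> : h (z + t) = clim u.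
  apply: (ccvg_unique _ uc); apply: (ccvg_shift 3 (u := power_sum b ^~ t)); apply: hP.
  by apply: lt_trans tp _; rewrite /p; lra.
rewrite -s3 normcB; apply: le_trans (uP 0%N) _; rewrite expr0 mulr1.
rewrite le_eqVlt; apply/orP; left; apply/eqP.
by rewrite expr_div_n; field; rewrite gt_eqF.
Qed.

Lemma analytic_taylor2 (U : set C) h z : analytic_on U h -> U z -> taylor2 h z.
Proof.
move=> ah Uz; have [r [b [r0 hP]]] := ah _ Uz.
apply: (@taylor2_series _ _ b r) => // t tr; apply/ccvgP.
have := hP (z + t); rewrite addrAC subrr add0r normc_normr ltcR => /(_ tr).
have -> // : [series b k * t ^+ k]_k = power_sum b ^~ t.
by apply/funext => n; exact: cseriesE.
Qed.

End SecondOrderTaylor.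

Section MaximumPrinciple.
Context {R : realType}.
Local Notation C := R[i].
Implicit Types (h : C -> C) (z t : C).

Lemma normc2D z t : normc (z + t) ^+ 2 = normc z ^+ 2 + normc t ^+ 2 +
  2 * (complex.Re z * complex.Re t + complex.Im z * complex.Im t).
Proof. by rewrite !normc2E ReD ImD; ring. Qed.

Lemma normc2_continuous z (e : R) : 0 < e ->
  exists2 d : R, 0 < d & forall t, normc t < d ->
    `|normc (z + t) ^+ 2 - normc z ^+ 2| < e.
Proof.
move=> e0; pose L := 2 * normc z + 1.
have L0 : 0 < L by rewrite ltr_wpDl// mulr_ge0// normc_ge0.
exists (Num.min 1 (e / L)) => [|t]; first by rewrite lt_min ltr01 divr_gt0.
rewrite lt_min => /andP[t1]; rewrite ltr_pdivlMr// => te.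
have -> : normc (z + t) ^+ 2 - normc z ^+ 2 =
  (normc (z + t) - normc z) * (normc (z + t) + normc z) by ring.
apply: le_lt_trans te; rewrite normrM ler_pM//.
  rewrite ler_norml; have := le_normc_sub z (- t); have := le_normcD z t.
  rewrite opprK normcN; lra.
rewrite ger0_norm ?addr_ge0 ?normc_ge0// /L; have := le_normcD z t; lra.
Qed.

(* The average of [h] over the four points [c + i^j t] is [h c] up to
   [O(t^3)], while that of [|z|^2] exceeds [|c|^2] by [t^2]: hence
   [Re h + eps |z|^2] has no interior maximum. *)
Lemma max_principle_Re h (rho M : R) : 0 < rho ->
  (forall z, normc z <= rho -> taylor2 h z) ->
  (forall z, normc z = rho -> complex.Re (h z) <= M) ->
  forall z, normc z <= rho -> complex.Re (h z) <= M.
Proof.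
move=> rho0 th hM z zr; apply/ler_addgt0Pl => e e0.
pose eps := e / rho ^+ 2; have eps0 : 0 < eps by rewrite divr_gt0 ?exprn_gt0.
have epsE : eps * rho ^+ 2 = e by rewrite /eps divfK// expf_neq0 ?gt_eqF.
pose v x := complex.Re (h x) + eps * normc x ^+ 2.
have [|c cr cmax] := @closed_disk_max _ rho v (ltW rho0).
  move=> x xr d d0; have d2 : 0 < d / 2 by rewrite divr_gt0.
  have [d1 d10 d1P] := taylor2_continuous (th _ xr) d2.
  have [d3 d30 d3P] := normc2_continuous x (divr_gt0 d2 eps0).
  exists (Num.min d1 d3) => [|t]; first by rewrite lt_min d10.
  rewrite lt_min => /andP[/d1P H1 /d3P H3].
  have -> : v (x + t) - v x = complex.Re (h (x + t) - h x) +
      eps * (normc (x + t) ^+ 2 - normc x ^+ 2).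
    by rewrite /v ReD ReN; ring.
  apply: le_lt_trans (ler_normD _ _) _; rewrite (splitr d); apply: ltrD.
    exact: le_lt_trans (abs_Re_le _) H1.
  by rewrite normrM (gtr0_norm eps0) mulrC -ltr_pdivlMr.
have [crho|] := eqVneq (normc c) rho.
  have := cmax z zr; rewrite /v crho epsE => vz.
  have := hM _ crho; have : 0 <= eps * normc z ^+ 2.
    by rewrite mulr_ge0 ?sqr_ge0 ?ltW.
  lra.
move=> crho; exfalso.
have clt : normc c < rho by rewrite lt_neqAle crho.
have [b1 [b2 [K [d [d0 K0 hP]]]]] := th _ cr.
pose s := Num.min (d / 2) (Num.min (rho - normc c) (eps / (K + 1))).
have K1 : 0 < K + 1 by rewrite ltr_wpDl.
have s0 : 0 < s by rewrite /s !lt_min subr_gt0 clt (divr_gt0 d0)// (divr_gt0 eps0 K1).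
have sd : s < d.
  by apply: le_lt_trans (_ : d / 2 < d); [rewrite /s ge_min lexx | lra].
have sr : s <= rho - normc c by rewrite /s !ge_min lexx orbT.
have Ks : K * s < eps.
  have : s <= eps / (K + 1) by rewrite /s !ge_min lexx !orbT.
  rewrite ler_pdivlMr//; lra.
pose t := s%:C; have nt : normc t = s by rewrite normc_real gtr0_norm.
have ni : normc ('i%C * t) = s by rewrite normcM normc_i mul1r.
have pt x : normc x = s -> v (c + x) <= v c /\
    - (K * s ^+ 3) <= complex.Re (h (c + x) - (h c + b1 * x + b2 * x ^+ 2)).
  move=> xs; split.
    apply: cmax; apply: le_trans (le_normcD _ _) _; rewrite xs; lra.
  have := hP x; rewrite xs => /(_ sd)/(le_trans (abs_Re_le _)).
  by rewrite ler_norml => /andP[].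
have [v1 e1] := pt _ nt.
have [v2 e2] := pt (- t) (etrans (normcN _) nt).
have [v3 e3] := pt _ ni.
have [v4 e4] := pt (- ('i%C * t)) (etrans (normcN _) ni).
have ii : 'i%C * 'i%C = -1 :> C by rewrite -expr2 sqr_i.
set E1 := h (c + t) - _ in e1; set E2 := h (c - t) - _ in e2.
set E3 := h (c + 'i%C * t) - _ in e3; set E4 := h (c - 'i%C * t) - _ in e4.
have ES : E1 + E2 + E3 + E4 = h (c + t) + h (c - t) + h (c + 'i%C * t) +
    h (c - 'i%C * t) - (h c + h c + h c + h c).
  rewrite /E1 /E2 /E3 /E4 sqrrN [in X in _ + X]sqrrN [('i%C * t) ^+ 2]exprMn sqr_i; ring.
clearbody E1 E2 E3 E4.
have := congr1 (@complex.Re R) ES; rewrite !(ReD, ReN) => ER.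
have NS : normc (c + t) ^+ 2 + normc (c - t) ^+ 2 + normc (c + 'i%C * t) ^+ 2 +
    normc (c - 'i%C * t) ^+ 2 = 4 * normc c ^+ 2 + 4 * s ^+ 2.
  by rewrite !normc2D !normcN nt ni !(ReN, ImN); ring.
have s3 : K * s ^+ 3 < eps * s ^+ 2.
  by rewrite exprSr mulrCA mulrC ltr_pM2r ?exprn_gt0// mulrC.
move: v1 v2 v3 v4 e1 e2 e3 e4; rewrite /v.
have : eps * (normc (c + t) ^+ 2 + normc (c - t) ^+ 2 + normc (c + 'i%C * t) ^+ 2 +
    normc (c - 'i%C * t) ^+ 2) = eps * (4 * normc c ^+ 2 + 4 * s ^+ 2) by rewrite NS.
rewrite !mulrDr => NE v1 v2 v3 v4 e1 e2 e3 e4.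
lra.
Qed.

Lemma max_principle h (rho M : R) : 0 < rho ->
  (forall z, normc z <= rho -> taylor2 h z) ->
  (forall z, normc z = rho -> normc (h z) <= M) ->
  forall z, normc z <= rho -> normc (h z) <= M.
Proof.
move=> rho0 th hM z zr; have [hz0|hz0] := eqVneq (h z) 0.
  rewrite hz0 normc0 -(normc0 R).
  have := hM rho%:C; rewrite normc_real (gtr0_norm rho0) => /(_ erefl).
  by apply: le_trans; rewrite normc0 normc_ge0.
have nz : normc (h z) != 0 by rewrite normc_eq0.
pose w := conjc (h z) / (normc (h z))%:C.
have w1 : normc w = 1.
  by rewrite /w normcM normcV normcJ_eq normc_real ger0_norm ?normc_ge0// divff.
have -> : normc (h z) = complex.Re (w * h z).
  rewrite /w mulrAC [conjc _ * _]mulrC mulcJ -fmorphV -rmorphM /=.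
  by rewrite expr2 mulfK.
apply: (@max_principle_Re (fun x => w * h x) _ _ rho0) => // x xr.
  by apply: taylor2M; [exact: taylor2_cst | exact: th].
apply: le_trans (hM _ xr); rewrite -[leRHS]mul1r -w1 -normcM.
exact: le_trans (ler_norm _) (abs_Re_le _).
Qed.

Lemma taylor2_bounded h (rho : R) : 0 <= rho ->
  (forall z, normc z <= rho -> taylor2 h z) ->
  exists M, forall z, normc z <= rho -> normc (h z) <= M.
Proof.
move=> rho0 th; have [|c _ cmax] := @closed_disk_max _ rho (fun x => normc (h x)) rho0.
  move=> x xr e e0; have [d d0 dP] := taylor2_continuous (th _ xr) e0.
  exists d => // t /dP; apply: le_lt_trans; rewrite /= ler_norml.
  have := le_normc_sub (h (x + t)) (h x); have := le_normc_sub (h x) (h (x + t)).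
  by rewrite [normc (h x - _)]normcB; lra.
by exists (normc (h c)).
Qed.

End MaximumPrinciple.

Section GlobalExpansion.
Context {R : realType}.
Local Notation C := R[i].
Implicit Types (a c : nat -> C) (z t : C).

Lemma complex_prim_root n : (0 < n)%N -> exists w : C, n.-primitive_root w.
Proof.
move=> n0; pose p : {poly C} := 'X^n - 1.
have [r Dp] := closed_field_poly_normal p.
rewrite (monicP _) ?monicXnsubC// scale1r in Dp.
have rn1 : all n.-unity_root r.
  by apply/allP => z; rewrite -root_prod_XsubC -Dp.
have sz_r : (n < (size r).+1)%N.
  by rewrite -(size_prod_XsubC r id) -Dp size_XnsubC.
have Ur : uniq r.
  by rewrite -separable_prod_XsubC -Dp separable_Xn_sub_1// pnatr_eq0 -lt0n.
by have [z] := hasP (cyclic.has_prim_root n0 rn1 Ur sz_r); exists z.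
Qed.

Lemma normc_prim_root n (w : C) : n.-primitive_root w -> normc w = 1.
Proof.
move=> pw; apply/eqP; rewrite -(@pexpr_eq1 _ _ n) ?normc_ge0 ?(prim_order_gt0 pw)//.
by rewrite -normcX (prim_expr_order pw) normc1.
Qed.

Lemma prim_root_sum n (w : C) k : n.-primitive_root w ->
  \sum_(j < n) w ^+ (j * k) = if (n %| k)%N then n%:R else 0.
Proof.
move=> pw; rewrite (eq_bigr (fun j : 'I_n => (w ^+ k) ^+ j)); last first.
  by move=> j _; rewrite -exprM mulnC.
case: ifP => nk.
  rewrite (eq_bigr (fun=> 1)) ?sumr_const ?card_ord// => j _.
  by move: nk; rewrite (prim_order_dvd pw) => /eqP ->; rewrite expr1n.
have wk : w ^+ k - 1 != 0 by rewrite subr_eq0 -(prim_order_dvd pw) nk.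
apply: (mulfI wk); rewrite mulr0 -subrX1 -exprM mulnC exprM.
by rewrite (prim_expr_order pw) expr1n subrr.
Qed.

Lemma power_sum_shift c n t m : (forall k, (k < n)%N -> c k = 0) ->
  power_sum c (n + m) t = t ^+ n * power_sum (fun k => c (n + k)%N) m t.
Proof.
move=> c0; elim: m => [|m IH].
  rewrite addn0 /power_sum big_ord0 mulr0 big1// => i _.
  by rewrite c0// mul0r.
by rewrite addnS !power_sumS IH mulrDr exprD mulrCA.
Qed.

(* Schwarz's lemma for a zero of order [n] at the origin: the maximum
   principle applied to [F z / z ^+ n]. *)
Lemma schwarz_order (F : C -> C) c n (r rho M : R) : 0 < r -> 0 < rho ->
  (forall z, normc z <= rho -> taylor2 F z) ->
  (forall t, normc t < r -> ccvg (power_sum c ^~ t) (F t)) ->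
  (forall k, (k < n)%N -> c k = 0) ->
  (forall z, normc z = rho -> normc (F z) <= M) ->
  normc (c n) * rho ^+ n <= M /\
  forall z, z != 0 -> normc z <= rho -> normc (F z) * rho ^+ n <= M * normc z ^+ n.
Proof.
move=> r0 rho0 tF Fc c0 FM.
pose h z := if z == 0 then c n else F z * z^-1 ^+ n.
have th z : normc z <= rho -> taylor2 h z.
  move=> zr; have [->|z0] := eqVneq z 0.
    apply: (@taylor2_series _ _ _ (fun k => c (n + k)%N) r) => // t tr.
    rewrite add0r /h; case: eqVneq => [->|t0].
      move=> e e0; exists 1%N => m m1; rewrite /power_sum -(prednK m1).
      rewrite big_ord_recl expr0 mulr1 addn0 big1 ?addr0 ?subrr ?normc0// => i _.
      by rewrite expr0n mulr0.
    have := ccvgMl (t^-1 ^+ n) (ccvg_shift n (Fc _ tr)); rewrite mulrC.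
    apply: eq_ccvg => m; rewrite addnC power_sum_shift// mulrA -exprMn.
    by rewrite mulVf// expr1n mul1r.
  apply: (@taylor2_local _ _ (fun x => F x * x^-1 ^+ n)); last first.
    by apply: taylor2M; [exact: tF | apply: taylor2X; exact: taylor2_inv].
  exists (normc z); rewrite ?normc_gt0// => t tz; rewrite /h ifF//.
  apply/negbTE; rewrite -normc_gt0; have := le_normc_sub z (- t).
  by rewrite opprK normcN; lra.
have rn0 : 0 < rho ^+ n by rewrite exprn_gt0.
have hM z : normc z <= rho -> normc (h z) <= M / rho ^+ n.
  apply: max_principle => // x xr; rewrite /h ifF; last first.
    by apply/negbTE; rewrite -normc_gt0 xr.
  by rewrite normcM normcX normcV xr exprVn ler_pM2r ?invr_gt0// FM.
split=> [|z z0 zr].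
  by rewrite -ler_pdivlMr//; have := hM 0; rewrite normc0 /h eqxx; apply; exact: ltW.
have := hM _ zr; rewrite /h (negbTE z0) normcM normcX normcV exprVn.
rewrite ler_pdivlMr// mulrAC ler_pdivrMr//.
by rewrite exprn_gt0// normc_gt0.
Qed.

Lemma cauchy_estimate (f : C -> C) a (r rho M : R) n : 0 < r -> 0 < rho ->
  (forall z, normc z <= rho -> taylor2 f z) ->
  (forall t, normc t < r -> ccvg (power_sum a ^~ t) (f t)) ->
  (forall z, normc z <= rho -> normc (f z) <= M) ->
  normc (a n) * rho ^+ n <= M.
Proof.
move=> r0 rho0 tf fa fM.
have [w pw] := complex_prim_root (ltn0Sn n).
have nw := normc_prim_root pw.
have nwX j : normc (w ^+ j) = 1 by rewrite normcX nw expr1n.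
have N0 : n.+1%:R != 0 :> C by rewrite pnatr_eq0.
pose F z := \sum_(j < n.+1) n.+1%:R^-1 * w ^+ j * f (w ^+ j * z).
pose c k := if (n.+1 %| k.+1)%N then a k else 0.
have -> : a n = c n by rewrite /c dvdnn.
apply: (proj1 (@schwarz_order F c n r rho M r0 rho0 _ _ _ _)).
- move=> z zr; apply: taylor2_sum => j; apply: taylor2M; first exact: taylor2_cst.
  by apply: taylor2_scale => //; apply: tf; rewrite normcM nwX mul1r.
- move=> t tr; apply: (@eq_ccvg _ (fun m => \sum_(j < n.+1)
      n.+1%:R^-1 * w ^+ j * power_sum a m (w ^+ j * t))); last first.
    apply: ccvg_sum => j; apply: ccvgMl; apply: fa.
    by rewrite normcM nwX mul1r.
  move=> m; rewrite /power_sum; under eq_bigr do rewrite mulr_sumr.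
  rewrite exchange_big /=; apply: eq_bigr => k _.
  transitivity (n.+1%:R^-1 * a k * t ^+ k * \sum_(j < n.+1) w ^+ (j * k.+1)).
    rewrite mulr_sumr; apply: eq_bigr => j _.
    by rewrite exprMn -exprM mulnS exprD; ring.
  rewrite prim_root_sum// /c; case: ifP => _; last by rewrite mulr0 mul0r.
  by rewrite [LHS]mulrC !mulrA divff ?mul1r.
- move=> k kn; rewrite /c ifF//; apply/negbTE/negP => /(dvdn_leq (ltn0Sn k)).
  by rewrite ltnS leqNgt kn.
- move=> z zr; apply: le_trans (le_normc_sum _ _ _) _.
  rewrite (le_trans (y := \sum_(j < n.+1) n.+1%:R^-1 * M))//.
    apply: ler_sum => j _; rewrite normcM normcM nwX mulr1 normcV normc_nat.
    by rewrite ler_wpM2l// fM// normcM nwX mul1r zr.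
  by rewrite sumr_const card_ord -[leLHS]mulr_natl mulrA divff ?mul1r//.
Qed.

Lemma exp_bound_eq0 (x M q : R) : 0 <= x -> 0 <= q < 1 ->
  (forall n, x <= M * q ^+ n) -> x = 0.
Proof.
move=> x0 q01 xM; have : ccvg (fun=> x%:C) 0.
  by apply: (ccvg_geometric q01) => n; rewrite subr0 normc_real ger0_norm.
by move=> /(ccvg_unique (ccvg_cst _)) [].
Qed.

Theorem analytic_disk_powser (f : C -> C) : analytic_on (@unit_disk R) f ->
  exists a, coef_bounded a /\ forall z, normc z < 1 -> f z = powser a z.
Proof.
move=> af; have tf z : normc z < 1 -> taylor2 f z.
  by move=> /unit_diskE; exact: analytic_taylor2.
have [r [a [r0 fa]]] : exists (r : R) (a : nat -> C), 0 < r /\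
    forall t, normc t < r -> ccvg (power_sum a ^~ t) (f t).
  have [|r [a [r0 fa]]] := af 0; first by apply/unit_diskE; rewrite normc0.
  exists r, a; split=> // t tr; apply/ccvgP; have := fa t.
  rewrite subr0 normc_normr ltcR => /(_ tr).
  have -> // : [series a k * t ^+ k]_k = power_sum a ^~ t.
  by apply/funext => n; exact: cseriesE.
have ba : coef_bounded a.
  move=> s /andP[s0 s1].
  have tfs z : normc z <= s -> taylor2 f z by move=> zs; apply/tf/le_lt_trans/s1.
  have [M fM] := taylor2_bounded (ltW s0) tfs.
  by exists M => n; apply: (@cauchy_estimate f a r).
exists a; split=> // z z1.
have tg x : normc x < 1 -> taylor2 (powser a) x.
  move=> x1; have [b bP] := powser_recenter ba x1.
  by apply: (@taylor2_series _ _ _ b (1 - normc x)) => //; rewrite subr_gt0.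
have [->|z0] := eqVneq z 0.
  apply: ccvg_unique (powser_cvg ba _); last by rewrite normc0.
  by apply: fa; rewrite normc0.
pose s := (1 + normc z) / 2.
have zs : normc z < s by rewrite /s; lra.
have s1 : s < 1 by rewrite /s; lra.
have s0 : 0 < s by apply: le_lt_trans zs; exact: normc_ge0.
pose d x := f x + (-1) * powser a x.
have td x : normc x <= s -> taylor2 d x.
  move=> xs; have x1 := le_lt_trans xs s1.
  apply: taylor2D; first exact: tf.
  by apply: taylor2M; [exact: taylor2_cst | exact: tg].
have [M dM] := taylor2_bounded (ltW s0) td.
have dn n : normc (d z) <= M * (normc z / s) ^+ n.
  have := @schwarz_order d (fun=> 0) n (Num.min r 1) s M.
  rewrite lt_min r0 ltr01 => /(_ isT s0 td); case.
  - move=> t; rewrite lt_min => /andP[tr t1].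
    have -> : d t = 0.
      rewrite /d (ccvg_unique (fa _ tr) (powser_cvg ba t1)).
      by rewrite mulN1r subrr.
    apply: (eq_ccvg _ (ccvg_cst 0)) => m.
    by rewrite /power_sum big1// => k _; rewrite mul0r.
  - by [].
  - by move=> x xs; apply: dM; rewrite xs.
  - move=> _ /(_ z z0 (ltW zs)) H; rewrite expr_div_n mulrA.
    by rewrite ler_pdivlMr// exprn_gt0.
have q01 : 0 <= normc z / s < 1.
  by rewrite divr_ge0 ?normc_ge0 ?(ltW s0)//= ltr_pdivrMr// mul1r.
have /eqP := exp_bound_eq0 (normc_ge0 _) q01 dn.
by rewrite normc_eq0 /d mulN1r subr_eq0 => /eqP.
Qed.

End GlobalExpansion.

Section WeightedSequences.
Context {R : realType}.
Local Notation C := R[i].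
Implicit Types (a b u v : nat -> C).

Definition wsum u v N : R :=
  \sum_(n < N) complex.Re (u n * conjc (v n)) / n.+1%:R.

(* [wl2] and [ip] model the Bergman norm: z^n has squared norm 1 / (n + 1). *)
Definition wl2 a := exists M, forall N, wsum a a N <= M.

Definition ip u v : R := limn (wsum u v).

Lemma Re_mulcJ (z : C) : complex.Re (z * conjc z) = normc z ^+ 2.
Proof. by rewrite mulcJ. Qed.

Lemma wsum_sqE a N : wsum a a N = \sum_(n < N) normc (a n) ^+ 2 / n.+1%:R.
Proof. by apply: eq_bigr => n _; rewrite Re_mulcJ. Qed.

Lemma wsumS u v N :
  wsum u v N.+1 = wsum u v N + complex.Re (u N * conjc (v N)) / N.+1%:R.
Proof. by rewrite /wsum big_ord_recr. Qed.

Lemma wsum_nd a : nondecreasing_seq (wsum a a).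
Proof.
apply/nondecreasing_seqP => N; rewrite wsumS Re_mulcJ lerDl.
by rewrite divr_ge0 ?sqr_ge0.
Qed.

Lemma wsum_ge0 a N : 0 <= wsum a a N.
Proof. by rewrite wsum_sqE sumr_ge0// => n _; rewrite divr_ge0 ?sqr_ge0. Qed.

Lemma wl2_cvg a : wl2 a -> wsum a a n @[n --> \oo] --> ip a a.
Proof.
move=> [M aM]; apply: nondecreasing_is_cvgn; first exact: wsum_nd.
by exists M => _ [N _ <-].
Qed.

Lemma wsum_le_ip a N : wl2 a -> wsum a a N <= ip a a.
Proof.
by move=> wa; apply: nondecreasing_cvgn_le; [exact: wsum_nd | exact: wl2_cvg].
Qed.

Lemma ip_le a M : (forall N, wsum a a N <= M) -> ip a a <= M.
Proof.
move=> aM; have wa : wl2 a by exists M.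
by apply: limr_le; [exact: wl2_cvg | exact: nearW].
Qed.

Lemma ip_ge0 a : wl2 a -> 0 <= ip a a.
Proof. by move=> wa; apply: le_trans (wsum_le_ip 0 wa); rewrite /wsum big_ord0. Qed.

Lemma normc_le_ip a n : wl2 a -> normc (a n) ^+ 2 <= n.+1%:R * ip a a.
Proof.
move=> wa; have := wsum_le_ip n.+1 wa; rewrite wsumS Re_mulcJ => H.
have : normc (a n) ^+ 2 / n.+1%:R <= ip a a.
  by apply: le_trans H; rewrite lerDr wsum_ge0.
by rewrite ler_pdivrMr// mulrC.
Qed.

Lemma ip_eq0 a : wl2 a -> ip a a = 0 -> a = fun=> 0.
Proof.
move=> wa a0; apply/funext => n; apply/eqP; rewrite -normc_eq0 -sqrf_eq0.
have := normc_le_ip n wa; rewrite a0 mulr0 => h.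
by rewrite eq_le h sqr_ge0.
Qed.

Lemma wsumC u v N : wsum u v N = wsum v u N.
Proof.
apply: eq_bigr => n _; congr (_ / _).
by rewrite !ReM !ReJ !ImJ; ring.
Qed.

Lemma wsumDl a b v N : wsum (fun n => a n + b n) v N = wsum a v N + wsum b v N.
Proof.
rewrite /wsum -big_split; apply: eq_bigr => n _ /=.
by rewrite mulrDl ReD mulrDl.
Qed.

Lemma wsumZl (x : R) a v N : wsum (fun n => x%:C * a n) v N = x * wsum a v N.
Proof.
rewrite /wsum mulr_sumr; apply: eq_bigr => n _ /=.
by rewrite mulrA -mulrA ReM /= mul0r subr0.
Qed.

Lemma wsumDr a b v N : wsum v (fun n => a n + b n) N = wsum v a N + wsum v b N.
Proof. by rewrite wsumC wsumDl !(wsumC v). Qed.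

Lemma wsumZr (x : R) a v N : wsum v (fun n => x%:C * a n) N = x * wsum v a N.
Proof. by rewrite wsumC wsumZl (wsumC v). Qed.

Lemma wsumM_adj (c : C) u v N :
  wsum (fun n => c * u n) v N = wsum u (fun n => conjc c * v n) N.
Proof.
apply: eq_bigr => n _; rewrite rmorphM /= conjcK.
by rewrite [c * _]mulrC mulrA.
Qed.

Lemma wsum_scale (c : C) a N :
  wsum (fun n => c * a n) (fun n => c * a n) N = normc c ^+ 2 * wsum a a N.
Proof.
rewrite !wsum_sqE mulr_sumr; apply: eq_bigr => n _.
by rewrite normcM exprMn mulrA.
Qed.

(* Parallelogram law with one summand dropped. *)
Lemma wsumD_le a b N : wsum (fun n => a n + b n) (fun n => a n + b n) N <=
  2 * wsum a a N + 2 * wsum b b N.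
Proof.
have := wsum_ge0 (fun n => a n + (-1)%:C * b n) N.
by rewrite !(wsumDl, wsumDr, wsumZl, wsumZr) (wsumC b a); lra.
Qed.

Lemma wl2D a b : wl2 a -> wl2 b -> wl2 (fun n => a n + b n).
Proof.
move=> [M aM] [L bL]; exists (2 * M + 2 * L) => N.
by apply: le_trans (wsumD_le _ _ _) _; apply: lerD; rewrite ler_wpM2l.
Qed.

Lemma wl2Z (c : C) a : wl2 a -> wl2 (fun n => c * a n).
Proof.
move=> [M aM]; exists (normc c ^+ 2 * M) => N.
by rewrite wsum_scale ler_wpM2l ?sqr_ge0.
Qed.

Lemma wl2B a b : wl2 a -> wl2 b -> wl2 (fun n => a n - b n).
Proof.
move=> wa /(wl2Z (-1)) wb; under eq_fun do rewrite -mulN1r.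
exact: wl2D.
Qed.

Lemma polarization u v N : wsum u v N =
  4^-1 * (wsum (fun n => u n + v n) (fun n => u n + v n) N -
          wsum (fun n => u n - v n) (fun n => u n - v n) N).
Proof.
rewrite /wsum -sumrB mulr_sumr; apply: eq_bigr => n _.
rewrite !Re_mulcJ !normc2E !ReD !ImD !ReN !ImN ReM ReJ ImJ.
have n0 : n.+1%:R != 0 :> R by rewrite pnatr_eq0.
move: (n.+1%:R) n0 => x x0; by field.
Qed.

Lemma ip_unique u v l : wsum u v n @[n --> \oo] --> l -> ip u v = l.
Proof. by move=> /cvg_lim; apply. Qed.

Lemma wsum_polarization_cvg u v : wl2 u -> wl2 v ->
  wsum u v n @[n --> \oo] -->
  4^-1 * (ip (fun n => u n + v n) (fun n => u n + v n) -
          ip (fun n => u n - v n) (fun n => u n - v n)).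
Proof.
move=> wu wv; under eq_fun do rewrite polarization.
by apply: cvgMl_tmp; apply: cvgB; apply: wl2_cvg; [exact: wl2D | exact: wl2B].
Qed.

Lemma ip_polarization u v : wl2 u -> wl2 v -> ip u v =
  4^-1 * (ip (fun n => u n + v n) (fun n => u n + v n) -
          ip (fun n => u n - v n) (fun n => u n - v n)).
Proof. by move=> wu wv; apply/ip_unique/wsum_polarization_cvg. Qed.

Lemma ip_cvg u v : wl2 u -> wl2 v -> wsum u v n @[n --> \oo] --> ip u v.
Proof.
by move=> wu wv; rewrite ip_polarization//; exact: wsum_polarization_cvg.
Qed.

Lemma ipC u v : ip u v = ip v u.
Proof. by congr (limn _); apply/funext => n; exact: wsumC. Qed.

Lemma ipDl a b v : wl2 a -> wl2 b -> wl2 v ->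
  ip (fun n => a n + b n) v = ip a v + ip b v.
Proof.
move=> wa wb wv; apply: ip_unique; under eq_fun do rewrite wsumDl.
by apply: cvgD; exact: ip_cvg.
Qed.

Lemma ipZl (x : R) a v : wl2 a -> wl2 v ->
  ip (fun n => x%:C * a n) v = x * ip a v.
Proof.
move=> wa wv; apply: ip_unique; under eq_fun do rewrite wsumZl.
by apply: cvgMl_tmp; exact: ip_cvg.
Qed.

Lemma ip_adj (c : C) u v : ip (fun n => c * u n) v = ip u (fun n => conjc c * v n).
Proof. by congr (limn _); apply/funext => n; exact: wsumM_adj. Qed.

Lemma ip_scale (c : C) a : wl2 a ->
  ip (fun n => c * a n) (fun n => c * a n) = normc c ^+ 2 * ip a a.
Proof.
move=> wa; apply: ip_unique; under eq_fun do rewrite wsum_scale.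
by apply: cvgMl_tmp; exact: wl2_cvg.
Qed.

Lemma ip_sqD a b : wl2 a -> wl2 b ->
  ip (fun n => a n + b n) (fun n => a n + b n) = ip a a + 2 * ip a b + ip b b.
Proof.
move=> wa wb; have wab := wl2D wa wb.
by rewrite ipDl// ![ip _ (fun n => a n + b n)]ipC !ipDl// (ipC b a); ring.
Qed.

Lemma ip_young (t : R) u v : wl2 u -> wl2 v -> 0 < t ->
  2 * ip u v <= t * ip u u + t^-1 * ip v v.
Proof.
move=> wu wv t0; have wz := wl2Z (- t)%:C wu.
have := ip_ge0 (wl2D wz wv); rewrite ip_sqD// ip_scale// normc_real ipZl//.
rewrite normrN real_normK ?num_real// => H.
have ti : t * t^-1 = 1 by rewrite divff// gt_eqF.
rewrite -(ler_pM2l t0) [leRHS]mulrDr !mulrA ti mul1r -expr2; lra.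
Qed.

Lemma ip_sqD_le (t : R) a b : wl2 a -> wl2 b -> 0 < t ->
  ip (fun n => a n + b n) (fun n => a n + b n) <=
  (1 + t) * ip a a + (1 + t^-1) * ip b b.
Proof.
move=> wa wb t0; rewrite ip_sqD//; have := ip_young wa wb t0.
by rewrite !mulrDl !mul1r; lra.
Qed.

Lemma wl2_coef_bounded a : wl2 a -> coef_bounded a.
Proof.
move=> wa s /andP[s0 s1]; pose B := ip a a / (1 - s).
have s1' : 0 < 1 - s by rewrite subr_gt0.
exists (B + 1) => n; set x := normc (a n) * s ^+ n.
have x0 : 0 <= x by rewrite mulr_ge0 ?normc_ge0// exprn_ge0 ?ltW.
have ns : n.+1%:R * s ^+ n * (1 - s) <= 1.
  have := subrX1 s n.+1 => E.
  have ge : n.+1%:R * s ^+ n <= \sum_(i < n.+1) s ^+ i.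
    rewrite mulr_natl -[X in _ *+ X]card_ord -sumr_const ler_sum// => i _.
    by apply: ler_wiXn2l; rewrite ?ltW// -ltnS.
  apply: le_trans (ler_wpM2r (ltW s1') ge) _.
  have -> : (\sum_(i < n.+1) s ^+ i) * (1 - s) = 1 - s ^+ n.+1.
    by rewrite -opprB -[1 - _ ^+ _]opprB E; ring.
  by rewrite gerBl exprn_ge0// ltW.
have xB : x ^+ 2 <= B.
  rewrite ler_pdivlMr// /x exprMn -mulrA.
  apply: le_trans (ler_wpM2r _ (normc_le_ip n wa)) _.
    by rewrite mulr_ge0 ?sqr_ge0// ltW.
  rewrite mulrAC -[leRHS]mul1r ler_wpM2r ?ip_ge0//.
  apply: le_trans ns; rewrite mulrA ler_wpM2r ?(ltW s1')// ler_wpM2l//.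
  by rewrite expr2 ler_piMr ?exprn_ge0 ?exprn_ile1// ltW.
have := sqr_ge0 (x - 1); rewrite sqrrB1 => H; have := sqr_ge0 x; lra.
Qed.

End WeightedSequences.

Section Parseval.
Context {R : realType}.
Local Notation C := R[i].
Local Notation plane := (measurableTypeR R * measurableTypeR R)%type.
Implicit Types (a : nat -> C) (f : C -> C).

Lemma disk_area_gt0 : 0 < disk_area (1 : R).
Proof.
have fin : dA (disk_of_radius (1 : R)) \is a fin_num.
  by rewrite ge0_fin_numE// dA_disk_lty.
rewrite -lte_fin /disk_area fineK//.
pose I : set (measurableTypeR R) := `[0, 2^-1]%classic.
have mI : measurable I by exact: measurable_itv.
have sub : I `*` I `<=` disk_of_radius 1.
  move=> -[x y]; rewrite /I /disk_of_radius /= !in_itv /= => -[/andP[x0 x1] /andP[y0 y1]].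
  by nra.
apply: (@lt_le_trans _ _ (dA (I `*` I))); last first.
  apply: le_measure => //; rewrite inE; first exact: measurableX.
  exact: measurable_disk_of_radius.
rewrite /dA /mscale /= [X in (_ < _ * X)%E](_ : _ = (lebesgue_measure I * lebesgue_measure I)%E).
  rewrite /I lebesgue_measure_itv /= lte_fin invr_gt0 ltr0n /= oppr0 adde0.
  by rewrite -!EFinM lte_fin !mulr_gt0// ?invr_gt0// pi_gt0.
exact: product_measure1E.
Qed.

Lemma disk_area_cvg : exists2 r : nat -> R, (forall k, 0 < r k < 1) &
  (r k @[k --> \oo] --> (1 : R)) /\
  (disk_area (r k) @[k --> \oo] --> disk_area 1).
Proof.
exists (fun k => 1 - k.+2%:R^-1).
  by move=> k; rewrite subr_gt0 invf_lt1// ltr1n /= gtrBl invr_gt0.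
have r1 : (1 - k.+2%:R^-1 : R) @[k --> \oo] --> (1 : R).
  rewrite -[X in _ --> X]subr0; apply: cvgB; first exact: cvg_cst.
  by have := @cvg_harmonic R; rewrite -cvg_shiftS.
split=> //; pose F (k : nat) := @disk_of_radius R (1 - k.+2%:R^-1).
have ndF : nondecreasing_seq F.
  apply/nondecreasing_seqP => k; rewrite subsetEset => p; rewrite /F /disk_of_radius /=.
  move=> /lt_le_trans; apply; rewrite lerXn2r ?nnegrE ?subr_ge0 ?invf_le1 ?ler1n//.
  by rewrite lerD2l lerN2 lef_pV2 ?posrE// ler_nat.
have UF : \bigcup_k F k = disk_of_radius 1.
  apply/seteqP; split=> p.
    move=> [k _]; rewrite /F /disk_of_radius /= => /lt_le_trans; apply.
    by rewrite lerXn2r ?nnegrE ?subr_ge0 ?invf_le1 ?ler1n// gerBl.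
  move=> /(disk_of_radiusE p ler01); have := @disk_of_radiusE _ _ p.
  move: (normc (cplx p)) => x pE p1.
  have /cvgrPdist_lt/(_ (1 - x)) := r1.
  rewrite subr_gt0 => /(_ p1)[k _ /(_ k (leqnn k))] /= Hk.
  exists k => //; apply/pE; first by rewrite subr_ge0 invf_le1 ?ler1n.
  have := le_lt_trans (ler_norm _) Hk.
  by rewrite opprB addrC subrK ltrBrDr addrC -ltrBrDr.
have mF k : measurable (F k) by exact: measurable_disk_of_radius.
have := @nondecreasing_cvg_mu _ _ _ (@dA R) F mF; rewrite UF.
move=> /(_ (measurable_disk_of_radius _) ndF) H.
by apply: fine_cvg; rewrite /disk_area fineK// ge0_fin_numE// dA_disk_lty.
Qed.

Lemma EFin_cvg (u : nat -> R) (l : R) :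
  u n @[n --> \oo] --> l -> (u n)%:E @[n --> \oo] --> l%:E.
Proof. by move=> ul; apply/fine_cvgP; split => //; exact: nearW. Qed.

Lemma cvg_ord_sum N (u : 'I_N -> nat -> R) (l : 'I_N -> R) :
  (forall i, u i n @[n --> \oo] --> l i) ->
  \sum_(i < N) u i n @[n --> \oo] --> \sum_(i < N) l i.
Proof. by move=> ul; apply: cvg_big => //; exact: add_continuous. Qed.

Lemma cvg_expn (u : nat -> R) (l : R) k :
  u n @[n --> \oo] --> l -> u n ^+ k @[n --> \oo] --> l ^+ k.
Proof.
move=> ul; elim: k => [|k IH]; first exact: cvg_cst.
by under eq_fun do rewrite exprS; rewrite exprS; exact: cvgM.
Qed.

Lemma normc2_cvg (u : nat -> C) (l : C) : ccvg u l ->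
  normc (u n) ^+ 2 @[n --> \oo] --> normc l ^+ 2.
Proof.
move=> ul; have nl : normc (u n) @[n --> \oo] --> normc l.
  apply/cvgrPdist_lt => e /ul[N NP]; exists N => // n /NP; apply: le_lt_trans.
  rewrite ler_norml; have := le_normc_sub (u n) l; have := le_normc_sub l (u n).
  by rewrite [normc (l - _)]normcB; lra.
by apply: cvgM.
Qed.

Lemma wsum_lower_bound a (r : R) f N : 0 < r < 1 -> coef_bounded a ->
  measurable_cfun (@disk2 R) f -> (forall z, normc z < 1 -> f z = powser a z) ->
  ((disk_area r * \sum_(k < N) normc (a k) ^+ 2 * r ^+ k.*2 / k.+1%:R)%:E <=
  \int[dA]_(p in @disk2 R) (normc (f (cplx p)) ^+ 2)%:E)%E.
Proof.
move=> /andP[r0 r1] ba mf fa.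
have mD := measurable_disk_of_radius r.
have sub : disk_of_radius r `<=` disk2.
  move=> p /(disk_of_radiusE p (ltW r0)) pr; apply/unit_diskE.
  exact: lt_trans pr r1.
have mfr : measurable_cfun (disk_of_radius r) f.
  by case: mf => m1 m2; split; exact: measurable_funS (measurable_disk2) sub _.
have mf2 := measurable_normc2 mfr.
apply: (@le_trans _ _ (\int[dA]_(p in disk_of_radius r) (normc (f (cplx p)) ^+ 2)%:E)%E); last first.
  apply: ge0_subset_integral => //; first exact: measurable_disk2.
    by apply/measurable_EFinP; exact: measurable_normc2.
  by move=> p _; rewrite lee_fin sqr_ge0.
have r01 : 0 <= r < 1 by rewrite ltW.
have [M [q [M0 /andP[q0 q1] MP]]] := coef_geometric ba r01.
have sB n p : disk_of_radius r p -> normc (power_sum a n (cplx p)) <= M / (1 - q).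
  move=> /(disk_of_radiusE p (ltW r0))/ltW pr.
  have inc k : normc (power_sum a k.+1 (cplx p) - power_sum a k (cplx p)) <= M * q ^+ k.
    rewrite power_sumS addrAC subrr add0r normcM normcX; apply: le_trans (MP k).
    by rewrite ler_wpM2l ?normc_ge0// lerXn2r ?nnegrE ?normc_ge0// ltW.
  have q01 : 0 <= q < 1 by rewrite q0.
  have := geometric_increments_le q01 inc 0 n.
  rewrite add0n [power_sum a 0 _]/power_sum big_ord0 subr0 => H; apply: le_trans H _.
  by rewrite ler_piMr ?divr_ge0 ?subr_ge0 ?(ltW q1)// expr0 gerBl exprn_ge0.
pose F n (p : plane) := (normc (power_sum a n (cplx p)) ^+ 2)%:E.
have mF n : measurable_fun (disk_of_radius r) (F n).
  by apply/measurable_EFinP; exact: (measurable_normc2 (measurable_power_sum _ a n)).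
have mf2E : measurable_fun (disk_of_radius r) (fun p => (normc (f (cplx p)) ^+ 2)%:E).
  exact/measurable_EFinP.
have cF : {ae dA, forall p, disk_of_radius r p ->
    F n p @[n --> \oo] --> (normc (f (cplx p)) ^+ 2)%:E}.
  apply: aeW => p /(disk_of_radiusE p (ltW r0)) pr; apply/fine_cvgP; split.
    exact: nearW.
  have p1 := lt_trans pr r1; rewrite fa//; apply: normc2_cvg; exact: powser_cvg.
have iM : dA.-integrable (disk_of_radius r) (cst ((M / (1 - q)) ^+ 2)%:E).
  apply: (@integrable_disk _ _ ((M / (1 - q)) ^+ 2) (cst ((M / (1 - q)) ^+ 2))).
    exact: measurable_cst.
  by move=> p _; rewrite ger0_norm ?sqr_ge0.
have FM : {ae dA, forall p n, disk_of_radius r p ->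
    (`|F n p| <= cst ((M / (1 - q)) ^+ 2)%:E p)%E}.
  apply: aeW => p n pr; rewrite /F /= lee_fin ger0_norm ?sqr_ge0//.
  rewrite lerXn2r ?nnegrE ?normc_ge0 ?divr_ge0 ?subr_ge0 ?(ltW q1)//.
  exact: sB.
have [_ _ H] := dominated_convergence mD mF mf2E cF iM FM.
rewrite -(cvg_lim _ H)//; apply: lime_ge; first exact: cvgP H.
near=> n; rewrite /= integral_power_sum// lee_fin ler_wpM2l ?disk_area_ge0//.
have Nn : (N <= n)%N by near: n; exists N.
pose t k := normc (a k) ^+ 2 * r ^+ k.*2 / k.+1%:R.
rewrite -!(big_mkord xpredT t) [leRHS](@big_cat_nat _ _ _ N)//= lerDl.
apply: sumr_ge0 => k _; rewrite divr_ge0// mulr_ge0 ?sqr_ge0// exprn_ge0//.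
exact: ltW.
Unshelve. all: by end_near. Qed.

Lemma disk_area_wsum_le a f N : coef_bounded a ->
  measurable_cfun (@disk2 R) f -> (forall z, normc z < 1 -> f z = powser a z) ->
  ((disk_area 1 * wsum a a N)%:E <=
  \int[dA]_(p in @disk2 R) (normc (f (cplx p)) ^+ 2)%:E)%E.
Proof.
move=> ba mf fa; have [r r01 [r1 ar]] := disk_area_cvg.
have lb k := wsum_lower_bound N (r01 k) ba mf fa.
have cv : disk_area (r k) * (\sum_(j < N) normc (a j) ^+ 2 * r k ^+ j.*2 / j.+1%:R)
    @[k --> \oo] --> disk_area 1 * wsum a a N.
  apply: cvgM => //; rewrite wsum_sqE; apply: cvg_ord_sum => j.
  apply: cvgMr_tmp; rewrite -[X in _ --> X]mulr1 -(expr1n R j.*2).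
  apply: cvgMl_tmp.
  exact: cvg_expn.
rewrite -(cvg_lim _ (EFin_cvg cv))//; apply: lime_le; first exact: cvgP (EFin_cvg cv).
by apply: nearW => k; exact: lb.
Qed.

Lemma disk_area_ip_ge a f : wl2 a ->
  measurable_cfun (@disk2 R) f -> (forall z, normc z < 1 -> f z = powser a z) ->
  (\int[dA]_(p in @disk2 R) (normc (f (cplx p)) ^+ 2)%:E <=
   (disk_area 1 * ip a a)%:E)%E.
Proof.
move=> wa mf fa; have ba := wl2_coef_bounded wa.
pose F n (p : plane) := (normc (power_sum a n (cplx p)) ^+ 2)%:E.
have mF n : measurable_fun (@disk2 R) (F n).
  by apply/measurable_EFinP; exact: (measurable_normc2 (measurable_power_sum _ a n)).
have F0 n p : disk2 p -> (0 <= F n p)%E by rewrite lee_fin sqr_ge0.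
have -> : (\int[dA]_(p in @disk2 R) (normc (f (cplx p)) ^+ 2)%:E =
    \int[dA]_(p in @disk2 R) limn_einf (F ^~ p))%E.
  apply: eq_integral => p /set_mem/unit_diskE p1.
  have [einfE _] := cvg_limn_einf_sup (EFin_cvg (normc2_cvg (powser_cvg ba p1))).
  by rewrite fa//; exact: esym einfE.
apply: le_trans (fatou _ measurable_disk2 mF F0) _.
have IE n : (\int[dA]_(p in @disk2 R) F n p = (disk_area 1 * wsum a a n)%:E)%E.
  rewrite disk2E integral_power_sum// wsum_sqE; congr (_ * _)%:E.
  by apply: eq_bigr => k _; rewrite expr1n mulr1.
have -> : (fun n => \int[dA]_(p in @disk2 R) F n p)%E = (fun n => (disk_area 1 * wsum a a n)%:E).
  exact/funext.
have cv : disk_area 1 * wsum a a n @[n --> \oo] --> disk_area 1 * ip a a.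
  by apply: cvgMl_tmp; exact: wl2_cvg.
by have [-> _] := cvg_limn_einf_sup (EFin_cvg cv).
Qed.

End Parseval.

Section ShiftOperators.
Context {R : realType}.
Local Notation C := R[i].
Implicit Types (a b x y : nat -> C).
Variable m : nat.

(* Coefficients of z^m f(z) and of the projection of conj(z)^m f(z). *)
Definition shift_up a n : C := if (m <= n)%N then a (n - m)%N else 0.
Definition shift_down a n : C := (n.+1%:R / (n + m).+1%:R)%:C * a (n + m)%N.

Lemma Re_realM (c : R) (z : C) : complex.Re (c%:C * z) = c * complex.Re z.
Proof. by rewrite ReM /= mul0r subr0. Qed.

Lemma wsum_shift_up a b N :
  wsum a (shift_up b) (N + m) = wsum (shift_down a) b N.
Proof.
rewrite /wsum -(big_mkord xpredT (fun n => complex.Re (a n * conjc (shift_up b n)) / n.+1%:R)).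
rewrite (@big_cat_nat _ _ _ m)//=; last exact: leq_addl.
rewrite big_nat_cond big1 ?add0r; last first.
  move=> n /andP[/andP[_ nm] _].
  have -> : shift_up b n = 0 by rewrite /shift_up leqNgt nm.
  by rewrite conjc0 mulr0 /= mul0r.
rewrite -{1}[m]add0n big_addn addnK big_mkord; apply: eq_bigr => n _.
rewrite /shift_up leq_addl addnK /shift_down -[in RHS]mulrA Re_realM.
rewrite [RHS]mulrAC [X in _ = X * _]mulrAC divff ?pnatr_eq0// mul1r.
by rewrite mulrC.
Qed.

Lemma wsum_shift_upE a N : wsum (shift_up a) (shift_up a) (N + m) =
  \sum_(n < N) normc (a n) ^+ 2 / (n + m).+1%:R.
Proof.
rewrite wsum_shift_up; apply: eq_bigr => n _.
rewrite /shift_down /shift_up leq_addl addnK -mulrA Re_realM Re_mulcJ.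
rewrite [LHS]mulrAC [X in X * _ = _]mulrAC divff ?pnatr_eq0// mul1r.
by rewrite mulrC.
Qed.

Lemma wsum_shift_up_le a N : wsum (shift_up a) (shift_up a) N <= wsum a a N.
Proof.
apply: le_trans (wsum_nd (shift_up a) (leq_addr m N)) _.
rewrite wsum_shift_upE wsum_sqE; apply: ler_sum => n _.
by rewrite ler_wpM2l ?sqr_ge0// lef_pV2 ?posrE// ler_nat ltnS leq_addr.
Qed.

Lemma wsum_shift_down_le a N :
  wsum (shift_down a) (shift_down a) N <= wsum a a (N + m).
Proof.
rewrite [leRHS]wsum_sqE -(big_mkord xpredT (fun n => normc (a n) ^+ 2 / n.+1%:R)).
rewrite (@big_cat_nat _ _ _ m)//=; last exact: leq_addl.
rewrite -[leLHS]add0r lerD//; first by apply: sumr_ge0 => n _; rewrite divr_ge0 ?sqr_ge0.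
rewrite -{1}[m]add0n big_addn addnK big_mkord wsum_sqE; apply: ler_sum => n _.
rewrite /shift_down normcM exprMn normc_real ger0_norm ?divr_ge0//.
have : n.+1%:R <= (n + m).+1%:R :> R by rewrite ler_nat ltnS leq_addr.
have x0 : 0 < n.+1%:R :> R by [].
have y0 : 0 < (n + m).+1%:R :> R by [].
move: (n.+1%:R) ((n + m).+1%:R) x0 y0 => x y x0 y0 xy.
set A := normc _ ^+ 2; have A0 : 0 <= A by exact: sqr_ge0.
have -> : (x / y) ^+ 2 * A / x = A / y * (x / y) by field; rewrite !gt_eqF.
rewrite ler_piMr ?divr_ge0 ?(ltW y0)//.
by rewrite ler_pdivrMr// mul1r.
Qed.

Lemma wl2_shift_up a : wl2 a -> wl2 (shift_up a).
Proof. by move=> [M aM]; exists M => N; exact: le_trans (wsum_shift_up_le _ _) (aM _). Qed.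

Lemma wl2_shift_down a : wl2 a -> wl2 (shift_down a).
Proof. by move=> [M aM]; exists M => N; exact: le_trans (wsum_shift_down_le _ _) (aM _). Qed.

Lemma ip_shift_up_le a : wl2 a -> ip (shift_up a) (shift_up a) <= ip a a.
Proof.
by move=> wa; apply: ip_le => N; exact: le_trans (wsum_shift_up_le _ _) (wsum_le_ip _ _).
Qed.

Lemma ip_shift_down_le a : wl2 a -> ip (shift_down a) (shift_down a) <= ip a a.
Proof.
by move=> wa; apply: ip_le => N; exact: le_trans (wsum_shift_down_le _ _) (wsum_le_ip _ _).
Qed.

Lemma ip_shift a b : wl2 a -> wl2 b -> ip (shift_down a) b = ip a (shift_up b).
Proof.
move=> wa wb; apply: ip_unique; under eq_fun do rewrite -wsum_shift_up.
by have := ip_cvg wa (wl2_shift_up wb); rewrite -(cvg_shiftn m).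
Qed.

Lemma shift_upZ (c : C) a : shift_up (fun n => c * a n) = (fun n => c * shift_up a n).
Proof. by apply/funext => n; rewrite /shift_up; case: ifP; rewrite ?mulr0. Qed.

Lemma shift_upD a b : shift_up (fun n => a n + b n) =
  (fun n => shift_up a n + shift_up b n).
Proof. by apply/funext => n; rewrite /shift_up; case: ifP; rewrite ?addr0. Qed.

Lemma shift_downZ (c : C) a : shift_down (fun n => c * a n) = (fun n => c * shift_down a n).
Proof. by apply/funext => n; rewrite /shift_down mulrCA. Qed.

Lemma shift_downD a b : shift_down (fun n => a n + b n) =
  (fun n => shift_down a n + shift_down b n).
Proof. by apply/funext => n; rewrite /shift_down mulrDr. Qed.

(* [seq_toeplitz al k] is T_phi - k for phi = conj(z)^m + al z^m. *)
Definition seq_toeplitz (al k : C) a n : C :=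
  shift_down a n + al * shift_up a n - k * a n.

Lemma wl2_seq_toeplitz al k a : wl2 a -> wl2 (seq_toeplitz al k a).
Proof.
move=> wa; apply: wl2B; last exact: wl2Z.
by apply: wl2D; [exact: wl2_shift_down | exact/wl2Z/wl2_shift_up].
Qed.

Lemma seq_toeplitzZ al k (c : C) a :
  seq_toeplitz al k (fun n => c * a n) = (fun n => c * seq_toeplitz al k a n).
Proof.
by apply/funext => n; rewrite /seq_toeplitz shift_upZ shift_downZ; ring.
Qed.

Lemma seq_toeplitzD al k a b : seq_toeplitz al k (fun n => a n + b n) =
  (fun n => seq_toeplitz al k a n + seq_toeplitz al k b n).
Proof.
by apply/funext => n; rewrite /seq_toeplitz shift_upD shift_downD; ring.
Qed.

Lemma ip_seq_toeplitz_le al k a : wl2 a ->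
  ip (seq_toeplitz al k a) (seq_toeplitz al k a) <=
  (4 + 4 * normc al ^+ 2 + 2 * normc k ^+ 2) * ip a a.
Proof.
move=> wa; have wU := wl2_shift_up wa; have wB := wl2_shift_down wa.
have waU := wl2Z al wU; have wk := wl2Z (- k) wa.
have -> : seq_toeplitz al k a =
    (fun n => (shift_down a n + al * shift_up a n) + - k * a n).
  by apply/funext => n; rewrite /seq_toeplitz mulNr.
apply: le_trans (ip_sqD_le (wl2D wB waU) wk ltr01) _.
have := ip_sqD_le wB waU ltr01; rewrite !ip_scale// normcN invr1.
have := ip_shift_down_le wa; have := ip_shift_up_le wa => hU hB h1.
have h2 : normc al ^+ 2 * ip (shift_up a) (shift_up a) <= normc al ^+ 2 * ip a a.
  by rewrite ler_wpM2l ?sqr_ge0.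
lra.
Qed.

Lemma ccvg_seq_toeplitz al k (x_ : nat -> nat -> C) x :
  (forall n, ccvg (x_ ^~ n) (x n)) ->
  forall n, ccvg (fun j => seq_toeplitz al k (x_ j) n) (seq_toeplitz al k x n).
Proof.
move=> xx n; rewrite /seq_toeplitz; apply: ccvgD.
  apply: ccvgD; first by apply: ccvgMl.
  apply: ccvgMl; rewrite /shift_up; case: ifP => // _; exact: ccvg_cst.
rewrite -mulNr; apply: (@eq_ccvg _ (fun j => - k * x_ j n)).
  by move=> j; rewrite mulNr.
exact: ccvgMl.
Qed.

End ShiftOperators.

Section Neumann.
Context {R : realType}.
Local Notation C := R[i].
Implicit Types (x y a b : nat -> C).
Variables (X : (nat -> C) -> nat -> C) (q : R).
Hypothesis X_wl2 : forall a, wl2 a -> wl2 (X a).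
Hypothesis XB : forall a b, X (fun n => a n - b n) = (fun n => X a n - X b n).
Hypothesis X_cvg : forall (x_ : nat -> nat -> C) x,
  (forall n, ccvg (x_ ^~ n) (x n)) -> forall n, ccvg (fun j => X (x_ j) n) (X x n).
Hypothesis q01 : 0 <= q < 1.
Hypothesis X_le : forall a, wl2 a -> ip (X a) (X a) <= q * ip a a.

Fixpoint neumann_iter y j : nat -> C :=
  if j is j'.+1 then (fun n => y n + X (neumann_iter y j') n) else (fun=> 0).

Lemma wl2_0 : wl2 (fun=> 0 : C).
Proof.
by exists 0 => N; rewrite wsum_sqE big1// => n _; rewrite normc0 expr0n mul0r.
Qed.

Lemma wl2_neumann_iter y j : wl2 y -> wl2 (neumann_iter y j).
Proof. by move=> wy; elim: j => [|j IH]; [exact: wl2_0 | apply: wl2D => //; exact: X_wl2]. Qed.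


Lemma neumann_increment_le y : wl2 y -> forall j,
  ip (fun n => neumann_iter y j.+1 n - neumann_iter y j n)
     (fun n => neumann_iter y j.+1 n - neumann_iter y j n) <=
  q ^+ j * ip (neumann_iter y 1) (neumann_iter y 1).
Proof.
move=> wy; elim=> [|j IH].
  have -> : (fun n => neumann_iter y 1 n - neumann_iter y 0 n) = neumann_iter y 1.
    by apply/funext => n; exact: subr0.
  by rewrite expr0 mul1r.
have /andP[q0 _] := q01.
set d := (fun n => neumann_iter y j.+1 n - neumann_iter y j n) in IH.
have -> : (fun n => neumann_iter y j.+2 n - neumann_iter y j.+1 n) = X d.
  by rewrite XB; apply/funext => n /=; rewrite opprD addrACA subrr add0r.
have wd : wl2 d by apply: wl2B; exact: wl2_neumann_iter.
by apply: le_trans (X_le wd) _; rewrite exprS -mulrA ler_wpM2l.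
Qed.

Lemma neumann_solution : exists K, forall y, wl2 y ->
  exists x, [/\ wl2 x, (fun n => x n - X x n) = y & ip x x <= K * ip y y].
Proof.
have /andP[q0 q1] := q01; pose t := 1 - q.
have t0 : 0 < t by rewrite subr_gt0.
pose K := (1 + t^-1) / t ^+ 2; exists K => y wy.
have K0 : 0 <= K by apply: divr_ge0; [apply: addr_ge0; rewrite ?invr_ge0 ?(ltW t0) | apply: exprn_ge0; exact: ltW].
pose x_ := neumann_iter y; have wx_ j : wl2 (x_ j) := wl2_neumann_iter j wy.
have x_K j : ip (x_ j) (x_ j) <= K * ip y y.
  elim: j => [|j IH].
    apply: ip_le => N; rewrite wsum_sqE big1 ?(mulr_ge0 K0 (ip_ge0 wy))// => n _.
    by rewrite normc0 expr0n mul0r.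
  have -> : x_ j.+1 = (fun n => X (x_ j) n + y n).
    by apply/funext => n; rewrite addrC.
  apply: le_trans (ip_sqD_le (X_wl2 (wx_ j)) wy t0) _.
  have H : (1 + t) * ip (X (x_ j)) (X (x_ j)) <= (1 + t) * (q * (K * ip y y)).
    apply: ler_wpM2l; first by rewrite addr_ge0// ltW.
    by apply: le_trans (X_le (wx_ j)) _; rewrite ler_wpM2l.
  apply: (@le_trans _ _ ((1 + t) * (q * (K * ip y y)) + (1 + t^-1) * ip y y)).
    by rewrite lerD2r.
  rewrite le_eqVlt; apply/orP; left; apply/eqP.
  have -> : q = 1 - t by rewrite /t; ring.
  by rewrite /K; field; rewrite gt_eqF.
pose s := Num.sqrt q.
have s01 : 0 <= s < 1 by rewrite sqrtr_ge0 -[ltRHS]sqrtr1 ltr_sqrt.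
pose I1 := ip (neumann_iter y 1) (neumann_iter y 1).
have I10 : 0 <= I1 by apply: ip_ge0; exact: wl2_neumann_iter.
have inc n j : normc (x_ j.+1 n - x_ j n) <= Num.sqrt (n.+1%:R * I1) * s ^+ j.
  have wd : wl2 (fun n => x_ j.+1 n - x_ j n) by apply: wl2B.
  have := normc_le_ip n wd => /= H.
  rewrite -(@ler_pXn2r _ 2%N)// ?nnegrE ?normc_ge0 ?mulr_ge0 ?exprn_ge0 ?sqrtr_ge0//.
  apply: le_trans H _; rewrite exprMn sqr_sqrtr ?mulr_ge0//.
  rewrite -exprM mulnC exprM sqr_sqrtr// -mulrA ler_wpM2l// mulrC.
  exact: neumann_increment_le.
pose x n := clim (x_ ^~ n).
have xx n : ccvg (x_ ^~ n) (x n).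
  exact: (proj1 (clim_geometric s01 (inc n))).
have xN N : wsum x x N <= K * ip y y.
  rewrite wsum_sqE.
  have cv : \sum_(n < N) normc (x_ j n) ^+ 2 / n.+1%:R @[j --> \oo] -->
      \sum_(n < N) normc (x n) ^+ 2 / n.+1%:R.
    by apply: cvg_ord_sum => n; apply: cvgMr_tmp; exact: normc2_cvg.
  rewrite -(cvg_lim _ cv)//; apply: limr_le; first exact: cvgP cv.
  apply: nearW => j; rewrite -wsum_sqE; apply: le_trans (x_K j).
  exact: wsum_le_ip.
exists x; split; [by exists (K * ip y y) | | exact: ip_le].
apply/funext => n; apply/eqP; rewrite subr_eq; apply/eqP.
apply: (ccvg_unique (ccvg_shift 1 (xx n))).
apply: (@eq_ccvg _ (fun j => y n + X (x_ j) n)).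
  by move=> j; rewrite addn1.
by apply: ccvgD; [exact: ccvg_cst | exact: X_cvg].
Qed.

End Neumann.

Section Resolvent.
Context {R : realType}.
Local Notation C := R[i].
Implicit Types (a x y : nat -> C).
Variable m : nat.

Lemma ip_scalar (c : C) a : wl2 a -> ip (fun n => c * a n) a = complex.Re c * ip a a.
Proof.
move=> wa; apply: ip_unique.
rewrite (_ : (fun N => _) = (fun N => complex.Re c * wsum a a N)); last first.
  apply/funext => N; rewrite wsum_sqE /wsum mulr_sumr; apply: eq_bigr => n _.
  by rewrite -mulrA mulcJ [c * _]mulrC Re_realM mulrA [_ * complex.Re c]mulrC.
by apply: cvgMl_tmp; exact: wl2_cvg.
Qed.

Lemma ip_shift_up_ge (c : C) a : wl2 a ->
  - normc c * ip a a <= ip (fun n => c * shift_up m a n) a.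
Proof.
move=> wa; have wU := wl2_shift_up m wa; have wcU := wl2Z c wU.
have [->|c0] := eqVneq c 0.
  rewrite normc0 oppr0 mul0r (_ : (fun n => _) = (fun n => (0 : R)%:C * a n)).
    by rewrite ipZl// mul0r.
  by apply/funext => n; rewrite !mul0r.
have nc0 : 0 < normc c by rewrite normc_gt0.
have wz := wl2Z (-1 : R)%:C wcU.
have := ip_young wz wa (_ : 0 < (normc c)^-1); rewrite invr_gt0 => /(_ nc0).
rewrite ipZl// invrK ip_scale// ip_scale// normc_real normrN1 expr1n mul1r.
have := ip_shift_up_le m wa; set u := ip (shift_up m a) _ => h.
have -> : (normc c)^-1 * (normc c ^+ 2 * u) = normc c * u.
  by rewrite expr2; field; rewrite gt_eqF.
have : normc c * u <= normc c * ip a a by rewrite ler_wpM2l// ltW.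
lra.
Qed.

(* The numerical range of conj(z)^m + al z^m lies in the half plane
   Re (conj d * _) <= |d + al conj d|. *)
Lemma seq_toeplitz_coercive (al k d : C) (eta : R) a : wl2 a ->
  normc (d + al * conjc d) + eta <= complex.Re (conjc d * k) ->
  eta * ip a a <= ip (fun n => - conjc d * seq_toeplitz m al k a n) a.
Proof.
move=> wa dk; have wU := wl2_shift_up m wa; have wB := wl2_shift_down m wa.
have wdB := wl2Z (- conjc d) wB; have wda := wl2Z (conjc d * k) wa.
have wdU := wl2Z (- (conjc d * al)) wU.
have -> : (fun n => - conjc d * seq_toeplitz m al k a n) = (fun n =>
    (- conjc d * shift_down m a n + - (conjc d * al) * shift_up m a n) +
    conjc d * k * a n).
  by apply/funext => n; rewrite /seq_toeplitz; ring.
rewrite ipDl ?ipDl//; last exact: wl2D.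
have -> : ip (fun n => - conjc d * shift_down m a n) a =
    ip (fun n => - d * shift_up m a n) a.
  rewrite ip_adj ip_shift//; last exact: wl2Z.
  by rewrite shift_upZ rmorphN /= conjcK ipC.
rewrite -ipDl//; last exact: wl2Z.
have -> : (fun n => - d * shift_up m a n + - (conjc d * al) * shift_up m a n) =
    (fun n => - (d + al * conjc d) * shift_up m a n).
  by apply/funext => n; ring.
rewrite ip_scalar//; have := ip_shift_up_ge (- (d + al * conjc d)) wa.
rewrite normcN; have := ip_ge0 wa; set s := ip a a => s0 h.
have : (normc (d + al * conjc d) + eta) * s <= complex.Re (conjc d * k) * s.
  by rewrite ler_wpM2r.
lra.
Qed.

Lemma seq_toeplitz_invertible (al k d : C) (eta : R) : 0 < eta ->
  normc (d + al * conjc d) + eta <= complex.Re (conjc d * k) ->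
  (forall a, wl2 a -> seq_toeplitz m al k a = (fun=> 0) -> a = (fun=> 0)) /\
  exists K, forall y, wl2 y ->
    exists x, [/\ wl2 x, seq_toeplitz m al k x = y & ip x x <= K * ip y y].
Proof.
move=> eta0 dk; have co a wa := @seq_toeplitz_coercive al k d eta a wa dk.
split=> [a wa Ta|].
  apply: ip_eq0 => //; have := co _ wa; rewrite Ta.
  have -> : (fun n : nat => - conjc d * 0) = (fun n => (0 : R)%:C * a n).
    by apply/funext => n; rewrite mulr0 mul0r.
  rewrite ipZl// mul0r pmulr_rle0// => h.
  by apply/eqP; rewrite eq_le h ip_ge0.
have d0 : d != 0.
  apply/eqP => dE; move: dk; rewrite dE conjc0 mulr0 addr0 mul0r normc0 /=; lra.
pose L := 4 + 4 * normc al ^+ 2 + 2 * normc k ^+ 2.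
have L0 : 0 <= L.
  by rewrite /L; have := sqr_ge0 (normc al); have := sqr_ge0 (normc k); lra.
pose D := normc d ^+ 2 * L + eta ^+ 2 + 1.
have dL0 : 0 <= normc d ^+ 2 * L by rewrite mulr_ge0 ?sqr_ge0.
have D0 : 0 < D by rewrite /D; have := sqr_ge0 eta; lra.
pose e := eta / D; have e0 : 0 < e by rewrite divr_gt0.
pose c : C := e%:C * conjc d.
have nc : normc c = e * normc d by rewrite normcM normc_real gtr0_norm// normcJ_eq.
have c0 : c != 0 by rewrite -normc_gt0 nc mulr_gt0// normc_gt0.
pose X a n := a n + c * seq_toeplitz m al k a n.
pose q := 1 - e * eta.
have eD : e * D = eta by rewrite /e divfK// gt_eqF.
have q01 : 0 <= q < 1.
  rewrite /q subr_ge0 gtrBl mulr_gt0// andbT /e mulrAC ler_pdivrMr// mul1r -expr2 /D.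
  lra.
have TB a b : seq_toeplitz m al k (fun n => a n - b n) =
    (fun n => seq_toeplitz m al k a n - seq_toeplitz m al k b n).
  have -> : (fun n => a n - b n) = (fun n => a n + -1 * b n).
    by apply/funext => n; rewrite mulN1r.
  by rewrite seq_toeplitzD seq_toeplitzZ; apply/funext => n; rewrite mulN1r.
have [K KP] : exists K, forall y, wl2 y ->
    exists x, [/\ wl2 x, (fun n => x n - X x n) = y & ip x x <= K * ip y y].
  apply: (@neumann_solution _ X q) => //.
  - by move=> a wa; apply: wl2D => //; exact/wl2Z/wl2_seq_toeplitz.
  - by move=> a b; apply/funext => n; rewrite /X TB; ring.
  - move=> x_ x xx n; apply: ccvgD; first exact: xx.
    by apply: ccvgMl; exact: ccvg_seq_toeplitz.
  - move=> a wa; have wT := wl2_seq_toeplitz m al k wa; have wcT := wl2Z c wT.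
    rewrite ip_sqD// ip_scale// nc.
    have -> : ip a (fun n => c * seq_toeplitz m al k a n) =
        - e * ip (fun n => - conjc d * seq_toeplitz m al k a n) a.
      have -> : (fun n => c * seq_toeplitz m al k a n) =
          (fun n => (- e)%:C * (- conjc d * seq_toeplitz m al k a n)).
        by apply/funext => n; rewrite /c rmorphN mulrA mulrNN.
      by rewrite ipC ipZl//; exact: wl2Z.
    have := co _ wa; have := ip_seq_toeplitz_le m al k wa; rewrite -/L.
    set T := ip (seq_toeplitz _ _ _ _) _.
    set S := ip (fun n => - conjc d * seq_toeplitz m al k a n) a; set s := ip a a.
    move=> hT hS; have s0 : 0 <= s by exact: ip_ge0.
    have h1 : e * (eta * s) <= e * S by rewrite ler_wpM2l// ltW.
    have h2 : (e * normc d) ^+ 2 * T <= (e * normc d) ^+ 2 * (L * s).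
      by rewrite ler_wpM2l// sqr_ge0.
    have h3 : e * (normc d ^+ 2 * L) <= eta.
      rewrite -[leRHS]eD; apply: ler_wpM2l; first exact: ltW.
      by rewrite /D; have := sqr_ge0 eta; lra.
    have h4 : e * s * (e * (normc d ^+ 2 * L)) <= e * s * eta.
      by apply: ler_wpM2l h3; rewrite mulr_ge0// ltW.
    have -> : q * s = s - e * (eta * s) by rewrite /q; ring.
    have E : (e * normc d) ^+ 2 * (L * s) = e * s * (e * (normc d ^+ 2 * L)) by ring.
    have E2 : e * s * eta = e * (eta * s) by ring.
    lra.
exists (K * normc c ^+ 2) => y wy; have [x [wx xE xK]] := KP _ (wl2Z (- c) wy).
exists x; split=> //.
  apply/funext => n; have := congr1 (fun f => f n) xE; rewrite /X /=.
  by rewrite opprD addrA subrr add0r -mulNr; apply: mulfI; rewrite oppr_eq0.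
by move: xK; rewrite ip_scale// normcN mulrA.
Qed.

End Resolvent.

Section Eigenvectors.
Context {R : realType}.
Local Notation C := R[i].

Lemma disk_root_lt1 (al w t : C) : normc al < 1 -> normc w < 1 ->
  t ^+ 2 - (conjc w + al * w) * t + al = 0 -> normc t < 1.
Proof.
move=> al1 w1 t0; rewrite ltNge; apply/negP => t1.
have E : (t - conjc w) * t = al * (w * t - 1).
  by apply/eqP; rewrite -subr_eq0 -t0; apply/eqP; ring.
have tw : 0 < normc (t - conjc w).
  by have := le_normc_sub t (conjc w); rewrite normcJ_eq; lra.
have le1 : normc (w * t - 1) <= normc (t - conjc w).
  rewrite -(@ler_pXn2r _ 2%N)// ?nnegrE ?normc_ge0// -subr_ge0.
  have -> : normc (t - conjc w) ^+ 2 - normc (w * t - 1) ^+ 2 =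
      (normc t ^+ 2 - 1) * (1 - normc w ^+ 2).
    case: (w) (t) => [a b] [c d]; rewrite !normc2E /=; ring.
  by rewrite mulr_ge0 ?subr_ge0 ?exprn_ege1 ?exprn_ile1 ?normc_ge0// ltW.
have := congr1 (@normc R) E; rewrite !normcM => En.
have : normc (t - conjc w) * normc t <= normc al * normc (t - conjc w).
  by rewrite En ler_wpM2l ?normc_ge0.
rewrite mulrC ler_pM2r// => h; have := le_lt_trans (le_trans t1 h) al1.
by rewrite ltxx.
Qed.

Lemma quadratic_roots (l al : C) : exists p q : C, [/\ p + q = l, p * q = al,
  p ^+ 2 - l * p + al = 0 & q ^+ 2 - l * q + al = 0].
Proof.
pose s := sqrtc (l ^+ 2 - 4%:R * al).
have s2 : s ^+ 2 = l ^+ 2 - 4%:R * al by exact: sqr_sqrtc.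
have n2 : 2%:R != 0 :> C by rewrite pnatr_eq0.
exists ((l + s) / 2%:R), ((l - s) / 2%:R).
have pq : (l + s) / 2%:R * ((l - s) / 2%:R) = al.
  have -> : (l + s) / 2%:R * ((l - s) / 2%:R) = (l ^+ 2 - s ^+ 2) / 4%:R by field.
  by rewrite s2; field.
by split; rewrite -?[in X in _ + X]pq //; field.
Qed.

Fixpoint eigen_pair (l al : C) k : C * C :=
  if k is k'.+1 then
    let: (u, v) := eigen_pair l al k' in
    (v, (k'.+2%:R / k'.+1%:R)%:C * (l * v - al * u))
  else (0, 1).

Definition eigen_seq l al k : C := (eigen_pair l al k).1.

Lemma eigen_seqSS l al k : eigen_seq l al k.+2 =
  (k.+2%:R / k.+1%:R)%:C * (l * eigen_seq l al k.+1 - al * eigen_seq l al k).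
Proof.
by rewrite /eigen_seq /=; case: (eigen_pair l al k) => u v.
Qed.

(* Lyapunov function [|c_(k+1)| + M |c_(k+1) - p c_k|] for the recurrence,
   whose limiting characteristic roots are [p] and [q]. *)
Lemma eigen_seq_decay l al : (exists p q : C, [/\ p + q = l, p * q = al,
    normc p < 1 & normc q < 1]) ->
  exists (K s : R) (k0 : nat), [/\ 0 <= s < 1 & forall j,
    normc (eigen_seq l al (k0 + j).+1) <= K * s ^+ j].
Proof.
move=> [p [q [pql pqal p1 q1]]]; set c := eigen_seq l al.
have rec k : c k.+2 = (k.+2%:R / k.+1%:R)%:C * (l * c k.+1 - al * c k).
  exact: eigen_seqSS.
clearbody c; have n0 := @normc_ge0 R.
pose r := Num.max (normc p) (normc q).
have r0 : 0 <= r by rewrite /r le_max n0.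
have pr : normc p <= r by rewrite /r le_max lexx.
have qr : normc q <= r by rewrite /r le_max lexx orbT.
have r1 : r < 1 by rewrite /r gt_max p1.
pose s := (1 + r) / 2.
have rs : r < s by rewrite /s; lra.
have s1 : s < 1 by rewrite /s; lra.
pose M := 2 / (s - r).
have sr0 : 0 < s - r by rewrite subr_gt0.
have M0 : 0 < M by rewrite divr_gt0.
have MsrE : M * (s - r) = 2 by rewrite divfK// gt_eqF.
pose d := (s - r) / (1 + M).
have d0 : 0 < d by rewrite divr_gt0// addr_gt0.
have dE : d * (1 + M) = s - r by rewrite divfK// gt_eqF// addr_gt0.
have [k0 k0P] : exists k0 : nat, forall k, (k0 <= k)%N -> k.+1%:R^-1 < d.
  have := @cvg_harmonic R => /cvgrPdist_lt/(_ d d0)[k0 _ kP].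
  exists k0 => k /kP; rewrite /= sub0r normrN; apply: le_lt_trans.
  exact: ler_norm.
pose y k := c k.+1 - p * c k.
pose N k := normc (c k.+1) + M * normc (y k).
have N0 k : 0 <= N k by rewrite /N addr_ge0 ?n0// mulr_ge0 ?n0// ltW.
have step k : (k0 <= k)%N -> N k.+1 <= s * N k.
  move=> /k0P; set e := k.+1%:R^-1 => ed.
  have e0 : 0 <= e by rewrite invr_ge0.
  pose f := 1 + e.
  have fE : k.+2%:R / k.+1%:R = f.
    by rewrite -[k.+2%:R]natr1 mulrDl divff ?mul1r// pnatr_eq0.
  have cE : c k.+2 = f%:C * (p * c k.+1 + q * y k).
    by rewrite rec fE -pql -pqal /y; ring.
  have yE : y k.+1 = f%:C * (q * y k) + e%:C * (p * c k.+1).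
    rewrite /y cE /f rmorphD /=; move: (e%:C) => e'; rewrite /y rmorph1; ring.
  have f0 : 0 <= f by rewrite addr_ge0.
  set C1 := normc (c k.+1); set Y := normc (y k).
  have C0 : 0 <= C1 by exact: n0.
  have Y0 : 0 <= Y by exact: n0.
  have hc : normc (c k.+2) <= f * (r * C1 + r * Y).
    rewrite cE normcM normc_real ger0_norm// ler_wpM2l//.
    apply: le_trans (le_normcD _ _) _; rewrite !normcM.
    by apply: lerD; rewrite ler_wpM2r.
  have hy : normc (y k.+1) <= f * (r * Y) + e * (r * C1).
    rewrite yE; apply: le_trans (le_normcD _ _) _.
    rewrite !normcM !normc_real !ger0_norm//.
    by apply: lerD; rewrite ler_wpM2l// ler_wpM2r.
  have hM : M * normc (y k.+1) <= M * (f * (r * Y) + e * (r * C1)).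
    by rewrite ler_wpM2l// ltW.
  have e1 : e * (1 + M) <= s - r by rewrite -dE ler_wpM2r ?addr_ge0// ltW.
  have re1 : r * (e * (1 + M)) <= s - r.
    by apply: le_trans e1; rewrite ler_piMl// ?mulr_ge0 ?addr_ge0// ltW.
  have k1 : (r * (e * (1 + M)) + r) * C1 <= s * C1 by rewrite ler_wpM2r//; lra.
  have k2 : (r * (e * (1 + M)) + r + r * M) * Y <= s * M * Y.
    rewrite ler_wpM2r//; have -> : s * M = r * M + M * (s - r) by ring.
    rewrite MsrE; lra.
  apply: (@le_trans _ _ ((r * (e * (1 + M)) + r) * C1 +
      (r * (e * (1 + M)) + r + r * M) * Y)); last first.
    have -> : s * N k = s * C1 + s * M * Y by rewrite /N -/C1 -/Y; ring.
    exact: lerD.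
  apply: le_trans (lerD hc hM) _; rewrite /f le_eqVlt; apply/orP; left.
  by apply/eqP; ring.
exists (N k0), s, k0; split=> [|j]; first by rewrite s1 andbT (le_trans r0)// ltW.
apply: (@le_trans _ _ (N (k0 + j)%N)); first by rewrite /N lerDl mulr_ge0 ?n0// ltW.
elim: j => [|j IH]; first by rewrite addn0 expr0 mulr1.
rewrite addnS; apply: le_trans (step _ (leq_addr _ _)) _.
by rewrite exprSr mulrA mulrC ler_wpM2r// (le_trans r0)// ltW.
Qed.

Lemma geometric_sum_bounded (g : nat -> R) (K s : R) k0 : 0 <= s < 1 ->
  (forall k, 0 <= g k) -> (forall j, g (k0 + j)%N <= K * s ^+ j) ->
  exists B, forall N, \sum_(k < N) g k <= B.
Proof.
move=> s01 g0 gK; have /andP[s0 s1] := s01.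
have K0 : 0 <= K by have := gK 0%N; rewrite expr0 mulr1; exact: le_trans.
exists (\sum_(0 <= k < k0) g k + K / (1 - s)) => N.
apply: (@le_trans _ _ (\sum_(0 <= k < k0 + N) g k)).
  rewrite -(big_mkord xpredT g) [leRHS](@big_cat_nat _ _ _ N)//= ?leq_addl//.
  by rewrite lerDl sumr_ge0.
rewrite (@big_cat_nat _ _ _ k0)//= ?leq_addr// lerD2l.
rewrite -{1}[k0]add0n big_addn addKn big_mkord.
apply: (@le_trans _ _ (\sum_(j < N) K * s ^+ j)).
  by apply: ler_sum => j _; rewrite addnC.
rewrite -mulr_sumr ler_wpM2l// -[leRHS]mul1r ler_pdivlMr ?subr_gt0//.
have -> : (\sum_(i < N) s ^+ i) * (1 - s) = 1 - s ^+ N.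
  by rewrite -opprB -[1 - _ ^+ _]opprB subrX1; ring.
by rewrite gerBl exprn_ge0.
Qed.

Definition spread (m : nat) (c : nat -> C) n : C :=
  if (m %| n.+1)%N then c (n.+1 %/ m)%N else 0.

Lemma spread_sum (m : nat) (c : nat -> C) N : (0 < m)%N ->
  \sum_(0 <= n < N * m) normc (spread m c n) ^+ 2 =
  \sum_(k < N) normc (c k.+1) ^+ 2.
Proof.
move=> m0; elim: N => [|N IH]; first by rewrite mul0n big_geq// big_ord0.
rewrite big_ord_recr /= -IH (@big_cat_nat _ _ _ (N * m)%N)//=; last first.
  by rewrite leq_mul2r leqnSn orbT.
congr (_ + _); rewrite -{1}[(N * m)%N]add0n big_addn mulSn addnK.
rewrite -(prednK m0) big_nat_recr//= (prednK m0) big_nat_cond big1 ?add0r.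
  rewrite /spread -addSn (prednK m0) -mulSn dvdn_mull//.
  by rewrite mulnK.
move=> i /andP[/andP[_ im] _]; rewrite /spread -addSn dvdn_addl ?dvdn_mull//.
rewrite ifF ?normc0 ?expr0n//; apply/negbTE/negP => /(dvdn_leq (ltn0Sn i)).
by lia.
Qed.

Lemma seq_toeplitz_eigenvector (m : nat) (al w : C) : (0 < m)%N ->
  normc al < 1 -> normc w < 1 ->
  exists a, [/\ wl2 a, a <> (fun=> 0) &
    seq_toeplitz m al (conjc w + al * w) a = (fun=> 0)].
Proof.
move=> m0 al1 w1; set l := conjc w + al * w.
pose c := eigen_seq l al; exists (spread m c); split.
- have [p [q [pq1 pq2 p0 q0]]] := quadratic_roots l al.
  have [K [s [k0 [s01 cK]]]] : exists (K s : R) (k0 : nat), [/\ 0 <= s < 1 & forall j,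
      normc (eigen_seq l al (k0 + j).+1) <= K * s ^+ j].
    apply: eigen_seq_decay; exists p, q.
    by split=> //; [exact: disk_root_lt1 al1 w1 p0 | exact: disk_root_lt1 al1 w1 q0].
  have /andP[s0 s1] := s01.
  have [|k|B BP] := @geometric_sum_bounded (fun k => normc (c k.+1) ^+ 2) (K ^+ 2) s k0 s01.
  + by move=> k; exact: sqr_ge0.
  + have K0 : 0 <= K * s ^+ k by exact: le_trans (normc_ge0 _) (cK k).
    apply: (@le_trans _ _ ((K * s ^+ k) ^+ 2)).
      by rewrite lerXn2r ?nnegrE ?normc_ge0.
    rewrite exprMn ler_wpM2l ?sqr_ge0// [leLHS]expr2.
    by rewrite ler_piMr ?exprn_ge0 ?exprn_ile1// ltW.
  exists B => N; rewrite wsum_sqE; apply: le_trans (BP N).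
  rewrite -(spread_sum c N m0).
  apply: (@le_trans _ _ (\sum_(0 <= n < N) normc (spread m c n) ^+ 2)).
    rewrite big_mkord; apply: ler_sum => n _.
    by rewrite ler_piMr ?sqr_ge0// invf_le1// ler1n.
  rewrite [leRHS](@big_cat_nat _ _ _ N)//= ?leq_pmulr// lerDl sumr_ge0// => n _.
  exact: sqr_ge0.
- move=> /(congr1 (fun f => f m.-1)); rewrite /spread (prednK m0) dvdnn divnn m0.
  by rewrite /c /eigen_seq /= => /eqP; rewrite oner_eq0.
- apply/funext => n; rewrite /seq_toeplitz /shift_down /shift_up /spread.
  have -> : (m %| (n + m).+1)%N = (m %| n.+1)%N by rewrite -addSn dvdn_addl.
  case: ifP => [/dvdnP[[//|k] nk]|nm].
    rewrite -addSn nk mulnK// -mulSnr mulnK//.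
    have -> : (if (m <= n)%N then if (m %| (n - m).+1)%N then c ((n - m).+1 %/ m)%N
        else 0 else 0) = c k.
      case: ifP => mn.
        have -> : ((n - m).+1 = k * m)%N by rewrite -subSn// nk mulSn addKn.
        by rewrite dvdn_mull// mulnK.
      case: k nk => [|k] nk; first by [].
      move: mn; rewrite -ltnS nk !mulSn; lia.
    rewrite /c eigen_seqSS !natrM invfM.
    have -> : (k.+1%:R * m%:R * (k.+2%:R^-1 * m%:R^-1) : R) = k.+1%:R / k.+2%:R.
      have m1 : m%:R != 0 :> R by rewrite pnatr_eq0 -lt0n.
      by rewrite mulrACA divff// mulr1.
    rewrite mulrA -rmorphM /= mulrA divfK ?pnatr_eq0// divff ?pnatr_eq0// mul1r.
    by rewrite subrK subrr.
  rewrite mulr0 add0r mulr0 subr0; case: ifP => mn; last by rewrite mulr0.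
  rewrite ifF ?mulr0//; rewrite -subSn// -nm.
  by rewrite -{2}(subnK (leqW mn)) dvdn_addl.
Qed.

End Eigenvectors.

Section BergmanCoefficients.
Context {R : realType}.
Local Notation C := R[i].
Local Notation L2a := (bergman R).
Local Notation plane := (measurableTypeR R * measurableTypeR R)%type.
Implicit Types (f g h : L2a) (a b : nat -> C).

Lemma powser_eq0 a : coef_bounded a ->
  (forall z, normc z < 1 -> powser a z = 0) -> a = (fun=> 0).
Proof.
move=> ba a0; apply/funext => n; apply/eqP; rewrite -normc_eq0.
rewrite eq_le normc_ge0 andbT.
have h0 : 0 < 2^-1 :> R by rewrite invr_gt0.
have h1 : 2^-1 < 1 :> R by rewrite invf_lt1// ltr1n.
have := @cauchy_estimate R (fun=> 0) a 1 2^-1 0 n ltr01 h0.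
rewrite pmulr_lle0 ?exprn_gt0//; apply.
- by move=> z _; exact: taylor2_cst.
- by move=> t t1; rewrite -(a0 t t1); exact: powser_cvg.
- by move=> z _; rewrite normc0.
Qed.

Lemma coef_bounded_comb (c : C) a b : coef_bounded a -> coef_bounded b ->
  coef_bounded (fun n => c * a n + b n).
Proof.
move=> ba bb s s01; have [M MP] := ba s s01; have [L LP] := bb s s01.
have /andP[s0 _] := s01.
exists (normc c * M + L) => n.
apply: (@le_trans _ _ ((normc c * normc (a n) + normc (b n)) * s ^+ n)).
  by rewrite ler_wpM2r ?exprn_ge0 ?(ltW s0)// (le_trans (le_normcD _ _))// normcM.
by rewrite mulrDl; apply: lerD => //; rewrite -mulrA ler_wpM2l ?normc_ge0.
Qed.

Lemma powser_comb (c : C) a b z : coef_bounded a -> coef_bounded b ->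
  normc z < 1 -> powser (fun n => c * a n + b n) z = c * powser a z + powser b z.
Proof.
move=> ba bb z1; apply: ccvg_unique (powser_cvg (coef_bounded_comb c ba bb) z1) _.
apply: (@eq_ccvg _ (fun n => c * power_sum a n z + power_sum b n z)).
  move=> n; rewrite /power_sum mulr_sumr -big_split; apply: eq_bigr => k _ /=.
  by rewrite mulrDl mulrA.
by apply: ccvgD; [apply: ccvgMl; exact: powser_cvg | exact: powser_cvg].
Qed.

Lemma powser_inj a b : coef_bounded a -> coef_bounded b ->
  (forall z, normc z < 1 -> powser a z = powser b z) -> a = b.
Proof.
move=> ba bb ab.
have /(congr1 (fun u : nat -> C => u _)) H : (fun n => -1 * a n + b n) = (fun=> 0).
  apply: powser_eq0; first exact: coef_bounded_comb.
  by move=> z z1; rewrite powser_comb// ab// mulN1r addNr.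
apply/funext => n; have := H n; rewrite mulN1r addrC => /eqP.
by rewrite subr_eq0 => /eqP.
Qed.

Lemma powser_shift_up m a z : coef_bounded a -> coef_bounded (shift_up m a) ->
  normc z < 1 -> powser (shift_up m a) z = z ^+ m * powser a z.
Proof.
move=> ba bs z1.
apply: (ccvg_unique (ccvg_shift m (powser_cvg bs z1))).
apply: (@eq_ccvg _ (fun n => z ^+ m * power_sum a n z)); last first.
  by apply: ccvgMl; exact: powser_cvg.
move=> n; rewrite addnC power_sum_shift; last first.
  by move=> k km; rewrite /shift_up leqNgt km.
congr (_ * _); apply: eq_bigr => k _.
by rewrite /shift_up leq_addr addKn.
Qed.

Lemma bergmanP f : [/\ analytic_on (@unit_disk R) f, L2_disk f &
  forall z, ~ unit_disk z -> f z = 0].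
Proof. by have := valP f; rewrite inE. Qed.

Lemma L2_disk_cmeasurable (u : C -> C) : L2_disk u -> measurable_cfun (@disk2 R) u.
Proof. by case. Qed.

Lemma taylor_exists f :
  exists a, wl2 a /\ forall z, normc z < 1 -> f z = powser a z.
Proof.
have [af Lf _] := bergmanP f; have [a [ba fa]] := analytic_disk_powser af.
exists a; split=> //; have [_ _ If] := Lf.
have A0 := @disk_area_gt0 R.
have Ifin := integrable_fin_num (@measurable_disk2 R) If.
pose I := fine (\int[dA]_(p in @disk2 R) (normc (f (cplx p)) ^+ 2)%:E)%E.
exists (I / disk_area 1) => N.
rewrite ler_pdivlMr// mulrC -lee_fin /I fineK//.
by apply: disk_area_wsum_le => //; exact: L2_disk_cmeasurable.
Qed.

Definition taylor f : nat -> C := projT1 (cid (taylor_exists f)).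

Lemma wl2_taylor f : wl2 (taylor f).
Proof. by rewrite /taylor; case: cid => a []. Qed.

Lemma taylorE f z : normc z < 1 -> f z = powser (taylor f) z.
Proof. by rewrite /taylor; case: cid => a [wa fa] /=; exact: fa. Qed.

Lemma coef_bounded_taylor f : coef_bounded (taylor f).
Proof. exact/wl2_coef_bounded/wl2_taylor. Qed.

Lemma taylor_unique f a : coef_bounded a ->
  (forall z, normc z < 1 -> f z = powser a z) -> taylor f = a.
Proof.
move=> ba fa; apply: powser_inj => //; first exact: coef_bounded_taylor.
by move=> z z1; rewrite -taylorE// fa.
Qed.

Lemma bergman_ext f g : (forall z, normc z < 1 -> f z = g z) -> f = g.
Proof.
move=> fg; apply: val_inj; apply/funext => z /=.
have [z1|z1] := ltP (normc z) 1; first exact: fg.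
have zD : ~ unit_disk z by rewrite unit_diskE; apply/negP; rewrite -leNgt.
by have [_ _ f0] := bergmanP f; have [_ _ g0] := bergmanP g; rewrite f0// g0.
Qed.

Lemma taylor_inj : injective taylor.
Proof. by move=> f g fg; apply: bergman_ext => z z1; rewrite !taylorE// fg. Qed.

Lemma bergman_combE (c : C) f g z : (c *: f + g) z = c * f z + g z.
Proof. by []. Qed.

Lemma taylor_comb (c : C) f g :
  taylor (c *: f + g) = (fun n => c * taylor f n + taylor g n).
Proof.
have bf := coef_bounded_taylor f; have bg := coef_bounded_taylor g.
apply: taylor_unique; first exact: coef_bounded_comb.
by move=> z z1; rewrite bergman_combE powser_comb// !taylorE.
Qed.

Lemma taylorZ (c : C) f : taylor (c *: f) = (fun n => c * taylor f n).
Proof.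
have bf := coef_bounded_taylor f.
have E : (fun n => c * taylor f n) = (fun n => (c - 1) * taylor f n + taylor f n).
  by apply/funext => n; rewrite mulrBl mul1r subrK.
apply: taylor_unique; first by rewrite E; exact: coef_bounded_comb.
move=> z z1; rewrite E powser_comb// -taylorE// mulrBl mul1r subrK.
by [].
Qed.

Lemma measurable_powser a : coef_bounded a ->
  measurable_cfun (@disk2 R) (powser a).
Proof.
move=> ba; have mps n := measurable_power_sum (@disk2 R) a n.
have part (pr : C -> R) : (forall x y, `|pr x - pr y| <= normc (x - y)) ->
    (forall n, measurable_fun (@disk2 R) (fun p => pr (power_sum a n (cplx p)))) ->
    measurable_fun (@disk2 R) (fun p => pr (powser a (cplx p))).
  move=> prle mpr; apply: (measurable_fun_cvg mpr) => p /unit_diskE p1.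
  apply/cvgrPdist_lt => e e0; have [N NP] := powser_cvg ba p1 e0.
  exists N => // n /NP; apply: le_lt_trans.
  by rewrite distrC.
split; apply: part.
- by move=> x y; rewrite -ReN -ReD; exact: abs_Re_le.
- by move=> n; have [] := mps n.
- by move=> x y; rewrite -ImN -ImD; exact: abs_Im_le.
- by move=> n; have [] := mps n.
Qed.

Lemma bergman_of_seq a : wl2 a -> exists f : L2a, taylor f = a.
Proof.
move=> wa; have ba := wl2_coef_bounded wa.
pose u (z : C) := if normc z < 1 then powser a z else 0.
have uE z : normc z < 1 -> u z = powser a z by rewrite /u => ->.
have mu : measurable_cfun (@disk2 R) u.
  have [m1 m2] := measurable_powser ba.
  by split; [move: m1 | move: m2]; apply: eq_measurable_fun => p /set_mem/unit_diskE p1;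
    rewrite uE.
have bu : u \in @bergman_pred R.
  rewrite inE; split.
  - move=> z0 /unit_diskE z1; have [b bP] := powser_recenter ba z1.
    exists (1 - normc z0), b; split; first by rewrite subr_gt0.
    move=> z; rewrite normc_normr ltcR => zz0.
    have -> : u z = powser a (z0 + (z - z0)).
      rewrite addrC subrK uE//; have := le_normcD (z - z0) z0.
      by rewrite subrK; lra.
    have H := (ccvgP _ _).2 (bP _ zz0).
    have -> // : [series b k * (z - z0) ^+ k]_k = power_sum b ^~ (z - z0).
    by apply/funext => n; exact: cseriesE.
  - case: (mu) => m1 m2; split=> //.
    apply/integrableP; split; first by apply/measurable_EFinP; exact: measurable_normc2.
    apply: le_lt_trans (_ : (_ <= (disk_area 1 * ip a a)%:E)%E) _; last exact: ltry.
    apply: le_trans (disk_area_ip_ge wa mu uE).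
    rewrite le_eqVlt; apply/orP; left; apply/eqP; apply: eq_integral => p _.
    by rewrite gee0_abs// lee_fin sqr_ge0.
  - by move=> z /unit_diskE zD; rewrite /u ifF//; apply/negbTE/negP.
by exists (Bergman bu); apply: taylor_unique.
Qed.

End BergmanCoefficients.

Section ToeplitzCoefficients.
Context {R : realType}.
Local Notation C := R[i].
Local Notation L2a := (bergman R).
Implicit Types (f g h : L2a) (u v : C -> C).

Lemma L2_innerE u v :
  L2_inner u v = cintegral (@disk2 R) (fun z => u z * conjc (v z)).
Proof. by []. Qed.

Lemma cintegrable_L2 u v : L2_disk u -> L2_disk v ->
  cintegrable (@disk2 R) (fun z => u z * conjc (v z)).
Proof.
move=> [ru ju iu] [rv jv iv]; have mD := @measurable_disk2 R.
have [m1 m2] := measurable_cfunM (conj ru ju : measurable_cfun _ u)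
  (measurable_cfunJ (conj rv jv : measurable_cfun _ v)).
have bound z : normc (u z * conjc (v z)) <= normc (u z) ^+ 2 + normc (v z) ^+ 2.
  rewrite normcM normcJ_eq; have := sqr_ge0 (normc (u z) - normc (v z)).
  rewrite sqrrB; have := sqr_ge0 (normc (u z)); have := sqr_ge0 (normc (v z)).
  lra.
have iuv := integrableD mD iu iv.
have n2 z : 0 <= normc (u z) ^+ 2 + normc (v z) ^+ 2 by rewrite addr_ge0 ?sqr_ge0.
split; apply: (le_integrable mD _ _ iuv); try exact/measurable_EFinP.
- move=> p _; rewrite -EFinD /= lee_fin [leRHS]ger0_norm ?n2//.
  exact: le_trans (abs_Re_le _) (bound _).
- move=> p _; rewrite -EFinD /= lee_fin [leRHS]ger0_norm ?n2//.
  exact: le_trans (abs_Im_le _) (bound _).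
Qed.

Lemma bergman_L2 f : L2_disk f.
Proof. by have [] := bergmanP f. Qed.

Lemma Re_L2_inner_sq f :
  complex.Re (L2_inner f f) = disk_area 1 * ip (taylor f) (taylor f).
Proof.
have Lf := bergman_L2 f; have wf := wl2_taylor f.
have mf := L2_disk_cmeasurable Lf; have fE := @taylorE _ f.
have A0 := @disk_area_gt0 R.
rewrite /L2_inner /= /Rintegral.
have -> : (\int[dA]_(p in @disk2 R) (complex.Re (f (cplx p) * conjc (f (cplx p))))%:E =
    \int[dA]_(p in @disk2 R) (normc (f (cplx p)) ^+ 2)%:E)%E.
  by apply: eq_integral => p _; rewrite Re_mulcJ.
have [_ _ If] := Lf.
have Ifin := integrable_fin_num (@measurable_disk2 R) If.
have le1 := disk_area_ip_ge wf mf fE.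
have le2 N := disk_area_wsum_le N (coef_bounded_taylor f) mf fE.
move: Ifin le1 le2; set I := (\int[dA]_(p in _) _)%E => Ifin le1 le2.
apply/eqP; rewrite eq_le; apply/andP; split.
  by rewrite -lee_fin fineK.
rewrite mulrC -ler_pdivlMr//; apply: ip_le => N.
by rewrite ler_pdivlMr// mulrC -lee_fin fineK.
Qed.

Lemma L2_norm_sq f : L2_norm f = Num.sqrt (disk_area 1 * ip (taylor f) (taylor f)).
Proof. by rewrite /L2_norm Re_L2_inner_sq. Qed.

Lemma Re_L2_inner f g :
  complex.Re (L2_inner f g) = disk_area 1 * ip (taylor f) (taylor g).
Proof.
have wf := wl2_taylor f; have wg := wl2_taylor g.
have Lf := bergman_L2 f; have Lg := bergman_L2 g; have mD := @measurable_disk2 R.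
have iff := cintegrable_L2 Lf Lf; have ifg := cintegrable_L2 Lf Lg.
have igf := cintegrable_L2 Lg Lf; have igg := cintegrable_L2 Lg Lg.
have E : L2_inner (1 *: f + g : L2a) (1 *: f + g : L2a) =
    L2_inner f f + L2_inner f g + (L2_inner g f + L2_inner g g).
  rewrite !L2_innerE.
  rewrite -!cintegralD//; try exact: cintegrableD.
  apply: eq_cintegral => p _; rewrite !bergman_combE !mul1r rmorphD /=; ring.
have S : complex.Re (L2_inner g f) = complex.Re (L2_inner f g).
  apply: eq_Rintegral => p _; rewrite !ReM !ReJ !ImJ; ring.
have := Re_L2_inner_sq (1 *: f + g); rewrite E taylor_comb.
have -> : (fun n => 1 * taylor f n + taylor g n) = (fun n => taylor f n + taylor g n).
  by apply/funext => n; rewrite mul1r.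
rewrite ip_sqD// !ReD S (Re_L2_inner_sq f) (Re_L2_inner_sq g) !mulrDr; lra.
Qed.

Lemma Im_L2_inner u h : complex.Im (L2_inner u h) = complex.Re (L2_inner u ('i%C *: h : L2a)).
Proof.
apply: eq_Rintegral => p _.
rewrite -[(_ *: _ : L2a) (cplx p)]/('i%C * h (cplx p)) rmorphM.
move: (u _) (h _) => [a b] [c d] /=; ring.
Qed.

Lemma L2_inner_eq0 f : (forall h, L2_inner f h = 0) -> f = 0.
Proof.
move=> /(_ f)/(congr1 (@complex.Re R)); rewrite Re_L2_inner_sq /= => /eqP.
rewrite mulf_eq0 gt_eqF ?disk_area_gt0//= => /eqP f0.
have t0 := ip_eq0 (wl2_taylor f) f0.
apply: bergman_ext => z z1; rewrite taylorE// t0.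
apply: ccvg_unique (powser_cvg _ z1) _.
  by rewrite -t0; exact: coef_bounded_taylor.
apply: (@eq_ccvg _ (fun=> 0)); last exact: ccvg_cst.
by move=> n; rewrite /power_sum big1// => k _; rewrite mul0r.
Qed.

Variables (m : nat) (alpha beta : C) (phi : C -> C).
Hypothesis hphi : forall z, unit_disk z ->
  phi z = (conjc z) ^+ m + alpha * z ^+ m + beta.

Lemma eq_L2_disk u v : (forall z, unit_disk z -> u z = v z) -> L2_disk u -> L2_disk v.
Proof.
move=> uv [m1 m2 iu]; have mD := @measurable_disk2 R; split.
- by move: m1; apply: eq_measurable_fun => p /set_mem/uv ->.
- by move: m2; apply: eq_measurable_fun => p /set_mem/uv ->.
- by move: iu; apply: eq_integrable => // p /set_mem/uv ->.
Qed.

Lemma L2_disk_conjX f : L2_disk (fun z => conjc z ^+ m * f z).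
Proof.
have [r j i] := bergman_L2 f; have mD := @measurable_disk2 R.
have mfun := measurable_cfunM
  (measurable_cfunX m (measurable_cfunJ (measurable_cfun_id (@disk2 R))))
  (conj r j : measurable_cfun _ f).
case: (mfun) => m1 m2; split => //.
have key z : normc z < 1 ->
    normc (conjc z ^+ m * f z) ^+ 2 <= normc (f z) ^+ 2.
  move=> z1; rewrite normcM exprMn normcX normcJ_eq ler_piMl ?sqr_ge0//.
  by rewrite exprn_ile1 ?exprn_ge0 ?normc_ge0// exprn_ile1 ?normc_ge0// ltW.
apply: (le_integrable mD _ _ i); first by apply/measurable_EFinP; exact: (measurable_normc2 mfun).
by move=> p /unit_diskE/key H; rewrite /= lee_fin !ger0_norm ?sqr_ge0.
Qed.

Lemma bergman_mulX f : exists g, taylor g = shift_up m (taylor f) /\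
  forall z, normc z < 1 -> g z = z ^+ m * f z.
Proof.
have wU := wl2_shift_up m (wl2_taylor f).
have [g gE] := bergman_of_seq wU; exists g; split=> // z z1.
rewrite taylorE// gE powser_shift_up ?taylorE//; last exact: wl2_coef_bounded.
exact: coef_bounded_taylor.
Qed.

Lemma L2_disk_symbol f : L2_disk (phi \* f).
Proof.
have [g [_ gE]] := bergman_mulX f.
apply: (@eq_L2_disk (fun z => 1 * (conjc z ^+ m * f z) +
    (alpha *: g + beta *: f : L2a) z)); last first.
  by apply: L2_disk_comb; [exact: L2_disk_conjX | exact: bergman_L2].
move=> z zD; have z1 := (unit_diskE z).1 zD.
have -> : (alpha *: g + beta *: f : L2a) z = alpha * g z + beta * f z by [].
by rewrite gE// -[(phi \* f) z]/(phi z * f z) hphi//; ring.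
Qed.

Lemma taylor_toeplitz f :
  taylor (toeplitz phi f) = seq_toeplitz m alpha (- beta) (taylor f).
Proof.
have wf := wl2_taylor f.
have [g gE] := bergman_of_seq (wl2_seq_toeplitz m alpha (- beta) wf).
have [fm [fmT fmE]] := bergman_mulX f.
have mD := @measurable_disk2 R.
suff -> : toeplitz phi f = g by [].
pose G : L2a := alpha *: fm + (beta *: f + (-1) *: g).
have GT : taylor G = (fun n => (-1 : R)%:C * shift_down m (taylor f) n).
  rewrite /G !taylor_comb taylorZ gE fmT; apply/funext => n.
  rewrite /seq_toeplitz rmorphN1; ring.
have Re0 h : complex.Re (L2_inner ((phi \* f) \- g) h) = 0.
  have [hm [hmT hmE]] := bergman_mulX h.
  have -> : L2_inner ((phi \* f) \- g) h = L2_inner f hm + L2_inner G h.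
    rewrite !L2_innerE -cintegralD//; try
      by apply: cintegrable_L2; exact: bergman_L2.
    apply: eq_cintegral => p pD; have p1 := (unit_diskE _).1 pD.
    rewrite -[G _]/(alpha * fm (cplx p) + (beta * f (cplx p) + -1 * g (cplx p))).
    rewrite hmE// fmE// -[((_ \* _) \- _) _]/(phi (cplx p) * f (cplx p) - g (cplx p)).
    rewrite hphi//; move: (cplx p) => z; rewrite rmorphM rmorphXn /=; ring.
  rewrite ReD !Re_L2_inner hmT GT ipZl; last 2 first.
  - exact: wl2_shift_down.
  - exact: wl2_taylor.
  by rewrite ip_shift//; [ring | exact: wl2_taylor].
have Pg h : L2_inner ((phi \* f) \- g) h = 0.
  by apply: complex_eqP; rewrite ?Im_L2_inner Re0.
apply: xget_unique => // y Py.
have L y' : L2_disk ((phi \* f) \- (y' : L2a)).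
  apply: (@eq_L2_disk (fun z => (-1) * y' z + (phi \* f) z)).
    by move=> z _; rewrite mulN1r addrC.
  by apply: L2_disk_comb; [exact: bergman_L2 | exact: L2_disk_symbol].
have : (-1) *: y + g = 0 :> L2a.
  apply: L2_inner_eq0 => h.
  transitivity (L2_inner ((phi \* f) \- y) h + (-1) * L2_inner ((phi \* f) \- g) h).
    rewrite !L2_innerE -cintegralZ//; last first.
      by apply: cintegrable_L2; [exact: L | exact: bergman_L2].
    rewrite -cintegralD//; last 2 first.
    - by apply: cintegrable_L2; [exact: L | exact: bergman_L2].
    - by apply: cintegrableZ => //; apply: cintegrable_L2; [exact: L | exact: bergman_L2].
    apply: eq_cintegral => p _; rewrite bergman_combE /=; ring.
  by rewrite Pg (Py h) mulr0 addr0.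
by move=> /eqP; rewrite scaleN1r addrC subr_eq0 => /eqP ->.
Qed.

End ToeplitzCoefficients.

Section Spectrum.
Context {R : realType}.
Local Notation C := R[i].
Local Notation L2a := (bergman R).

Lemma closureP (A : set C) (l : C) : closure A l <->
  forall e : R, 0 < e -> exists2 z, A z & normc (z - l) < e.
Proof.
split=> [Al e e0|Al B].
  have [|z [Az]] := Al (ball l e%:C).
    by apply: nbhsx_ballx; rewrite ltcR.
  by rewrite /ball /= normc_normr ltcR normcB; exists z.
move=> /nbhs_ballP[e /=]; rewrite ltcE /= => /andP[/eqP ie re] eB.
have [z Az zl] := Al _ re; exists z; split=> //; apply: eB.
by rewrite /ball /= normc_normr ltcE /= ie eqxx normcB.
Qed.

Lemma complex_rootX (m : nat) (w : C) : (0 < m)%N -> exists z, z ^+ m = w.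
Proof.
move=> m0; have [z] := solve_monicpoly (fun i => if i == 0%N then w else 0 : C) m0.
rewrite -(prednK m0) big_ord_recl /= expr0 mulr1 big1 ?addr0; first by exists z.
by move=> i _; rewrite mul0r.
Qed.

Definition ellipse (al w : C) : C := conjc w + al * w.

Lemma ellipse_comb (al w v : C) (s : R) :
  ellipse al (w + s%:C * (v - w)) =
  ellipse al w + s%:C * (ellipse al v - ellipse al w).
Proof.
by case: al w v => [a b] [c d] [x y]; apply: complex_eqP => /=; ring.
Qed.

Lemma ellipse_dist (al w t : C) :
  normc (ellipse al (w + t) - ellipse al w) <= (1 + normc al) * normc t.
Proof.
have -> : ellipse al (w + t) - ellipse al w = conjc t + al * t.
  by rewrite /ellipse rmorphD /=; ring.
by rewrite (le_trans (le_normcD _ _))// normcJ_eq normcM mulrDl mul1r.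
Qed.

Lemma Re_le0_of_shortest (u D : C) :
  (forall s : R, 0 < s <= 1 -> normc u <= normc (u - s%:C * D)) ->
  complex.Re (conjc u * D) <= 0.
Proof.
move=> H; rewrite leNgt; apply/negP => P0.
set P := complex.Re _ in P0.
pose N := normc D ^+ 2 + P; have D0 := sqr_ge0 (normc D).
have N0 : 0 < N by rewrite /N; lra.
pose s := P / N; have s0 : 0 < s by rewrite divr_gt0.
have s1 : s <= 1 by rewrite ler_pdivrMr// mul1r /N; lra.
have := H s; rewrite s0 s1 => /(_ isT).
rewrite -(@ler_pXn2r _ 2%N)// ?nnegrE ?normc_ge0//.
have -> : normc (u - s%:C * D) ^+ 2 =
    normc u ^+ 2 - s * (2 * P - s * normc D ^+ 2).
  rewrite /P !normc2E; case: (u) (D) => [a b] [c d] /=; ring.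
have sN : s * N = P by rewrite divfK// gt_eqF.
have : s * normc D ^+ 2 < 2 * P.
  have : s * normc D ^+ 2 <= s * N by rewrite ler_wpM2l ?(ltW s0)// /N; lra.
  by rewrite sN; lra.
move=> h; have : 0 < s * (2 * P - s * normc D ^+ 2) by rewrite mulr_gt0// subr_gt0.
lra.
Qed.

Lemma ellipse_separation (al l : C) (e : R) : 0 < e ->
  (forall w, normc w < 1 -> e <= normc (l - ellipse al w)) ->
  exists (d : C) (eta : R), 0 < eta /\
    normc (d + al * conjc d) + eta <= complex.Re (conjc d * l).
Proof.
move=> e0 far.
have [|w0 w01 w0max] := @closed_disk_max _ 1 (fun w => - normc (l - ellipse al w)) ler01.
  move=> w w1 x x0; have K0 : 0 < 1 + normc al by rewrite ltr_pwDl ?normc_ge0.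
  exists (x / (1 + normc al)) => [|t]; first by rewrite divr_gt0.
  rewrite ltr_pdivlMr// mulrC => tx; apply: le_lt_trans tx.
  apply: le_trans (ellipse_dist al w t); rewrite ler_norml.
  have := le_normc_dist l (ellipse al w) (ellipse al (w + t)).
  have := le_normc_dist l (ellipse al (w + t)) (ellipse al w).
  rewrite [normc (ellipse al w - _)]normcB; lra.
pose d := l - ellipse al w0.
have dmin w : normc w <= 1 -> normc d <= normc (l - ellipse al w).
  by move=> /w0max; rewrite lerN2.
have d0 : 0 < normc d.
  rewrite lt_neqAle normc_ge0 andbT eq_sym; apply/eqP => d00.
  have K0 : 0 < 1 + normc al by rewrite ltr_pwDl ?normc_ge0.
  pose t := Num.min 1 (e / 2 / (1 + normc al)).
  have t0 : 0 < t by rewrite /t lt_min ltr01 !divr_gt0.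
  have t1 : t <= 1 by rewrite /t ge_min lexx.
  have tK : t * (1 + normc al) <= e / 2.
    by rewrite -ler_pdivlMr// /t ge_min lexx orbT.
  pose w := (1 - t)%:C * w0.
  have w1 : normc w < 1.
    rewrite /w normcM normc_real ger0_norm ?subr_ge0//.
    by apply: le_lt_trans (_ : (1 - t) * 1 < 1); [rewrite ler_wpM2l ?subr_ge0 | lra].
  have := far _ w1; have := le_normc_dist l (ellipse al w0) (ellipse al w).
  rewrite -/d d00 add0r => h1 h2.
  have := ellipse_dist al w0 (- t%:C * w0).
  have -> : w0 + - t%:C * w0 = w by rewrite /w rmorphB rmorph1; ring.
  rewrite normcB normcM normcN normc_real gtr0_norm// => h3.
  have h4 : (1 + normc al) * (t * normc w0) <= (1 + normc al) * t.
    by rewrite ler_wpM2l ?(ltW K0)// ler_piMr// ltW.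
  lra.
have half w : normc w <= 1 ->
    complex.Re (conjc d * (ellipse al w - ellipse al w0)) <= 0.
  move=> w1; apply: Re_le0_of_shortest => s /andP[s0 s1].
  have -> : d - s%:C * (ellipse al w - ellipse al w0) =
      l - ellipse al (w0 + s%:C * (w - w0)).
    by rewrite ellipse_comb /d; ring.
  apply: dmin; have -> : w0 + s%:C * (w - w0) = (1 - s)%:C * w0 + s%:C * w.
    by rewrite rmorphB rmorph1; ring.
  apply: le_trans (le_normcD _ _) _; rewrite !normcM !normc_real.
  rewrite !ger0_norm ?subr_ge0//; last exact: ltW.
  have h1 : (1 - s) * normc w0 <= (1 - s) * 1 by rewrite ler_wpM2l ?subr_ge0.
  have h2 : s * normc w <= s * 1 by rewrite ler_wpM2l// ltW.
  lra.
exists d, (normc d ^+ 2); split; first by rewrite exprn_gt0.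
set k := d + al * conjc d.
have kE w : complex.Re (conjc d * ellipse al w) = complex.Re (k * w).
  rewrite /k /ellipse; case: (d) (al) (w) => [a b] [c x] [y z] /=; ring.
have [w w1 wk] : exists2 w, normc w <= 1 & complex.Re (k * w) = normc k.
  have [k0|k0] := eqVneq k 0.
    by exists 0; rewrite ?normc0// k0 mul0r normc0.
  have nk : normc k != 0 by rewrite normc_eq0.
  exists (conjc k / (normc k)%:C).
    by rewrite normcM normcV normcJ_eq normc_real ger0_norm ?normc_ge0// divff.
  rewrite mulrA mulcJ -fmorphV -rmorphM /=.
  by rewrite expr2 mulfK.
have := half w w1; rewrite mulrBr ReD ReN kE wk.
have -> : complex.Re (conjc d * l) =
    complex.Re (conjc d * ellipse al w0) + normc d ^+ 2.
  have -> : l = ellipse al w0 + d by rewrite /d addrC subrK.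
  by rewrite mulrDr ReD [conjc d * d]mulrC Re_mulcJ.
lra.
Qed.

End Spectrum.

Section SpectrumInclusions.
Context {R : realType}.
Local Notation C := R[i].
Local Notation L2a := (bergman R).
Implicit Types (a x : nat -> C) (f g : L2a).
Variables (m : nat) (al be : C) (phi : C -> C).
Hypothesis m0 : (0 < m)%N.
Hypothesis hphi : forall z, unit_disk z ->
  phi z = (conjc z) ^+ m + al * z ^+ m + be.

Lemma taylor_toeplitz_sub (l : C) f :
  taylor (toeplitz phi f - l *: f) = seq_toeplitz m al (l - be) (taylor f).
Proof.
have -> : toeplitz phi f - l *: f = (- l) *: f + toeplitz phi f.
  by rewrite scaleNr addrC.
rewrite taylor_comb (taylor_toeplitz hphi); apply/funext => n.
by rewrite /seq_toeplitz; ring.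
Qed.

Lemma spectrum_sub_closure :
  spectrum (toeplitz phi) `<=` closure (phi @` (@unit_disk R)).
Proof.
move=> l; apply: contraPP => /closureP ncl.
have [e e0 far] : exists2 e : R, 0 < e &
    forall z, normc z < 1 -> e <= normc (phi z - l).
  apply: contrapT => nfar; apply: ncl => e e0; apply: contrapT => nz.
  apply: nfar; exists e => // z z1; rewrite leNgt; apply/negP => zl.
  by apply: nz; exists (phi z) => //; exists z => //; apply/unit_diskE.
have farE w : normc w < 1 -> e <= normc ((l - be) - ellipse al w).
  move=> w1; have [z zw] := complex_rootX w m0.
  have z1 : normc z < 1.
    rewrite ltNge; apply/negP => z1; move: w1; rewrite -zw normcX ltNge.
    by rewrite exprn_ege1.
  have := far _ z1; rewrite hphi; last exact/unit_diskE.
  have -> : l - be - ellipse al w = l - (conjc z ^+ m + al * z ^+ m + be).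
    by rewrite /ellipse -zw rmorphXn /=; ring.
  by rewrite normcB.
have [d [eta [eta0 sep]]] := ellipse_separation e0 farE.
have [inj [K surj]] := seq_toeplitz_invertible m eta0 sep.
pose T f := toeplitz phi f - l *: f.
have tT f : taylor (T f) = seq_toeplitz m al (l - be) (taylor f).
  exact: taylor_toeplitz_sub.
have T_inj f g : T f = T g -> f = g.
  move=> fg; apply/eqP; rewrite -subr_eq0; apply/eqP; apply: taylor_inj.
  have -> : f - g = (-1) *: g + f by rewrite scaleN1r addrC.
  have t0 : taylor (0 : L2a) = (fun=> 0).
    by rewrite -(scale0r 0) taylorZ; apply/funext => n; rewrite mul0r.
  rewrite t0; apply: inj; first exact: wl2_taylor.
  rewrite taylor_comb seq_toeplitzD seq_toeplitzZ -!tT fg.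
  by apply/funext => n; rewrite mulN1r addNr.
have T_surj g : exists f, T f = g /\
    ip (taylor f) (taylor f) <= K * ip (taylor g) (taylor g).
  have [x [wx xE xK]] := surj _ (wl2_taylor g).
  have [f fx] := bergman_of_seq wx; exists f; rewrite fx; split=> //.
  by apply: taylor_inj; rewrite tT fx.
apply; pose S g := projT1 (cid (T_surj g)).
have TS g : T (S g) = g by rewrite /S; case: cid => f [].
have SK g : ip (taylor (S g)) (taylor (S g)) <= K * ip (taylor g) (taylor g).
  by rewrite /S; case: cid => f [].
have T_lin (c : C) f g : T (c *: f + g) = c *: T f + T g.
  apply: taylor_inj; rewrite tT !taylor_comb !tT seq_toeplitzD seq_toeplitzZ.
  by [].
exists S; split.
- split=> [c f g|]; first by apply: T_inj; rewrite T_lin !TS.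
  exists (Num.sqrt `|K|) => g; rewrite !L2_norm_sq -sqrtrM// ler_wsqrtr//.
  have A0 := @disk_area_gt0 R; rewrite mulrCA ler_wpM2l ?(ltW A0)//.
  apply: le_trans (SK g) _; rewrite ler_wpM2r ?ler_norm// ip_ge0//.
  exact: wl2_taylor.
- by move=> f; apply: T_inj; exact: TS.
- exact: TS.
Qed.

Lemma ip_seq_toeplitz_adj (k : C) x a : wl2 x -> wl2 a ->
  ip (seq_toeplitz m al k x) a =
  ip x (fun n => shift_up m a n + conjc al * shift_down m a n - conjc k * a n).
Proof.
move=> wx wa.
have wBx := wl2_shift_down m wx; have wUx := wl2Z al (wl2_shift_up m wx).
have wUa := wl2_shift_up m wa; have wBa := wl2Z (conjc al) (wl2_shift_down m wa).
have wkx := wl2Z (- k) wx; have wka := wl2Z (conjc (- k)) wa.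
have -> : seq_toeplitz m al k x =
    (fun n => (shift_down m x n + al * shift_up m x n) + - k * x n).
  by apply/funext => n; rewrite /seq_toeplitz mulNr.
have -> : (fun n => shift_up m a n + conjc al * shift_down m a n - conjc k * a n) =
    (fun n => (shift_up m a n + conjc al * shift_down m a n) + conjc (- k) * a n).
  by apply/funext => n; rewrite rmorphN /= mulNr.
rewrite (ipDl (wl2D wBx wUx) wkx wa) (ipDl wBx wUx wa).
rewrite [RHS]ipC (ipDl (wl2D wUa wBa) wka wx) (ipDl wUa wBa wx).
rewrite ip_shift// [ip x (shift_up m a)]ipC; congr (_ + _ + _).
  rewrite ip_adj [LHS]ipC -ip_shift//; last exact: wl2Z.
  by rewrite shift_downZ.
by rewrite ip_adj ipC.
Qed.

(* Approximate eigenvectors of the operator (if |al| <= 1) or exact ones of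
   its adjoint (if |al| > 1) prevent invertibility. *)
Lemma closure_sub_spectrum :
  closure (phi @` (@unit_disk R)) `<=` spectrum (toeplitz phi).
Proof.
move=> l /closureP cl [S [[_ [M SM]] ST TS]].
set k := l - be.
set e := (4 * (M ^+ 2 + 1))^-1.
have M1 : 0 < 4 * (M ^+ 2 + 1) by have := sqr_ge0 M; lra.
have e0 : 0 < e by rewrite invr_gt0.
have eM : e * (4 * (M ^+ 2 + 1)) = 1 by rewrite mulVf// gt_eqF.
have [w w1 we] : exists2 w, normc w < 1 & normc (ellipse al w - k) < e.
  have [_ [z zD <-] zl] := cl _ e0; exists (z ^+ m).
    rewrite normcX exprn_ilt1 ?normc_ge0 -?lt0n//; exact/unit_diskE.
  move: zl; rewrite hphi// /ellipse /k rmorphXn /= opprB.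
  by rewrite [be - l]addrC addrA addrAC.
have A0 := @disk_area_gt0 R.
have SMip f : ip (taylor (S f)) (taylor (S f)) <= M ^+ 2 * ip (taylor f) (taylor f).
  have := SM f; rewrite !L2_norm_sq => h.
  have i0 g : 0 <= disk_area 1 * ip (taylor g) (taylor g).
    by rewrite mulr_ge0 ?(ltW A0)// ip_ge0//; exact: wl2_taylor.
  have : Num.sqrt (disk_area 1 * ip (taylor (S f)) (taylor (S f))) ^+ 2 <=
      (M * Num.sqrt (disk_area 1 * ip (taylor f) (taylor f))) ^+ 2.
    by rewrite lerXn2r ?nnegrE ?sqrtr_ge0// (le_trans _ h)// sqrtr_ge0.
  by rewrite exprMn !sqr_sqrtr// mulrCA ler_pM2l.
have pos a : wl2 a -> a <> (fun=> 0) -> 0 < ip a a.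
  move=> wa a0; rewrite lt_neqAle ip_ge0// andbT eq_sym; apply/eqP => h.
  by apply: a0; exact: ip_eq0.
have [al1|al1] := leP (normc al) 1.
  pose al' := (1 - e)%:C * al.
  have e1 : e < 1.
    by have : e * 1 < e * (4 * (M ^+ 2 + 1)); [rewrite ltr_pM2l//; have := sqr_ge0 M; lra | rewrite eM mulr1].
  have al'1 : normc al' < 1.
    rewrite /al' normcM normc_real ger0_norm ?subr_ge0 ?(ltW e1)//.
    apply: le_lt_trans (_ : (1 - e) * 1 < 1); last by lra.
    by rewrite ler_wpM2l// subr_ge0 ltW.
  have [a [wa a0 aE]] := seq_toeplitz_eigenvector m0 al'1 w1.
  have [f fa] := bergman_of_seq wa.
  have wU := wl2_shift_up m wa.
  have := SMip (toeplitz phi f - l *: f); rewrite ST taylor_toeplitz_sub fa -/k.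
  have -> : seq_toeplitz m al k a =
      (fun n => (al - al') * shift_up m a n + (ellipse al' w - k) * a n).
    apply/funext => n; have := congr1 (fun u => u n) aE.
    rewrite /seq_toeplitz -/(ellipse al' w) => h.
    by rewrite -[LHS]subr0 -h; ring.
  have n1 : normc (al - al') <= e.
    have -> : al - al' = e%:C * al by rewrite /al' rmorphB rmorph1; ring.
    by rewrite normcM normc_real gtr0_norm// ler_piMr// ltW.
  have n2 : normc (ellipse al' w - k) <= 2 * e.
    have -> : ellipse al' w - k = (ellipse al w - k) + (al' - al) * w.
      by rewrite /ellipse; ring.
    apply: le_trans (le_normcD _ _) _; rewrite normcM [normc (al' - _)]normcB.
    have : normc (al - al') * normc w <= e * 1.
      by apply: ler_pM; rewrite ?normc_ge0// ltW.
    lra.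
  have := ip_sqD_le (wl2Z (al - al') wU) (wl2Z (ellipse al' w - k) wa) ltr01.
  rewrite !ip_scale// invr1; have := ip_shift_up_le m wa; have := pos _ wa a0.
  set s := ip a a; set u := ip (shift_up m a) _; set T := ip (fun n => _ + _) _.
  move=> s0 us TP; apply/negP; rewrite -ltNge.
  have h1 : normc (al - al') ^+ 2 * u <= e ^+ 2 * s.
    apply: le_trans (_ : normc (al - al') ^+ 2 * s <= _).
      by rewrite ler_wpM2l// sqr_ge0.
    by rewrite ler_wpM2r ?(ltW s0)// lerXn2r ?nnegrE ?normc_ge0// ltW.
  have h2 : normc (ellipse al' w - k) ^+ 2 * s <= (2 * e) ^+ 2 * s.
    rewrite ler_wpM2r ?(ltW s0)// lerXn2r ?nnegrE ?normc_ge0//.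
    by rewrite mulr_ge0// ltW.
  have TP' : T <= 10 * e ^+ 2 * s.
    apply: le_trans TP _; have -> : 10 * e ^+ 2 * s =
      (1 + 1) * (e ^+ 2 * s) + (1 + 1) * ((2 * e) ^+ 2 * s) by ring.
    by apply: lerD; rewrite ler_wpM2l.
  apply: le_lt_trans (_ : M ^+ 2 * (10 * e ^+ 2 * s) < s).
    by rewrite ler_wpM2l// sqr_ge0.
  have -> : M ^+ 2 * (10 * e ^+ 2 * s) = (10 * (M ^+ 2 * e) * e) * s by ring.
  rewrite gtr_pMl//.
  have Me : M ^+ 2 * e <= 4^-1.
    have -> : M ^+ 2 * e = 4^-1 - e by have := eM; lra.
    by lra.
  have e4 : e <= 4^-1.
    have : 0 <= M ^+ 2 * e by rewrite mulr_ge0 ?sqr_ge0// ltW.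
    have := eM; lra.
  have : M ^+ 2 * e * e <= 4^-1 * 4^-1.
    apply: ler_pM => //; [|exact: ltW].
    by apply: mulr_ge0; [exact: sqr_ge0 | exact: ltW].
  rewrite -mulrA; lra.
have nal0 : 0 < normc al by apply: lt_trans al1.
have al0 : conjc al != 0 by rewrite -normc_gt0 normcJ_eq.
have ial1 : normc (conjc al)^-1 < 1 by rewrite normcV normcJ_eq invf_lt1.
have [a [wa a0 aE]] := seq_toeplitz_eigenvector m0 ial1 w1.
have [f fa] := bergman_of_seq wa.
have tS : seq_toeplitz m al k (taylor (S f)) = a.
  by rewrite -taylor_toeplitz_sub TS.
have wS := wl2_taylor (S f).
have s0 := pos _ wa a0.
have wca := wl2Z (conjc (ellipse al w - k)) wa.
have E : ip a a = ip (taylor (S f)) (fun n => conjc (ellipse al w - k) * a n).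
  rewrite -{1}tS ip_seq_toeplitz_adj//; congr (ip _ _); apply/funext => n.
  have := congr1 (fun u => conjc al * u n) aE.
  rewrite /seq_toeplitz /= mulr0 mulrBr mulrDr !mulrA divff// mul1r => /eqP.
  rewrite subr_eq0 => /eqP h; rewrite [shift_up m a n + _]addrC h.
  rewrite /ellipse !(rmorphB, rmorphD, rmorphM) /= conjcK mulrDr mulrA divff// mul1r.
  by ring.
have := ip_young wS wca e0; rewrite -E ip_scale// normcJ_eq.
have := SMip f; rewrite fa; set s := ip a a in s0 *; set v := ip _ _ => vs.
have n2 : normc (ellipse al w - k) ^+ 2 <= e ^+ 2.
  by rewrite lerXn2r ?nnegrE ?normc_ge0// ltW.
have h1 : e^-1 * (normc (ellipse al w - k) ^+ 2 * s) <= e * s.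
  apply: le_trans (_ : e^-1 * (e ^+ 2 * s) <= _).
    apply: ler_wpM2l; first by rewrite invr_ge0 ltW.
    by apply: ler_wpM2r => //; exact: ltW.
  by rewrite expr2 !mulrA mulVf ?mul1r// gt_eqF.
have h2 : e * v <= e * (M ^+ 2 * s) by rewrite ler_wpM2l// ltW.
have h3 : (e * (4 * (M ^+ 2 + 1))) * s = s by rewrite eM mul1r.
have h4 : e * (M ^+ 2 * s) + e * s = 4^-1 * s by rewrite -[in RHS]h3; field.
lra.
Qed.

End SpectrumInclusions.

Theorem theorem5p3 (R : realType) (m : nat) (alpha beta : R[i])
    (phi : R[i] -> R[i]) (hm : (1 <= m)%N)
    (hphi : forall z, unit_disk z ->
      phi z = (conjc z) ^+ m + alpha * z ^+ m + beta) :
  spectrum (toeplitz phi) = closure (phi @` unit_disk).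
Proof.
apply/seteqP; split; first exact: spectrum_sub_closure hm hphi.
exact: closure_sub_spectrum hm hphi.
Qed.
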